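(* Let $n\geq 2$, let $M$ be a closed $(n-1)$-connected $m$-manifold, and let $W$ be a coboundary of $M$ over $H^{\leq s}$ for $s := m-3n+1$. Then the restriction of $A_W$ to $\mathcal{B}^{m+1}(M)$ equals $\mathcal{F}_M$.
   Context: Cohomology is rational; manifolds are connected and oriented. A compact $(m+1)$-manifold $W$ with boundary $M$ is a coboundary of $M$ over $H^{\leq s}$ if the restriction map $j\colon H^*(W)\to H^*(M)$ is surjective in degrees $\leq s$. For a graded vector space $V$, $\mathcal{G}^kV$ is the quotient of $V^{\otimes k}$ by graded symmetry relations (transposing adjacent homogeneous factors $x,y$ introduces $(-1)^{|x||y|}$), graded by total degree. Let $E^*\subseteq\mathcal{G}^2H^*(M)$ be the kernel of the map $\mathcal{G}^2H^*(M)\to H^*(M)$ induced by the cup product, and let $\mathcal{B}^{m+1}(M)\subseteq(\mathcal{G}^2E^* )^{m+1}$ be the degree $m+1$ part of the intersection of $\mathcal{G}^2E^*$ with the kernel of the full graded symmetrisation map $\mathcal{G}^2\mathcal{G}^2H^*(M)\to\mathcal{G}^4H^*(M)$. Bianchi-Massey tensor: in the DGA $\Omega_{PL}(M)$ of piecewise linear forms, choose a linear map $\alpha$ assigning closed representatives to cohomology classes, inducing $\alpha^2$ on $\mathcal{G}^2H^*(M)$, and a linear degree $-1$ map $\gamma\colon E^*\to\Omega_{PL}^{*-1}(M)$ with $d\gamma=\alpha^2$ on $E^*$. The map $\mathcal{G}^2E^*\to\Omega_{PL}^{*-1}(M)$, $ee'\mapsto\frac12(\gamma(e)\alpha^2(e')+(-1)^{pq}\gamma(e')\alpha^2(e))$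 for $e\in E^p,e'\in E^q$, takes closed values on $\mathcal{B}^{m+1}(M)$ and induces a map to $H^m(M)$ independent of choices; $\mathcal{F}_M\colon\mathcal{B}^{m+1}(M)\to\mathbb{Q}$ is its composition with integration over $M$. Definition of $A_W$: choose a linear right inverse $r\colon H^{\leq s}(M)\to H^{\leq s}(W)$ of $j$, written $x\mapsto\hat x$. With $M$ $(n-1)$-connected, $E^{\leq n+s}$ is contained in $\mathcal{G}^2H^{\leq s}(M)$, so composing $r$ with the cup product of $W$ gives a map $E^{\leq n+s}\to H^{\leq n+s}(W)$, $e\mapsto\hat e$, which takes values in $H_0^*(W)\subseteq H^*(W)$, the image of the natural map $H^*(W,M)\to H^*(W)$. Also $\mathcal{G}^2E^{\leq n+s}$ and $\mathcal{G}^2E^*$ are equal in degree $\leq m+1$, so there is an induced map $(\mathcal{G}^2E^* )^{m+1}\to(\mathcal{G}^2H_0^*(W))^{m+1}$, $ee'\mapsto\hat e\,\hat e'$. The intersection form of $W$ is the well-defined map $\lambda_W\colon(\mathcal{G}^2H_0^*(W))^{m+1}\to\mathbb{Q}$ sending $ab$ to $\langle u\cup b,[W,M]\rangle$ for any preimage $u\in H^*(W,M)$ of $a$. Then $A_W\colon(\mathcal{G}^2E^* )^{m+1}\to\mathbb{Q}$ is the composition, i.e. $A_W(ee')=\lambda_W(\hat e\,\hat e')$.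
   Formalization: G^k H^*(M) is formed from cohomology in positive degrees only (with H^0, E^{≤n+s} need not lie in G^2H^{≤s}(M)), and M carries the boundary orientation with ∂[W,M] = −[M] (inward normal first); with the outward normal one would get A_W = −F_M. *)

(* Defs.v *)
From HB Require Import structures.
From mathcomp Require Import all_boot all_order all_algebra.
From mathcomp Require Import perm generic_quotient ring_quotient.
From mathcomp Require finmap.
From mathcomp.multinomials Require mpoly monalg.

Set Implicit Arguments.
Unset Strict Implicit.
Unset Printing Implicit Defensive.

Import Order.TTheory GRing.Theory Num.Theory.
Local Open Scope ring_scope.

Module Export FreeModule.
Import finmap monalg.

Definition free_mod (A : nzRingType) (K : choiceType) : Type := {malg A[K]}.

HB.instance Definition _ (A : nzRingType) (K : choiceType) :=
  GRing.Lmodule.on (free_mod A K).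

Definition gen (A : nzRingType) (K : choiceType) (k : K) : free_mod A K := << k >>.

Definition supp (A : nzRingType) (K : choiceType) (c : free_mod A K) : {pred K} :=
  [pred k | c@_k != 0].

(* the additive extension of f to the free abelian group on K *)
Definition zext (K : choiceType) (V : zmodType) (f : K -> V) (c : free_mod int K) : V :=
  \sum_(k <- msupp c) f k *~ c@_k.

End FreeModule.

(* Polynomial differential forms on the standard k-simplex, with barycentric
   coordinates t_0, ..., t_k.  The relations t_0 + ... + t_k = 1 and
   dt_0 + ... + dt_k = 0 are used to eliminate t_0 and dt_0: a form is
   \sum_S w_S dt_S, where S runs over the subsets of {1, ..., k}, dt_S is the
   product of the dt_i (i in S) in increasing order, and w_S is a polynomial in
   t_1, ..., t_k.  The index i : 'I_k stands for i + 1. *)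
Module Export PolynomialForms.
Import mpoly.

Definition pform (k : nat) := {ffun {set 'I_k} -> {mpoly rat[k]}}.

HB.instance Definition _ k := GRing.Lmodule.on (pform k).

Section OneSimplex.
Variable k : nat.
Implicit Types (w e : pform k) (A B S : {set 'I_k}).

Definition pform_homog (p : nat) w : bool :=
  [forall S : {set 'I_k}, (#|S| != p) ==> (w S == 0)].

Definition pform0 (f : {mpoly rat[k]}) : pform k :=
  [ffun S => if S == set0 then f else 0].

(* dt_A dt_B = shuffle_sign A B dt_(A :|: B) for disjoint A, B *)
Definition shuffle_sign A B : rat :=
  (-1) ^+ #|[set ab in setX A B | (ab.2 < ab.1)%N]|.

Definition wedge w e : pform k :=
  [ffun S : {set 'I_k} => \sum_(A in powerset S)
     shuffle_sign A (S :\: A) *: (w A * e (S :\: A))].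

Definition pform_d w : pform k :=
  [ffun S : {set 'I_k} => \sum_(i in S)
     (-1 : rat) ^+ #|[set j in S | (j < i)%N]| *: (w (S :\ i))^`M(i)].

Definition barycentric (i : 'I_k.+1) : {mpoly rat[k]} :=
  if unlift ord0 i is Some j then 'X_j else 1 - \sum_(j < k) 'X_j.

(* Dirichlet's formula: the integral over the simplex of
   t_1^(m_1) ... t_k^(m_k) dt_1 ... dt_k is m_1! ... m_k! / (k + |m|)! *)
Definition pform_int w : rat :=
  \sum_(m <- msupp (w [set: 'I_k]))
    (w [set: 'I_k])@_m * (\prod_(i < k) (m i)`!)%:R / ((k + mdeg m)`!)%:R.

Lemma pform_homogP p w :
  reflect (forall S : {set 'I_k}, #|S| != p -> w S = 0) (pform_homog p w).
Proof.
apply: (iffP forallP) => [H S Sp|H S].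
  by have /implyP/(_ Sp)/eqP := H S.
by apply/implyP => Sp; apply/eqP/H.
Qed.

Lemma pform_homog_linear p a w e :
  pform_homog p w -> pform_homog p e -> pform_homog p (a *: w + e).
Proof.
move=> /pform_homogP Hw /pform_homogP He; apply/pform_homogP => S Sp.
by rewrite !ffunE Hw // He // scaler0 addr0.
Qed.

Lemma pform_homog0 p : pform_homog p 0.
Proof. by apply/pform_homogP => S _; rewrite ffunE. Qed.

Lemma pform_d_linear : linear pform_d.
Proof.
move=> a w e; apply/ffunP => S; rewrite !ffunE scaler_sumr -big_split /=.
apply: eq_bigr => i _; rewrite !ffunE linearP scalerDr.
by rewrite !scalerA mulrC.
Qed.

Lemma wedge_linearl e : linear (wedge^~ e).
Proof.
move=> a w w'; apply/ffunP => S; rewrite !ffunE scaler_sumr -big_split /=.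
apply: eq_bigr => i _; rewrite !ffunE mulrDl -scalerAl scalerDr.
by rewrite !scalerA mulrC.
Qed.

Lemma pform0_linear : linear pform0.
Proof.
move=> a f g; apply/ffunP => S; rewrite !ffunE.
by case: ifP; rewrite // scaler0 addr0.
Qed.

HB.instance Definition _ :=
  GRing.isLinear.Build rat (pform k) (pform k) _ pform_d pform_d_linear.

End OneSimplex.

(* Pullback along the affine map of simplices sending the i-th vertex to the
   th(i)-th one, i.e. t_j |-> \sum_(i | th i = j) t_i. *)
Definition pullback (k l : nat) (th : 'I_k.+1 -> 'I_l.+1) (w : pform l) : pform k :=
  let T := [tuple \sum_(i | th i == lift ord0 j) barycentric i | j < l] in
  \sum_(S : {set 'I_l})
    wedge (pform0 (w S \mPo T))
      (\big[@wedge k / pform0 1]_(j <- enum S) pform_d (pform0 (tnth T j))).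

Lemma pullback_linear k l (th : 'I_k.+1 -> 'I_l.+1) : linear (pullback th).
Proof.
move=> a w e; rewrite /pullback scaler_sumr -big_split /=.
apply: eq_bigr => S _; rewrite !ffunE linearP pform0_linear.
exact: wedge_linearl.
Qed.

End PolynomialForms.

From mathcomp Require Import all_classical reals topology normedtype.
Import numFieldNormedType.Exports.
Local Open Scope classical_set_scope.

Definition subspace (V : lmodType rat) (S : submodClosed V) : Type :=
  {v : V | v \in S}.

Section Subspace.
Variables (V : lmodType rat) (S : submodClosed V).
HB.instance Definition _ := [isSub of subspace S for @sval V (fun v => v \in S)].
HB.instance Definition _ := [Choice of subspace S by <:].
HB.instance Definition _ := [SubChoice_isSubLmodule of subspace S by <:].
End Subspace.

Definition subgroup_of (V : lmodType rat) (S : submodClosed V) : {pred V} :=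
  fun v => v \in S.

HB.instance Definition _ (V : lmodType rat) (S : submodClosed V) :=
  GRing.isZmodClosed.Build V (subgroup_of S)
    (GRing.submod_closedB (submodClosedP S)).

Definition quotient (V : lmodType rat) (S : submodClosed V) : Type :=
  Quotient.quot (subgroup_of S).

Section Quotient.
Variables (V : lmodType rat) (S : submodClosed V).
Local Open Scope quotient_scope.

HB.instance Definition _ := GRing.Zmodule.on (quotient S).

Definition to_quotient (v : V) : quotient S := \pi_(Quotient.quot (subgroup_of S)) v.
Definition lift_quotient (x : quotient S) : V := repr (x : Quotient.quot (subgroup_of S)).

Definition quotient_scale (a : rat) (x : quotient S) : quotient S :=
  to_quotient (a *: lift_quotient x).

Lemma to_quotientK : cancel lift_quotient to_quotient.
Proof. by move=> x; rewrite /to_quotient /lift_quotient reprK. Qed.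

Lemma to_quotient_eq u v : (to_quotient u == to_quotient v) = (u - v \in S).
Proof. exact: esym (Quotient.idealrBE (subgroup_of S) u v). Qed.

Lemma to_quotientB : zmod_morphism to_quotient.
Proof. by move=> x y; rewrite /to_quotient raddfB. Qed.

Lemma to_quotientZ a v : to_quotient (a *: v) = quotient_scale a (to_quotient v).
Proof.
apply/eqP; rewrite to_quotient_eq -scalerBr rpredZ //.
by rewrite -to_quotient_eq to_quotientK.
Qed.

Lemma quotient_scaleA a b x :
  quotient_scale a (quotient_scale b x) = quotient_scale (a * b) x.
Proof. by rewrite -(to_quotientK x) -!to_quotientZ scalerA. Qed.

Lemma quotient_scale1 : left_id 1 quotient_scale.
Proof. by move=> x; rewrite -(to_quotientK x) -!to_quotientZ scale1r. Qed.

HB.instance Definition _ :=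
  GRing.isZmodMorphism.Build V (quotient S) to_quotient to_quotientB.

Lemma quotient_scaleDr : right_distributive quotient_scale +%R.
Proof.
move=> a x y; rewrite -(to_quotientK x) -(to_quotientK y).
by rewrite -raddfD -!to_quotientZ scalerDr raddfD.
Qed.

Lemma quotient_scaleDl x : {morph quotient_scale^~ x : a b / a + b}.
Proof.
move=> a b; rewrite -(to_quotientK x).
by rewrite -!to_quotientZ scalerDl raddfD.
Qed.

HB.instance Definition _ := GRing.Zmodule_isLmodule.Build rat (quotient S)
  quotient_scaleA quotient_scale1 quotient_scaleDr quotient_scaleDl.

End Quotient.

Definition lin_span (V : lmodType rat) (G : set V) : {pred V} := fun v =>
  `[< exists2 s : seq (rat * V), (forall c, c \in s -> G c.2)
                               & v = \sum_(c <- s) c.1 *: c.2 >].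

Lemma lin_span_closed (V : lmodType rat) (G : set V) : submod_closed (lin_span G).
Proof.
split=> [|a u v /asboolP[s Gs ->] /asboolP[t Gt ->]].
  by apply/asboolP; exists [::] => //; rewrite big_nil.
apply/asboolP; exists ([seq (a * c.1, c.2) | c <- s] ++ t).
  by move=> c; rewrite mem_cat => /orP[/mapP[b bs ->]|/Gt//]; exact: Gs bs.
rewrite big_cat big_map scaler_sumr /=; congr (_ + _).
by apply: eq_bigr => c _; rewrite scalerA.
Qed.

HB.instance Definition _ (V : lmodType rat) (G : set V) :=
  GRing.isSubmodClosed.Build rat V (lin_span G)
    (GRing.submod_closed_semi (lin_span_closed G)).

Definition lker (U V : lmodType rat) (L : {linear U -> V}) : {pred U} :=
  [pred u | L u == 0].

Lemma lker_closed (U V : lmodType rat) (L : {linear U -> V}) :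
  submod_closed (lker L).
Proof.
split=> [|a u v]; rewrite !inE ?linear0 // linearP.
by move=> /eqP-> /eqP->; rewrite scaler0 addr0.
Qed.

HB.instance Definition _ (U V : lmodType rat) (L : {linear U -> V}) :=
  GRing.isSubmodClosed.Build rat U (lker L)
    (GRing.submod_closed_semi (lker_closed L)).

(* [Sym k D V d] is the degree d part of G^k applied to the direct sum of the
   V p with p in D.  The k-th tensor power is presented by generators and
   relations: the free vector space on k-tuples of homogeneous elements, modulo
   multilinearity. *)
Section GradedSymmetricPower.
Variables (k : nat) (D : pred nat) (V : nat -> lmodType rat) (d : nat).

Definition htuple := {ffun 'I_k -> {p : nat & V p}}.

Definition htuple_deg (f : htuple) : bool :=
  [forall i, D (tag (f i))] && (\sum_i tag (f i) == d)%N.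

Definition generator := {f : htuple | htuple_deg f}.

Definition htuple_set (f : htuple) (i : 'I_k) p (x : V p) : htuple :=
  [ffun j => if j == i then Tagged V x else f j].

Inductive Sym_relation : set (free_mod rat generator) :=
| Sym_multilinear (f : htuple) (i : 'I_k) p (a : rat) (x y : V p)
    (g g1 g2 : generator) of
    val g = htuple_set f i (a *: x + y) &
    val g1 = htuple_set f i x & val g2 = htuple_set f i y :
    Sym_relation (gen _ g - (a *: gen _ g1 + gen _ g2))
| Sym_transpose (i j : 'I_k) (g g' : generator) of
    (j = i.+1 :> nat)%N & val g' = [ffun l => val g (tperm i j l)] :
    Sym_relation (gen _ g -
      (-1) ^+ (tag (val g i) * tag (val g j)) *: gen _ g').

Definition Sym : lmodType rat := quotient (lin_span Sym_relation).

(* the class of the tensor product of the f i; zero if f is not of degree d *)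
Definition monomial (f : htuple) : Sym :=
  if insub f is Some g then to_quotient (lin_span Sym_relation) (gen _ g) else 0.

(* The linear map sending [monomial f] to [phi f].  It exists, and is then
   unique, exactly when phi is multilinear and graded symmetric. *)
Definition induced (U : lmodType rat) (phi : htuple -> U) : {linear Sym -> U} :=
  if pselect (exists L : {linear Sym -> U},
                forall f, htuple_deg f -> L (monomial f) = phi f)
  is left ex then projT1 (cid ex) else \0.

End GradedSymmetricPower.

Definition all_degrees : pred nat := fun _ => true.

(* G^2 and G^4 are applied to the cohomology in positive degrees.  With H^0
   included, the kernel of the cup product would contain xy - 1(x y) for all x
   and y, and in degrees <= n + s it would not lie in G^2 H^{<= s}, as the
   definition of A_W needs. *)
Definition positive_degrees : pred nat := fun p => (0 < p)%N.

(* meant for a + b = d *)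
Definition Sym22_mul (D : pred nat) (V : nat -> lmodType rat) (a b d : nat)
    (x : Sym 2 D V a) (y : Sym 2 D V b) : Sym 4 D V d :=
  induced D a (fun f : htuple 2 V =>
    induced D b (fun g : htuple 2 V =>
      monomial D d ([ffun i : 'I_(2 + 2) =>
         match fintype.split i with inl j => f j | inr j => g j end] : htuple 4 V))
      y) x.

Section Simplices.
Variable R : realType.

Definition simplex (k : nat) : set 'rV[R]_k.+1 :=
  [set x | (forall i, 0 <= x ord0 i) /\ \sum_i x ord0 i = 1].
Arguments simplex : clear implicits.

Definition sing (k : nat) (X : topologicalType) : Type :=
  continuousType (simplex k) X.
HB.instance Definition _ k X := Choice.on (sing k X).

Section SimplexMap.
Variables (k l : nat) (th : 'I_k.+1 -> 'I_l.+1).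

Definition simplex_mx (x : 'rV[R]_k.+1) : 'rV[R]_l.+1 :=
  \row_j \sum_(i | th i == j) x ord0 i.

Lemma simplex_mxP x : simplex k x -> simplex l (simplex_mx x).
Proof.
case=> x0 x1; split=> [j|]; first by rewrite mxE sumr_ge0.
rewrite -[RHS]x1 (partition_big th xpredT) //=.
by apply: eq_bigr => j _; rewrite mxE.
Qed.

Lemma simplex_mx_continuous : continuous simplex_mx.
Proof.
have coordC j : continuous (fun y => simplex_mx y ord0 j).
  have -> : (fun y => simplex_mx y ord0 j) =
            \sum_(i | th i == j) (fun y : 'rV[R]_k.+1 => y ord0 i).
    by apply/funext => y; rewrite mxE fct_sumE.
  elim/big_ind: _ => [|f g cf cg|i _]; first exact: cst_continuous.
    by move=> y; apply: continuousD; [exact: cf | exact: cg].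
  exact: coord_continuous.
move=> x A [P Px sPA].
have Pxj j : nbhs (simplex_mx x ord0 j) (P ord0 j) by exact: Px.
have : \forall y \near x, forall j, P ord0 j (simplex_mx y ord0 j).
  apply: (@filter_forall _ _ (fun j y => P ord0 j (simplex_mx y ord0 j)) (nbhs x)) => j.
  exact: (coordC j x (P ord0 j) (Pxj j)).
by apply: filterS => y Py; apply: sPA => i j; rewrite ord1.
Qed.

Definition simplex_map_fun (x : simplex k) : simplex l :=
  SigSub (mem_set (simplex_mxP (set_mem (valP x)))).

Lemma simplex_map_continuous : continuous simplex_map_fun.
Proof.
apply: continuous_comp_initial => x.
apply: (@continuous_comp _ _ _ (@set_val _ (simplex k)) simplex_mx).
  exact: initial_continuous.
exact: simplex_mx_continuous.
Qed.

Definition simplex_map : continuousType (simplex k) (simplex l) :=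
  mkcts simplex_map_continuous.

End SimplexMap.
End Simplices.

Section Sing.
Variables (R : realType) (X Y : topologicalType).

Definition sing_restrict k l (th : 'I_k.+1 -> 'I_l.+1) (s : sing R l X) : sing R k X :=
  s \o simplex_map R th.

Definition sing_push k (f : continuousType X Y) (s : sing R k X) : sing R k Y :=
  f \o s.

Definition chain k : Type := free_mod int (sing R k X).
HB.instance Definition _ k := GRing.Lmodule.on (chain k).

Definition face k (i : 'I_k.+2) (s : sing R k.+1 X) : sing R k X :=
  sing_restrict (lift i) s.

Definition boundary_succ k (c : chain k.+1) : chain k :=
  zext (fun s => \sum_(i < k.+2) (-1) ^+ i *: (gen int (face i s) : chain k)) c.

Definition chain_boundary k : chain k -> chain k.-1 :=
  match k with 0 => fun=> 0 | q.+1 => @boundary_succ q end.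

Definition chain_in (A : set X) k (c : chain k) : Prop :=
  forall s : sing R k X, s \in supp c -> range s `<=` A.

(* Arbitrary families of polynomial forms on the singular simplices of X;
   Omega_PL(X) consists of those compatible with the simplicial operators, see
   [PL_forms].  A pre_form may have components in all degrees, see [homog]. *)
Definition pre_form : Type := forall k, sing R k X -> pform k.

HB.instance Definition _ := gen_eqMixin pre_form.
HB.instance Definition _ := gen_choiceMixin pre_form.

Definition pre_form_add (w e : pre_form) : pre_form := fun k s => w k s + e k s.
Definition pre_form_opp (w : pre_form) : pre_form := fun k s => - w k s.
Definition pre_form_zero : pre_form := fun k s => 0.
Definition pre_form_scale (a : rat) (w : pre_form) : pre_form := fun k s => a *: w k s.

Lemma pre_formP (w e : pre_form) : (forall k s, w k s = e k s) -> w = e.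
Proof.
by move=> H; apply: functional_extensionality_dep => k; apply/funext => s.
Qed.

Lemma pre_form_addA : associative pre_form_add.
Proof. by move=> a b c; apply: pre_formP => k s; exact: addrA. Qed.
Lemma pre_form_addC : commutative pre_form_add.
Proof. by move=> a b; apply: pre_formP => k s; exact: addrC. Qed.
Lemma pre_form_add0 : left_id pre_form_zero pre_form_add.
Proof. by move=> a; apply: pre_formP => k s; exact: add0r. Qed.
Lemma pre_form_addN : left_inverse pre_form_zero pre_form_opp pre_form_add.
Proof. by move=> a; apply: pre_formP => k s; exact: addNr. Qed.

HB.instance Definition _ := GRing.isZmodule.Build pre_form
  pre_form_addA pre_form_addC pre_form_add0 pre_form_addN.

Lemma pre_form_scaleA a b w :
  pre_form_scale a (pre_form_scale b w) = pre_form_scale (a * b) w.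
Proof. by apply: pre_formP => k s; exact: scalerA. Qed.
Lemma pre_form_scale1 : left_id 1 pre_form_scale.
Proof. by move=> w; apply: pre_formP => k s; exact: scale1r. Qed.
Lemma pre_form_scaleDr : right_distributive pre_form_scale +%R.
Proof. by move=> a w e; apply: pre_formP => k s; exact: scalerDr. Qed.
Lemma pre_form_scaleDl w : {morph pre_form_scale^~ w : a b / a + b}.
Proof. by move=> a b; apply: pre_formP => k s; exact: scalerDl. Qed.

HB.instance Definition _ := GRing.Zmodule_isLmodule.Build rat pre_form
  pre_form_scaleA pre_form_scale1 pre_form_scaleDr pre_form_scaleDl.

Definition PL_forms : {pred pre_form} := fun w => `[<
  forall k l (th : 'I_k.+1 -> 'I_l.+1) (s : sing R l X),
    {homo th : i j / (i <= j)%N} ->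
    w k (sing_restrict th s) = pullback th (w l s) >].

Definition homog (p : nat) : {pred pre_form} := fun w =>
  `[< forall k s, pform_homog p (w k s) >].

Definition dform (w : pre_form) : pre_form := fun k s => pform_d (w k s).
Definition wedgeF (w e : pre_form) : pre_form := fun k s => wedge (w k s) (e k s).

Definition integral k (c : chain k) (w : pre_form) : rat :=
  zext (fun s => pform_int (w k s)) c.

Lemma PL_forms_closed : submod_closed PL_forms.
Proof.
split=> [|a w e /asboolP Hw /asboolP He]; apply/asboolP => k l th s hth.
  change (0 = pullback th 0); have := pullback_linear th (-1) 0 0.
  by rewrite scaler0 addr0 scaleN1r addNr.
have E := pullback_linear th a (w l s) (e l s).
by rewrite -(Hw _ _ _ _ hth) -(He _ _ _ _ hth) in E; exact: esym E.
Qed.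

HB.instance Definition _ := GRing.isSubmodClosed.Build rat pre_form PL_forms
  (GRing.submod_closed_semi PL_forms_closed).

Lemma homog_closed p : submod_closed (homog p).
Proof.
split=> [|a w e /asboolP Hw /asboolP He]; apply/asboolP => k s.
  exact: pform_homog0.
exact: pform_homog_linear.
Qed.

HB.instance Definition _ p := GRing.isSubmodClosed.Build rat pre_form (homog p)
  (GRing.submod_closed_semi (homog_closed p)).

Lemma dform_linear : linear dform.
Proof. by move=> a w e; apply: pre_formP => k s; exact: pform_d_linear. Qed.

HB.instance Definition _ :=
  GRing.isLinear.Build rat pre_form pre_form _ dform dform_linear.

(* The cohomology of a graded subspace C of forms that is stable under dform.
   Exactness need not mention the degree of the primitive: if [dform u] is
   homogeneous of degree p, it is d of the degree p - 1 part of u. *)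
Section Cohomology.
Variables (C : submodClosed pre_form) (p : nat).

Definition cocycle : {pred pre_form} := fun w =>
  [&& w \in C, w \in homog p & w \in lker dform].

Lemma cocycle_closed : submod_closed cocycle.
Proof.
split=> [|a w e /and3P[w1 w2 w3] /and3P[e1 e2 e3]]; apply/and3P.
  by split; rewrite rpred0.
by split; rewrite rpredD ?rpredZ.
Qed.

HB.instance Definition _ := GRing.isSubmodClosed.Build rat pre_form cocycle
  (GRing.submod_closed_semi cocycle_closed).

Definition exact_cocycle : {pred subspace cocycle} := fun z =>
  `[< exists2 u, u \in C & val z = dform u >].

Lemma exact_cocycle_closed : submod_closed exact_cocycle.
Proof.
split=> [|a y z /asboolP[u uC Eu] /asboolP[v vC Ev]]; apply/asboolP.
  by exists 0; [exact: rpred0 | rewrite !raddf0].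
exists (a *: u + v); first by rewrite rpredD ?rpredZ.
by rewrite !linearP /= -Eu -Ev.
Qed.

HB.instance Definition _ := GRing.isSubmodClosed.Build rat (subspace cocycle)
  exact_cocycle (GRing.submod_closed_semi exact_cocycle_closed).

Definition cohomology : lmodType rat := quotient exact_cocycle.

(* the class of w; zero if w is not a cocycle *)
Definition class (w : pre_form) : cohomology :=
  to_quotient exact_cocycle (insubd 0 w).

Definition rep (x : cohomology) : pre_form := val (lift_quotient x).

End Cohomology.

(* rational cohomology, as the cohomology of Omega_PL(X) *)
Definition HPL (p : nat) : lmodType rat := cohomology PL_forms p.

(* meant for p + q = r *)
Definition cup (p q r : nat) (x : HPL p) (y : HPL q) : HPL r :=
  class PL_forms r (wedgeF (rep x) (rep y)).

End Sing.

Arguments PL_forms : clear implicits.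
Arguments homog : clear implicits.

Section Map.
Variables (R : realType) (M W : topologicalType) (f : continuousType M W).

Definition chain_push k (c : chain R M k) : chain R W k :=
  zext (fun s => gen int (sing_push f s) : chain R W k) c.

Definition restrict_form (w : pre_form R W) : pre_form R M := fun k s => w k (sing_push f s).

Lemma restrict_form_linear : linear restrict_form.
Proof. by []. Qed.

HB.instance Definition _ :=
  GRing.isLinear.Build rat (pre_form R W) (pre_form R M) _ restrict_form restrict_form_linear.

(* for the inclusion f of a subspace M, the complex computing H^*(W, M) *)
Definition relative_PL_forms : {pred pre_form R W} := fun w =>
  (w \in PL_forms R W) && (w \in lker restrict_form).

Lemma relative_PL_forms_closed : submod_closed relative_PL_forms.
Proof.
split=> [|a w e /andP[w1 w2] /andP[e1 e2]]; apply/andP.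
  by split; rewrite rpred0.
by split; rewrite rpredD ?rpredZ.
Qed.

HB.instance Definition _ := GRing.isSubmodClosed.Build rat (pre_form R W)
  relative_PL_forms (GRing.submod_closed_semi relative_PL_forms_closed).

Definition pullbackH (p : nat) (x : HPL R W p) : HPL R M p :=
  class (PL_forms R M) p (restrict_form (rep x)).

Definition Hrel (p : nat) : lmodType rat := cohomology relative_PL_forms p.

Definition rel_to_abs (p : nat) (u : Hrel p) : HPL R W p :=
  class (PL_forms R W) p (rep u).

End Map.

Section Topology.
Variables (R : realType).

Definition half_space (d : nat) : set 'rV[R]_d :=
  [set x | forall i : 'I_d, i = 0 :> nat -> 0 <= x ord0 i].

Definition half_space_boundary (d : nat) : set 'rV[R]_d :=
  [set x | exists2 i : 'I_d, i = 0 :> nat & x ord0 i = 0].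

Definition sphere (k : nat) : set 'rV[R]_k.+1 :=
  [set x | \sum_i x ord0 i ^+ 2 = 1].

Definition disk (k : nat) : set 'rV[R]_k.+1 :=
  [set x | \sum_i x ord0 i ^+ 2 <= 1].

Arguments half_space : clear implicits.
Arguments half_space_boundary : clear implicits.
Arguments sphere : clear implicits.
Arguments disk : clear implicits.

Variable X : topologicalType.

(* phi is a homeomorphism, with inverse psi, from the open set U onto an open
   subset of the half-space *)
Definition chart (d : nat) (U : set X) (phi : X -> 'rV[R]_d) (psi : 'rV[R]_d -> X) :
    Prop :=
  [/\ open U,
      exists2 V, open V & phi @` U = V `&` half_space d,
      {within U, continuous phi},
      {within phi @` U, continuous psi} &
      forall x, U x -> psi (phi x) = x].

Definition manifold_boundary (d : nat) : set X :=
  [set x | exists U (phi : X -> 'rV[R]_d) psi,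
     [/\ U x, chart U phi psi & half_space_boundary d (phi x)]].

(* connected, and possibly with boundary.  Orientations are given separately, by
   a [fundamental_cycle]. *)
Definition compact_manifold (d : nat) : Prop :=
  [/\ hausdorff_space X, @second_countable X,
      forall x : X, exists U phi psi, U x /\ @chart d U phi psi,
      compact [set: X] & connected [set: X]].

Definition closed_manifold (d : nat) : Prop :=
  compact_manifold d /\ manifold_boundary d = set0.

Definition highly_connected (k : nat) : Prop :=
  [set: X] !=set0 /\
  forall j (f : 'rV[R]_j.+1 -> X), (j <= k)%N ->
    {within sphere j, continuous f} ->
    exists2 g : 'rV[R]_j.+1 -> X, {within disk j, continuous g} &
                                  forall x, sphere j x -> g x = f x.

(* An integral cycle z of (X, boundary) representing the fundamental class of
   an orientation: at each interior point x it generates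
   H_d(X, X \ {x}; Z). *)
Definition fundamental_cycle (d : nat) (z : chain R X d) : Prop :=
  chain_in (manifold_boundary d) (chain_boundary z) /\
  forall x, ~ manifold_boundary d x ->
  forall c : chain R X d, chain_in (~` [set x]) (chain_boundary c) ->
  exists (a : int) (b : chain R X d.+1) (c' : chain R X d),
    chain_in (~` [set x]) c' /\ c = z *~ a + chain_boundary b + c'.

End Topology.

Section BianchiMassey.
Variables (R : realType) (M : topologicalType).

Local Notation HM := (HPL R M).
Local Notation G2 := (Sym 2 positive_degrees HM).

Definition cup_G2 (d : nat) : {linear G2 d -> HM d} :=
  induced positive_degrees d (fun f : htuple 2 HM =>
    cup d (tagged (f ord0)) (tagged (f ord_max))).

Definition Estar (d : nat) : lmodType rat := subspace (lker (cup_G2 d)).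

Local Notation G2E := (Sym 2 all_degrees Estar).

Definition full_sym (d : nat) : {linear G2E d -> Sym 4 positive_degrees HM d} :=
  induced all_degrees d (fun f : htuple 2 Estar =>
    Sym22_mul d (val (tagged (f ord0))) (val (tagged (f ord_max)))).

(* G^2 E is a subspace of G^2 G^2 H^*, so this is its intersection with the
   kernel of the full symmetrisation *)
Definition Bspace (d : nat) : set (G2E d) := [set b | full_sym d b = 0].

Variables (alpha : forall p, {linear HM p -> pre_form R M}).

Definition alpha2 (d : nat) : {linear G2 d -> pre_form R M} :=
  induced positive_degrees d (fun f : htuple 2 HM =>
    wedgeF (alpha _ (tagged (f ord0))) (alpha _ (tagged (f ord_max)))).

Definition closed_representatives : Prop :=
  forall p (x : HM p),
    alpha p x \in cocycle (PL_forms R M) p /\ class (PL_forms R M) p (alpha p x) = x.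

Variables (gamma : forall p, {linear Estar p -> pre_form R M}).

Definition primitives : Prop :=
  forall p (e : Estar p),
    [/\ gamma p e \in PL_forms R M, gamma p e \in homog R M p.-1 &
        dform (gamma p e) = alpha2 p (val e)].

Definition BM_form (d : nat) : {linear G2E d -> pre_form R M} :=
  induced all_degrees d (fun f : htuple 2 Estar =>
    let e := tagged (f ord0) in let p := tag (f ord0) in
    let e' := tagged (f ord_max) in let q := tag (f ord_max) in
    (1 / 2%:R) *: (wedgeF (gamma p e) (alpha2 q (val e'))
      + (-1) ^+ (p * q) *: wedgeF (gamma q e') (alpha2 p (val e)))).

(* [BM_form b] is a form of degree m, closed if b is in [Bspace]; the value of its
   class on the fundamental class of M is its integral over zM *)
Definition F_M (m : nat) (zM : chain R M m) (b : G2E m.+1) : rat :=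
  integral zM (BM_form m.+1 b).

End BianchiMassey.

Section Coboundary.
Variables (R : realType) (M W : topologicalType) (iota : continuousType M W).

Definition coboundary_over (s : int) : Prop :=
  forall p, (p%:Z <= s)%R ->
  forall y : HPL R M p, exists x : HPL R W p, pullbackH iota x = y.

Variable r : forall p, {linear HPL R M p -> HPL R W p}.

Definition right_inverse_upto (s : int) : Prop :=
  forall p, (p%:Z <= s)%R -> forall y : HPL R M p, pullbackH iota (r p y) = y.

Definition hat_G2 (s : int) (d : nat) :
    {linear Sym 2 positive_degrees (HPL R M) d -> HPL R W d} :=
  induced positive_degrees d (fun f : htuple 2 (HPL R M) =>
    if ((tag (f ord0))%:Z <= s) && ((tag (f ord_max))%:Z <= s)
    then cup d (r _ (tagged (f ord0))) (r _ (tagged (f ord_max))) else 0).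

Definition hat (s : int) (p : nat) (e : Estar R M p) : HPL R W p := hat_G2 s p (val e).

(* <u cup b, [W, M]> for a preimage u of a in H^*(W, M); meant for a and b in the
   image of H^*(W, M) *)
Definition intersection_form k (zW : chain R W k) (p q : nat)
    (a : HPL R W p) (b : HPL R W q) : rat :=
  let u := xget 0 [set u : Hrel R iota p | rel_to_abs u = a] in
  integral zW (wedgeF (rep u) (rep b)).

(* When one of e, e' has degree > n + s, the other has degree < 2n and is zero if
   M is (n-1)-connected, so that e e' = 0: hence the default value. *)
Definition A_W (n m : nat) (s : int) (zW : chain R W m.+1) :
    {linear Sym 2 all_degrees (Estar R M) m.+1 -> rat^o} :=
  induced all_degrees m.+1 (fun f : htuple 2 (Estar R M) =>
    if ((tag (f ord0))%:Z <= n%:Z + s) && ((tag (f ord_max))%:Z <= n%:Z + s)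
    then intersection_form zW (hat s (tagged (f ord0))) (hat s (tagged (f ord_max)))
           : rat^o
    else 0).

(* for M compact and W Hausdorff, this makes iota a homeomorphism onto the
   boundary of W *)
Definition boundary_inclusion (m : nat) : Prop :=
  injective iota /\ range iota = @manifold_boundary R W m.+1.

(* The orientation of M as the boundary of W: [bounds zW zM] says that
   \partial [W, M] = - [M], that is, an inward normal followed by an oriented
   frame of M is an oriented frame of W.  This is the convention for which A_W
   and F_M agree; the outward normal would give A_W = - F_M.  Indeed extend alpha
   and gamma over W: the form alpha^2(e) - d gamma(e) represents a preimage of
   e^ in H^*(W, M), and on B the sum of its products with the alpha^2(e') is
   - d of the sum of the gamma(e) alpha^2(e'). *)
Definition bounds m (zW : chain R W m.+1) (zM : chain R M m) : Prop :=
  exists b : chain R M m.+1,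
    chain_boundary zW = - chain_push iota (zM + chain_boundary b).

End Coboundary.

(* Main.v *)
(* Extend the choices on M to W.  The representatives alpha(x) of the classes of
   degree <= s extend to closed forms on W representing r(x), and gamma extends to
   a map gamma^ into the forms on W; both extensions are linear.  The products of
   the extended representatives give alpha^2(e) on W, of class e^, and
     beta(e) = alpha^2(e) - d gamma^(e)
   is closed and vanishes on M, so that its relative class maps to e^ and
   A_W(e e') is the integral over W of beta(e) beta(e').  This is also the integral
   of beta(e) alpha^2(e'), since beta(e) d gamma^(e') is the differential of a form
   vanishing on M.  Symmetrising in e and e', the integrand becomes
   alpha^2(e) alpha^2(e') - d(gamma^(e) alpha^2(e') +/- gamma^(e') alpha^2(e)) / 2.
   The first term factors through the full symmetrisation because forms are graded
   commutative, so it vanishes on B; by Stokes' theorem the second one gives F_M.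

   This needs H^p(M) = 0 for 0 < p < n, that is, the exactness of closed forms of
   these degrees: the connectivity of M yields cones h(s) on the singular simplices
   s of low dimension, compatible with faces, and the Poincare lemma on h(s) gives
   compatible primitives on the s.  All extensions of forms, here and from M to W,
   proceed by induction on dimension, one nondegenerate simplex at a time. *)
From mathcomp Require Import all_boot perm. (* [Sym] is that of Defs, not of perm *)
Require Import Defs.
From HB Require Import structures.
From mathcomp Require Import all_boot all_order all_algebra.
From mathcomp Require Import zify ring lra.
From mathcomp Require finmap.
From mathcomp.multinomials Require mpoly monalg ssrcomplements.

Set Implicit Arguments.
Unset Strict Implicit.
Unset Printing Implicit Defensive.

Import Order.TTheory GRing.Theory Num.Theory.
Local Open Scope ring_scope.

(** * Polynomial forms on the simplex *)

(** Linearity of the extensions is not a convenience. [A_W] and [F_M] are given through [induced],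
    which is 0 unless its formula is multilinear and graded symmetric. The formula for A_W, with an
    arbitrary preimage u and arbitrary representatives, is recognised as such only once it is
    identified with the integral of beta(e) beta(e'), beta being linear; hence the linear
    selections, made with Zorn's lemma. The constant s enters through m + 1 - (n + s) = 2n. Since
    H^p(M) = 0 for 0 < p < n, E vanishes below degree 2n; so in a product e e' of degree m + 1 both
    degrees are at most n + s, unless one factor is 0. For the same reason a product of two classes
    of total degree at most n + s involves only degrees up to s, and the extension of alpha may be
    taken to be 0 above s. The vanishing of H^p(M) is derived directly from the extension of maps
    from spheres to disks. The same extension principle for simplicial presheaves serves three
    times: for the cones in M, for primitives of closed forms, and for forms from M to W. It rests
    on two facts about one simplex: a compatible family of forms on the boundary extends, and closed
    forms vanishing on the boundary have such primitives below the top degree. *)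

Module Export SimplexForms.
Import mpoly.

Section Generators.
Variable k : nat.
Implicit Types (w e u : pform k) (A B S : {set 'I_k}) (f g : {mpoly rat[k]}).

Definition pmul f w : pform k := [ffun S => f * w S].

Definition below (j : 'I_k) S : rat := (-1) ^+ #|[set i in S | (i < j)%N]|.

(** Left multiplication by dt_j; [below j S] is the sign that brings dt_j to its place in the
    increasing product dt_S. *)
Definition dX (j : 'I_k) w : pform k :=
  [ffun S : {set 'I_k} => if j \in S then below j S *: w (S :\ j) else 0].

(** The grading involution. It expresses the signs for forms of mixed degree, so that the Leibniz
    rule can be proved by induction on generators. *)
Definition eps w : pform k := [ffun S : {set 'I_k} => (-1 : rat) ^+ #|S| *: w S].

Definition pderiv (i : 'I_k) w : pform k := [ffun S => (w S)^`M(i)].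

Definition pone : pform k := pform0 1.

Definition mono S f : pform k := [ffun T => if T == S then f else 0].

Lemma pmul_linear f : linear (pmul f).
Proof. by move=> a u v; apply/ffunP => S; rewrite !ffunE mulrDr scalerAr. Qed.
HB.instance Definition _ f := GRing.isLinear.Build rat (pform k) (pform k) _ (pmul f) (pmul_linear f).

Lemma dX_linear j : linear (dX j).
Proof.
move=> a u v; apply/ffunP => S; rewrite !ffunE; case: ifP => _.
  by rewrite scalerDr !scalerA mulrC.
by rewrite scaler0 addr0.
Qed.
HB.instance Definition _ j := GRing.isLinear.Build rat (pform k) (pform k) _ (dX j) (dX_linear j).

Lemma eps_linear : linear eps.
Proof.
by move=> a u v; apply/ffunP => S; rewrite !ffunE scalerDr !scalerA mulrC.
Qed.
HB.instance Definition _ := GRing.isLinear.Build rat (pform k) (pform k) _ eps eps_linear.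

Lemma pderiv_linear i : linear (pderiv i).
Proof. by move=> a u v; apply/ffunP => S; rewrite !ffunE linearP. Qed.
HB.instance Definition _ i := GRing.isLinear.Build rat (pform k) (pform k) _ (pderiv i) (pderiv_linear i).

Lemma pmulDl f g w : pmul (f + g) w = pmul f w + pmul g w.
Proof. by apply/ffunP => S; rewrite !ffunE mulrDl. Qed.
Lemma pmul_suml (I : Type) (r : seq I) (P : pred I) (F : I -> {mpoly rat[k]}) w :
  pmul (\sum_(i <- r | P i) F i) w = \sum_(i <- r | P i) pmul (F i) w.
Proof.
apply/ffunP => S; rewrite !ffunE mulr_suml sum_ffunE.
by apply: eq_bigr => i _; rewrite ffunE.
Qed.
Lemma pmulA f g w : pmul f (pmul g w) = pmul (f * g) w.
Proof. by apply/ffunP => S; rewrite !ffunE mulrA. Qed.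
Lemma pmul1 w : pmul 1 w = w.
Proof. by apply/ffunP => S; rewrite !ffunE mul1r. Qed.
Lemma pmul0 w : pmul 0 w = 0.
Proof. by apply/ffunP => S; rewrite !ffunE mul0r. Qed.
Lemma pform0E f : pform0 f = pmul f pone.
Proof. by apply/ffunP => S; rewrite !ffunE; case: ifP; rewrite ?mulr1 ?mulr0. Qed.
Lemma scale_pmul a w : a *: w = pmul (a%:MP) w.
Proof. by apply/ffunP => S; rewrite !ffunE mul_mpolyC. Qed.

Lemma dX_pmul j f w : dX j (pmul f w) = pmul f (dX j w).
Proof.
by apply/ffunP => S; rewrite !ffunE; case: ifP; rewrite ?mulr0 // scalerAr.
Qed.

Lemma belowD1 (i j : 'I_k) S : i \in S ->
  below j (S :\ i) = below j S * (if (i < j)%N then -1 else 1).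
Proof.
move=> iS; rewrite /below; case: ifP => ij.
  rewrite [X in _ = _ ^+ X * _](cardsD1 i) inE iS ij /= exprD expr1 mulN1r mulrN1 opprK.
  by congr (_ ^+ _); apply: eq_card => l; rewrite !inE; case: eqP.
rewrite mulr1; congr (_ ^+ _); apply: eq_card => l; rewrite !inE.
by have [->|] := eqVneq l i; rewrite ?ij ?andbF.
Qed.

Lemma dX_dX i j w : dX i (dX j w) = - dX j (dX i w).
Proof.
apply/ffunP => S; rewrite !ffunE.
have [->|nij] := eqVneq i j.
  by rewrite in_setD1 eqxx; case: ifP; rewrite ?scaler0 oppr0.
rewrite !in_setD1 nij eq_sym nij /=.
case iS: (i \in S); case jS: (j \in S); rewrite ?scaler0 ?oppr0 //.
rewrite !scalerA -scaleNr; congr (_ *: w _).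
  rewrite !belowD1 //; move: nij; rewrite -val_eqE /= => nij.
  by case: (ltngtP i j) nij => // _ _; ring.
by apply/setP => l; rewrite !inE andbCA.
Qed.

Lemma eps_pone : eps pone = pone.
Proof.
apply/ffunP => S; rewrite !ffunE; case: eqP => [->|_]; last by rewrite scaler0.
by rewrite cards0 expr0 scale1r.
Qed.
Lemma eps_pmul f w : eps (pmul f w) = pmul f (eps w).
Proof. by apply/ffunP => S; rewrite !ffunE scalerAr. Qed.
Lemma eps_dX j w : eps (dX j w) = - dX j (eps w).
Proof.
apply/ffunP => S; rewrite !ffunE; case: ifP => jS; last by rewrite scaler0 oppr0.
by rewrite !scalerA -scaleNr (cardsD1 j) jS exprD expr1 mulN1r mulNr mulrC.
Qed.
Lemma epsK : involutive eps.
Proof.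
move=> w; apply/ffunP => S; rewrite !ffunE scalerA -exprMn mulrNN mulr1 expr1n.
by rewrite scale1r.
Qed.
Lemma eps_homog p w : pform_homog p w -> eps w = (-1) ^+ p *: w.
Proof.
move=> /pform_homogP Hw; apply/ffunP => S; rewrite !ffunE.
by have [->//|/eqP/eqP nS] := eqVneq #|S| p; rewrite Hw ?scaler0.
Qed.

Lemma pderiv_dX i j w : pderiv i (dX j w) = dX j (pderiv i w).
Proof.
by apply/ffunP => S; rewrite !ffunE; case: ifP; rewrite ?linear0 // linearZ.
Qed.
Lemma pderiv_pmul i f w : pderiv i (pmul f w) = pmul f^`M(i) w + pmul f (pderiv i w).
Proof. by apply/ffunP => S; rewrite !ffunE mderivM. Qed.
Lemma pderiv_pone i : pderiv i pone = 0.
Proof.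
apply/ffunP => S; rewrite !ffunE; case: eqP => _; last by rewrite linear0.
by rewrite -mpolyC1 mderivC.
Qed.
Lemma pderivC i j w : pderiv i (pderiv j w) = pderiv j (pderiv i w).
Proof. by apply/ffunP => S; rewrite !ffunE mderiv_comm. Qed.

Lemma pform_dE w : pform_d w = \sum_i dX i (pderiv i w).
Proof.
apply/ffunP => S; rewrite ffunE sum_ffunE big_mkcond /=.
by apply: eq_bigr => i _; rewrite !ffunE; case: ifP; rewrite //= ffunE.
Qed.

Lemma pform_d_pmul f w :
  pform_d (pmul f w) = \sum_i dX i (pmul f^`M(i) w) + pmul f (pform_d w).
Proof.
rewrite !pform_dE [X in _ = _ + X]linear_sum -big_split; apply: eq_bigr => i _ /=.
by rewrite pderiv_pmul linearD /= !dX_pmul.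
Qed.
Lemma pform_d_dX j w : pform_d (dX j w) = - dX j (pform_d w).
Proof.
rewrite !pform_dE linear_sum -sumrN; apply: eq_bigr => i _ /=.
by rewrite pderiv_dX dX_dX.
Qed.
Lemma pform_d_pone : pform_d pone = 0.
Proof. by rewrite pform_dE big1 // => i _; rewrite pderiv_pone linear0. Qed.

Lemma pform_dd w : pform_d (pform_d w) = 0.
Proof.
rewrite [pform_d w]pform_dE linear_sum /=.
under eq_bigr => i _ do rewrite pform_d_dX pform_dE linear_sum /= -sumrN.
(* The double sum is antisymmetric: the dt_i anticommute and the partial derivatives commute. *)
set s := \sum_i _; suff: s = - s.
  move/eqP; rewrite -addr_eq0 -mulr2n -scaler_nat scaler_eq0 => /orP[|/eqP//].
  by rewrite pnatr_eq0.
rewrite {1}/s exchange_big /= -sumrN; apply: eq_bigr => i _.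
rewrite -sumrN; apply: eq_bigr => j _.
by rewrite opprK dX_dX pderivC opprK.
Qed.

Lemma mono_dX j S : j \in S -> mono S 1 = below j S *: dX j (mono (S :\ j) 1).
Proof.
move=> jS; apply/ffunP => T; rewrite !ffunE.
have [->|nTS] := eqVneq T S.
  by rewrite jS eqxx scalerA -exprMn mulrNN mulr1 expr1n scale1r.
case: ifP => jT; last by rewrite scaler0.
rewrite ifN ?scaler0 //; apply: contraNneq nTS => E.
by rewrite -(setD1K jT) -(setD1K jS) E.
Qed.

Lemma mono_pmul S f : mono S f = pmul f (mono S 1).
Proof. by apply/ffunP => T; rewrite !ffunE; case: ifP; rewrite ?mulr1 ?mulr0. Qed.

Lemma mono0 f : mono set0 f = pform0 f.
Proof. by apply/ffunP => T; rewrite !ffunE. Qed.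

Lemma pform_mono w : w = \sum_S mono S (w S).
Proof.
apply/ffunP => T; rewrite sum_ffunE (bigD1 T) //= ffunE eqxx big1 ?addr0 //.
by move=> S; rewrite ffunE eq_sym => /negPf->.
Qed.

(** A form f dt_S is obtained from 1 by multiplying with the dt_j (j in S), then with f. The
    identities of the algebra of forms are checked on these generators. *)
Lemma homog_ind (P : nat -> pform k -> Prop) :
  (forall p u v, P p u -> P p v -> P p (u + v)) ->
  P 0%N pone -> (forall p f w, P p w -> P p (pmul f w)) ->
  (forall p j w, P p w -> P p.+1 (dX j w)) -> (forall p, P p 0) ->
  forall p w, pform_homog p w -> P p w.
Proof.
move=> PD P1 PM PX P0 p w /pform_homogP Hw.
have PS S : P #|S| (mono S 1).
  have [n] := ubnP #|S|; elim: n S => // n IH S; rewrite ltnS => Sn.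
  have [->|/set0Pn[j jS]] := eqVneq S set0; first by rewrite cards0 mono0.
  rewrite (mono_dX jS) scale_pmul; apply: PM; move: Sn; rewrite (cardsD1 j) jS => Sn.
  by apply/PX/IH.
rewrite (pform_mono w); elim/big_ind: _ => [||S _]; [exact: P0|exact: PD|].
have [<-|/Hw->] := eqVneq #|S| p; first by rewrite mono_pmul; apply: PM.
by rewrite mono_pmul pmul0.
Qed.

Lemma pform_ind (P : pform k -> Prop) :
  (forall u v, P u -> P v -> P (u + v)) ->
  P pone -> (forall f w, P w -> P (pmul f w)) ->
  (forall j w, P w -> P (dX j w)) -> forall w, P w.
Proof.
move=> PD P1 PM PX w; have P0 : P 0 by rewrite -(pmul0 pone); apply: PM.
rewrite (pform_mono w); elim/big_ind: _ => [//|//|S _].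
apply: (@homog_ind (fun _ => P) _ _ _ _ _ #|S|) => //.
by apply/pform_homogP => T nT; rewrite ffunE; have [E|//] := eqVneq T S; rewrite E eqxx in nT.
Qed.

Lemma belowU1 j i S : i \notin S ->
  below j (i |: S) = below j S * (if (i < j)%N then -1 else 1).
Proof.
move=> iS; rewrite -{2}(setU1K iS) belowD1 ?setU11 //.
by case: ifP; rewrite ?mulr1 // -mulrA mulrNN !mulr1.
Qed.

Lemma belowU j A B : [disjoint A & B] -> below j (A :|: B) = below j A * below j B.
Proof.
move=> dAB; rewrite /below -exprD -cardsUI.
have -> : [set i in A | (i < j)%N] :&: [set i in B | (i < j)%N] = set0.
  by apply/setP => l; rewrite !inE; case: (boolP (l \in A)) => //= /(disjointFr dAB) ->;
    rewrite andbF.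
by rewrite cards0 addn0; congr (_ ^+ _); apply: eq_card => l; rewrite !inE andb_orl.
Qed.

(** The inversions with first entry j are the elements of B below j. *)
Lemma shuffle_signU1 j A B : j \notin A ->
  shuffle_sign (j |: A) B = shuffle_sign A B * below j B.
Proof.
move=> jA; rewrite /shuffle_sign /below -exprD; congr (_ ^+ _).
have pair_inj : injective (@pair _ 'I_k j) by move=> ? ? [].
rewrite -[X in (_ + X)%N](card_imset _ pair_inj) -cardsUI.
set X := [set ab in setX A B | _]; set Y := [set (_, _) | _ in _].
have -> : X :&: Y = set0.
  apply/setP => -[a b]; rewrite !inE; apply/negbTE/negP => /andP[/andP[/andP[aA _] _]].
  by case/imsetP => l _ [aj _]; rewrite -aj aA in jA.
rewrite cards0 addn0; apply: eq_card => -[a b]; rewrite !inE /=.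
have [->|aj] /= := eqVneq a j.
  rewrite (negPf jA) /=; apply/idP/imsetP => [bB|[l]]; first by exists b; rewrite ?inE.
  by rewrite inE => lB [->].
suff /negPf-> : (a, b) \notin Y by rewrite orbF.
by apply/negP => /imsetP[l _ [E _]]; rewrite E eqxx in aj.
Qed.

(** Only the subsets A containing j contribute, and they are reindexed as j |: B. Associativity,
    graded commutativity and the Leibniz rule follow from this by induction on the first factor. *)
Lemma wedge_dX j w e : wedge (dX j w) e = dX j (wedge w e).
Proof.
apply/ffunP => S; rewrite !ffunE.
case: ifP => jS; last first.
  apply: big1 => A; rewrite powersetE => /subsetP sAS; rewrite ffunE ifF.
    by rewrite mul0r scaler0.
  by apply/negbTE/negP => /sAS; rewrite jS.
rewrite scaler_sumr (bigID (fun A : {set 'I_k} => j \in A)) /=.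
rewrite [X in _ + X]big1 ?addr0; last first.
  by move=> A /andP[_ /negPf jA]; rewrite ffunE jA mul0r scaler0.
rewrite (reindex_onto (fun B => j |: B) (fun A => A :\ j)) /=; last first.
  by move=> A /andP[_ jA]; rewrite setD1K.
apply: eq_big => [B|B].
  rewrite !powersetE setU11 andbT subsetD1 subUset sub1set jS /=; congr (_ && _).
  apply/eqP/idP => [<-|jB]; first by rewrite in_setD1 eqxx.
  by rewrite setU1K.
case/andP => /andP[]; rewrite powersetE subUset => /andP[_ sBS] _ /eqP BE.
have jB : j \notin B by rewrite -BE in_setD1 eqxx.
rewrite ffunE setU11 setU1K // setDDl.
have SE : j |: (B :|: (S :\: (j |: B))) = S.
  apply/setP => l; rewrite !inE; have [->|_] /= := eqVneq l j; first by rewrite jS.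
  by case lB: (l \in B) => //=; rewrite (subsetP sBS).
set C := S :\: (j |: B) in SE *; rewrite -SE.
have jC : j \notin C by rewrite !inE eqxx.
have dBC : [disjoint B & C].
  by rewrite -setI_eq0; apply/eqP/setP => l; rewrite !inE; case: (l \in B); rewrite ?orbT ?andbF.
rewrite -scalerAl !scalerA shuffle_signU1 // !belowU1 ?belowU ?inE ?negb_or ?jB //.
  by rewrite ltnn; congr (_ *: _); ring.
by rewrite eqxx.
Qed.

Lemma wedge_pmul f w e : wedge (pmul f w) e = pmul f (wedge w e).
Proof.
apply/ffunP => S; rewrite !ffunE mulr_sumr; apply: eq_bigr => A _.
by rewrite ffunE -scalerAr mulrA.
Qed.

Lemma wedge_pmulr f w e : wedge w (pmul f e) = pmul f (wedge w e).
Proof.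
apply/ffunP => S; rewrite !ffunE mulr_sumr; apply: eq_bigr => A _.
by rewrite ffunE -scalerAr mulrCA.
Qed.

Lemma wedge_linearr w : linear (wedge w).
Proof.
move=> a e e'; apply/ffunP => S; rewrite !ffunE scaler_sumr -big_split /=.
apply: eq_bigr => A _; rewrite !ffunE mulrDr -scalerAr scalerDr.
by rewrite !scalerA mulrC.
Qed.

HB.instance Definition _ w :=
  GRing.isLinear.Build rat (pform k) (pform k) _ (wedge w) (wedge_linearr w).

Lemma wedgeDl w w' e : wedge (w + w') e = wedge w e + wedge w' e.
Proof. by have := wedge_linearl e 1 w w'; rewrite !scale1r. Qed.
Lemma wedgeZl a w e : wedge (a *: w) e = a *: wedge w e.
Proof. by rewrite scale_pmul wedge_pmul -scale_pmul. Qed.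
Lemma wedge0l e : wedge 0 e = 0.
Proof. by rewrite -[0 in LHS](scale0r 0) wedgeZl scale0r. Qed.
Lemma wedgeNl w e : wedge (- w) e = - wedge w e.
Proof. by rewrite -scaleN1r wedgeZl scaleN1r. Qed.
Lemma wedge_suml (I : Type) (r : seq I) (P : pred I) (F : I -> pform k) e :
  wedge (\sum_(i <- r | P i) F i) e = \sum_(i <- r | P i) wedge (F i) e.
Proof.
by elim/big_rec2: _ => [|i x y _ <-]; rewrite ?wedge0l ?wedgeDl.
Qed.

Lemma wedge1l e : wedge pone e = e.
Proof.
apply/ffunP => S; rewrite ffunE (bigD1 set0) ?powersetE ?sub0set //= big1 ?addr0.
  rewrite setD0 ffunE eqxx mul1r /shuffle_sign eq_card0 ?expr0 ?scale1r //.
  by move=> -[a b]; rewrite !inE.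
by move=> A /andP[_ /negPf A0]; rewrite ffunE A0 mul0r scaler0.
Qed.

Lemma wedgeA w e u : wedge w (wedge e u) = wedge (wedge w e) u.
Proof.
elim/pform_ind: w => [w w' IH IH'||f w IH|j w IH].
- by rewrite !wedgeDl IH IH'.
- by rewrite !wedge1l.
- by rewrite !wedge_pmul IH.
- by rewrite !wedge_dX IH.
Qed.

Lemma wedge_dXr j w e : wedge e (dX j w) = dX j (wedge (eps e) w).
Proof.
elim/pform_ind: e => [e e' IH IH'||f e IH|i e IH].
- by rewrite raddfD /= !wedgeDl IH IH' linearD.
- by rewrite eps_pone !wedge1l.
- by rewrite eps_pmul !wedge_pmul IH dX_pmul.
- by rewrite eps_dX wedgeNl !wedge_dX IH dX_dX linearN.
Qed.

Lemma wedge1r w : wedge w pone = w.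
Proof.
elim/pform_ind: w => [w w' IH IH'||f w IH|j w IH].
- by rewrite wedgeDl IH IH'.
- by rewrite wedge1l.
- by rewrite wedge_pmul IH.
- by rewrite wedge_dX IH.
Qed.

(** Each dt_j of w that passes e costs one [eps], which allows e to have mixed degree. *)
Lemma wedge_comm_eps p w e : pform_homog p w -> wedge w e = wedge (iter p eps e) w.
Proof.
move=> wp; elim/homog_ind: p w / wp e => [p u v IHu IHv||p f w IH|p j w IH|p] e.
- by rewrite wedgeDl IHu IHv linearD.
- by rewrite wedge1l wedge1r.
- by rewrite wedge_pmul IH wedge_pmulr.
- by rewrite wedge_dX IH wedge_dXr iterS epsK.
- by rewrite wedge0l linear0.
Qed.

Lemma wedgeC p q w e : pform_homog p w -> pform_homog q e ->
  wedge w e = (-1) ^+ (p * q) *: wedge e w.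
Proof.
move=> wp eq; rewrite (wedge_comm_eps e wp) -wedgeZl; congr wedge.
elim: p {wp} => [|p IH] /=; first by rewrite mul0n scale1r.
by rewrite IH linearZ /= (eps_homog eq) scalerA mulSn exprD mulrC.
Qed.

Lemma pform_d_wedge w e :
  pform_d (wedge w e) = wedge (pform_d w) e + wedge (eps w) (pform_d e).
Proof.
elim/pform_ind: w => [w w' IH IH'||f w IH|j w IH].
- by rewrite wedgeDl !linearD /= !wedgeDl IH IH' addrACA.
- by rewrite eps_pone !wedge1l pform_d_pone wedge0l add0r.
- rewrite wedge_pmul !pform_d_pmul eps_pmul wedgeDl !wedge_pmul IH linearD /= addrA.
  congr (_ + _ + _); rewrite wedge_suml; apply: eq_bigr => i _.
  by rewrite wedge_dX wedge_pmul.
- by rewrite wedge_dX !pform_d_dX IH eps_dX !wedgeNl !wedge_dX linearD /= opprD.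
Qed.

Lemma homog_pmul p f w : pform_homog p w -> pform_homog p (pmul f w).
Proof.
by move=> /pform_homogP H; apply/pform_homogP => S /H; rewrite ffunE => ->; rewrite mulr0.
Qed.
Lemma homog_dX p j w : pform_homog p w -> pform_homog p.+1 (dX j w).
Proof.
move=> /pform_homogP H; apply/pform_homogP => S nS; rewrite ffunE; case: ifP => // jS.
by rewrite H ?scaler0 //; move: nS; rewrite (cardsD1 j) jS.
Qed.
Lemma homog_pone : pform_homog 0 pone.
Proof.
apply/pform_homogP => S nS; rewrite ffunE; case: (eqVneq S set0) nS => // ->.
by rewrite cards0.
Qed.
Lemma homogD p w e : pform_homog p w -> pform_homog p e -> pform_homog p (w + e).
Proof. by move=> wp ep; rewrite -[w]scale1r; apply: pform_homog_linear. Qed.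
Lemma homog_sum p (I : Type) (r : seq I) (P : pred I) (F : I -> pform k) :
  (forall i, pform_homog p (F i)) -> pform_homog p (\sum_(i <- r | P i) F i).
Proof.
by move=> FP; apply: (big_ind (pform_homog p)) => [||i _]; [exact: pform_homog0|exact: homogD|].
Qed.
Lemma homog_wedge p q w e : pform_homog p w -> pform_homog q e ->
  pform_homog (p + q) (wedge w e).
Proof.
move=> wp eq; elim/homog_ind: p w / wp => [p u v IHu IHv||p f w IH|p j w IH|p].
- by rewrite wedgeDl; apply: homogD.
- by rewrite wedge1l.
- by rewrite wedge_pmul; apply: homog_pmul.
- by rewrite wedge_dX addSn; apply: homog_dX.
- by rewrite wedge0l pform_homog0.
Qed.
Lemma homog_d p w : pform_homog p w -> pform_homog p.+1 (pform_d w).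
Proof.
move=> wp; rewrite pform_dE; apply: homog_sum => i; apply: homog_dX.
by apply/pform_homogP => S; rewrite ffunE => /(pform_homogP _ _ wp) ->; rewrite linear0.
Qed.

End Generators.
End SimplexForms.

(** * Pullback of polynomial forms along maps of simplices *)

Module Export SimplexPullback.
Import mpoly.

Lemma mpoly_gen_ind (n : nat) (P : {mpoly rat[n]} -> Prop) :
  (forall f g, P f -> P g -> P (f + g)) -> (forall c, P c%:MP) ->
  (forall i f, P f -> P ('X_i * f)) -> forall f, P f.
Proof.
move=> PD PC PX f; rewrite [f]mpolyE; apply: big_ind => [||m _].
- by rewrite -mpolyC0.
- exact: PD.
rewrite mpolyXE_id -mul_mpolyC mulrC.
elim/big_rec: _ => [|i p _ IH]; first by rewrite mul1r.
elim: (m i) => [|q IHq]; first by rewrite expr0 mul1r.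
by rewrite exprS -!mulrA; apply: PX; rewrite mulrA.
Qed.

(** The chain rule, behind the compatibility of [pullback] with d. *)
Lemma mderiv_comp k l (f : {mpoly rat[l]}) (T : l.-tuple {mpoly rat[k]}) i :
  (f \mPo T)^`M(i) = \sum_j (f^`M(j) \mPo T) * (tnth T j)^`M(i).
Proof.
elim/mpoly_gen_ind: f => [f g IHf IHg|c|j f IH].
- rewrite raddfD mderivD /= IHf IHg -big_split; apply: eq_bigr => j _ /=.
  by rewrite mderivD raddfD mulrDl.
- rewrite comp_mpolyC mderivC big1 // => j _.
  by rewrite mderivC raddf0 mul0r.
rewrite rmorphM /= comp_mpolyXU -tnth_nth mderivM IH.
rewrite [RHS](eq_bigr (fun j' => (j == j')%:R * ((f \mPo T) * (tnth T j)^`M(i)) +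
   tnth T j * ((f^`M(j') \mPo T) * (tnth T j')^`M(i)))) => [|j' _].
  rewrite big_split /= -mulr_sumr; congr (_ + _).
  rewrite (bigD1 j) //= eqxx mul1r big1 ?addr0; first by rewrite mulrC.
  by move=> j' /negPf; rewrite eq_sym => ->; rewrite mul0r.
rewrite mderivM mderivX raddfD /= !rmorphM /= comp_mpolyXU -tnth_nth mulrDl mulrA.
congr (_ + _); last by rewrite mulrA.
rewrite mnm1E; have [->|nij] := eqVneq j j'; last first.
  by rewrite scale0r raddf0 !mul0r.
have -> : (U_(j') - U_(j') = 0 :> 'X_{1..l})%MM by apply/mnmP => a; rewrite mnmBE mnm0E subnn.
by rewrite scale1r mpolyX0 comp_mpoly1 !mul1r.
Qed.

Lemma comp_mpoly_comp k l n (f : {mpoly rat[n]}) (T : n.-tuple {mpoly rat[l]})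
    (U : l.-tuple {mpoly rat[k]}) :
  (f \mPo T) \mPo U = f \mPo [tuple tnth T j \mPo U | j < n].
Proof.
elim/mpoly_gen_ind: f => [f g IHf IHg|c|j f IH].
- by rewrite !raddfD /= IHf IHg.
- by rewrite !comp_mpolyC.
- by rewrite !rmorphM /= IH !comp_mpolyXU -!tnth_nth tnth_mktuple.
Qed.

Section Pullback.
Variables (k l : nat) (th : 'I_k.+1 -> 'I_l.+1).
Implicit Types (w e : pform l) (f : {mpoly rat[l]}).

Definition pbT (j : 'I_l) : {mpoly rat[k]} := \sum_(i | th i == lift ord0 j) barycentric i.
Definition pbcomp f : {mpoly rat[k]} := f \mPo [tuple pbT j | j < l].
Definition dT (j : 'I_l) : pform k := pform_d (pform0 (pbT j)).

HB.instance Definition _ :=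
  GRing.isLinear.Build rat (pform l) (pform k) _ (pullback th) (pullback_linear th).

Lemma pbcompM f g : pbcomp (f * g) = pbcomp f * pbcomp g.
Proof. exact: rmorphM. Qed.
Lemma pbcompX j : pbcomp 'X_j = pbT j.
Proof. by rewrite /pbcomp comp_mpolyXU -tnth_nth tnth_mktuple. Qed.

Lemma d_pform0 n (g : {mpoly rat[n]}) : pform_d (pform0 g) = \sum_i dX i (pmul g^`M(i) (pone n)).
Proof. by rewrite pform0E pform_d_pmul pform_d_pone linear0 addr0. Qed.

Lemma wedge_d_pform0 n (g : {mpoly rat[n]}) u :
  wedge (pform_d (pform0 g)) u = \sum_i dX i (pmul g^`M(i) u).
Proof.
rewrite d_pform0 wedge_suml; apply: eq_bigr => i _.
by rewrite wedge_dX wedge_pmul wedge1l.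
Qed.

Lemma d_pform0_anticomm n (g h : {mpoly rat[n]}) u :
  wedge (pform_d (pform0 g)) (wedge (pform_d (pform0 h)) u) =
  - wedge (pform_d (pform0 h)) (wedge (pform_d (pform0 g)) u).
Proof.
rewrite !wedge_d_pform0 -sumrN.
under eq_bigr => i _ do rewrite !linear_sum.
rewrite exchange_big; apply: eq_bigr => i _ /=.
rewrite [pmul _ (\sum_(_ < _) _)]linear_sum [dX _ (\sum_(_ < _) _)]linear_sum -sumrN.
apply: eq_bigr => j _ /=.
by rewrite -!dX_pmul dX_dX !pmulA mulrC.
Qed.

Lemma d_pform0_sq n (g : {mpoly rat[n]}) u :
  wedge (pform_d (pform0 g)) (wedge (pform_d (pform0 g)) u) = 0.
Proof.
have /eqP := d_pform0_anticomm g g u.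
rewrite -addr_eq0 -mulr2n -scaler_nat scaler_eq0 => /orP[|/eqP//].
by rewrite pnatr_eq0.
Qed.

Lemma homog_d_pform0 n (g : {mpoly rat[n]}) : pform_homog 1 (pform_d (pform0 g)).
Proof. by apply: homog_d; rewrite pform0E; apply/homog_pmul/homog_pone. Qed.

Let B (s : seq 'I_l) : pform k := \big[@wedge k / pform0 1]_(j <- s) dT j.

Let B_ins j s1 s2 : wedge (dT j) (B (s1 ++ s2)) = (-1) ^+ size s1 *: B (s1 ++ j :: s2).
Proof.
elim: s1 => [|i s1 IH] /=; first by rewrite expr0 scale1r /B big_cons.
by rewrite /B !big_cons d_pform0_anticomm -/(B _) IH linearZ /= exprS mulN1r scaleNr.
Qed.

Let B_rep j s1 s2 : B (s1 ++ [:: j, j & s2]) = 0.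
Proof.
elim: s1 => [|i s1 IH]; first by rewrite /B !big_cons d_pform0_sq.
by rewrite /B big_cons -/(B _) IH linear0.
Qed.

Lemma pullbackE w :
  pullback th w = \sum_(S : {set 'I_l}) pmul (pbcomp (w S)) (B (enum S)).
Proof.
rewrite /pullback; apply: eq_bigr => S _.
rewrite pform0E wedge_pmul wedge1l; congr pmul.
by apply: eq_bigr => j _; rewrite tnth_mktuple.
Qed.

#[local] Opaque pullback wedge pform_d.

Lemma pullbackD u v : pullback th (u + v) = pullback th u + pullback th v.
Proof. exact: linearD. Qed.
Lemma pullback0 : pullback th 0 = 0.
Proof. exact: linear0. Qed.
Lemma pullbackZ a u : pullback th (a *: u) = a *: pullback th u.
Proof. exact: linearZ. Qed.
Lemma pullbackN u : pullback th (- u) = - pullback th u.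
Proof. exact: linearN. Qed.
Lemma pullback_sum (I : Type) (r : seq I) (P : pred I) (F : I -> pform l) :
  pullback th (\sum_(i <- r | P i) F i) = \sum_(i <- r | P i) pullback th (F i).
Proof. exact: (big_morph _ pullbackD pullback0). Qed.

Lemma pullback_mono S f : pullback th (mono S f) = pmul (pbcomp f) (B (enum S)).
Proof.
rewrite pullbackE (bigD1 S) //= ffunE eqxx big1 ?addr0 // => A nA.
by rewrite ffunE (negPf nA) /pbcomp raddf0 pmul0.
Qed.

Lemma pullback_pone : pullback th (pone l) = pone k.
Proof.
rewrite -[pone l]mono0 pullback_mono enum_set0 /B big_nil.
by rewrite /pbcomp comp_mpoly1 pmul1.
Qed.

Lemma pullback_pmul f w : pullback th (pmul f w) = pmul (pbcomp f) (pullback th w).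
Proof.
rewrite !pullbackE linear_sum; apply: eq_bigr => S _ /=.
by rewrite ffunE pbcompM pmulA.
Qed.

(** Relates [below j S] to the position of j in [enum S]: the elements of S below j are those in
    s1. *)
Lemma enum_split (j : 'I_l) : exists s1 s2,
  [/\ enum 'I_l = s1 ++ j :: s2, forall i, (i \in s1) = (i < j)%N & j \notin s2].
Proof.
have [s1 [s2 E]] : exists s1 s2, enum 'I_l = s1 ++ j :: s2.
  have jin : j \in enum 'I_l by rewrite mem_enum.
  exists (take (index j (enum 'I_l)) (enum 'I_l)), (drop (index j (enum 'I_l)).+1 (enum 'I_l)).
  by rewrite -{1}(cat_take_drop (index j (enum 'I_l)) (enum 'I_l)) (drop_nth j) ?index_mem // nth_index.
exists s1, s2; have := enum_uniq 'I_l; rewrite E cat_uniq /= negb_or.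
case/and4P => _ /andP[js1 _] js2 _; split => // i.
have : sorted ltn (map val (enum 'I_l)) by rewrite val_enum_ord iota_ltn_sorted.
rewrite E map_cat /= (sorted_pairwise ltn_trans) pairwise_cat /= allrel_consr.
case/and3P => /andP[/allP Hs1 _] _ /andP[/allP Hs2 _].
apply/idP/idP => [is1|ij]; first by apply: Hs1; apply: map_f.
have : i \in enum 'I_l by rewrite mem_enum.
rewrite E mem_cat inE => /orP[//|/orP[/eqP ij'|is2]].
  by rewrite ij' ltnn in ij.
by have /= := Hs2 _ (map_f val is2); rewrite ltnNge (ltnW ij).
Qed.

Lemma dX_mono (j : 'I_l) S f :
  dX j (mono S f) = if j \in S then 0 else below j S *: mono (j |: S) f.
Proof.
have [jS|jS] := boolP (j \in S); apply/ffunP => A; rewrite !ffunE.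
  case: (boolP (j \in A)) => // jA; case: eqP => [E|_]; last by rewrite scaler0.
  by rewrite -E !inE eqxx in jS.
have [->|nA] := eqVneq A (j |: S).
  by rewrite setU11 setU1K // eqxx belowU1 // ltnn mulr1.
rewrite scaler0; case: (boolP (j \in A)) => // jA; case: eqP => [E|_]; last by rewrite scaler0.
by rewrite -E setD1K // eqxx in nA.
Qed.

Lemma pullback_dX j w : pullback th (dX j w) = wedge (dT j) (pullback th w).
Proof.
suff H S f : pullback th (dX j (mono S f)) = wedge (dT j) (pullback th (mono S f)).
  rewrite (pform_mono w); apply: (big_ind (fun u =>
    pullback th (dX j u) = wedge (dT j) (pullback th u))) => [|u v Hu Hv|S _].
  - by rewrite !linear0.
  - by rewrite !linearD /= Hu Hv.
  - exact: H.
rewrite dX_mono pullback_mono wedge_pmulr.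
have [s1 [s2 [E s1P js2]]] := enum_split j.
have enumS (A : {set 'I_l}) : enum A = [seq x <- s1 | x \in A] ++
    (if j \in A then [:: j] else [::]) ++ [seq x <- s2 | x \in A].
  by rewrite {1}/enum_mem -enumT E filter_cat /=; case: ifP.
have js1 : j \notin s1 by rewrite s1P ltnn.
(* If j is in S, the factor dT j is repeated and both sides vanish. Otherwise [B_ins] moves it to
   its place, past the elements of S below j. *)
case: ifPn => jS.
  by rewrite linear0 enumS jS B_ins B_rep !linear0.
rewrite linearZ /= pullback_mono (enumS S) (negPf jS) B_ins linearZ /=.
have -> : below j S = (-1) ^+ size [seq x <- s1 | x \in S].
  rewrite /below -(card_uniqP (filter_uniq _ _)); last first.
    by have := enum_uniq 'I_l; rewrite E cat_uniq => /and3P[].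
  by congr (_ ^+ _); apply: eq_card => i; rewrite inE mem_filter s1P.
congr (_ *: pmul _ (B _)); rewrite enumS setU11 /=; congr (_ ++ _ :: _).
  by apply: eq_in_filter => i is1; rewrite !inE; case: eqP => // ij; rewrite -ij is1 in js1.
by apply: eq_in_filter => i is2; rewrite !inE; case: eqP => // ij; rewrite -ij is2 in js2.
Qed.

(** A map of algebras is determined by its values on functions and on the dt_j; functoriality of
    [pullback] is deduced from this. *)
Lemma pullback_unique (phi : pform l -> pform k) :
  {morph phi : u v / u + v} -> phi (pone l) = pone k ->
  (forall f w, phi (pmul f w) = pmul (pbcomp f) (phi w)) ->
  (forall j w, phi (dX j w) = wedge (dT j) (phi w)) -> phi =1 pullback th.
Proof.
move=> phiD phi1 phiM phiX w.
elim/pform_ind: w => [u v IHu IHv||f w IH|j w IH].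
- by rewrite phiD IHu IHv linearD.
- by rewrite phi1 pullback_pone.
- by rewrite phiM IH pullback_pmul.
- by rewrite phiX IH pullback_dX.
Qed.

Lemma pullback_wedge w e : pullback th (wedge w e) = wedge (pullback th w) (pullback th e).
Proof.
elim/pform_ind: w => [u v IHu IHv||f w IH|j w IH].
- by rewrite wedgeDl !linearD /= wedgeDl IHu IHv.
- by rewrite pullback_pone !wedge1l.
- by rewrite wedge_pmul !pullback_pmul wedge_pmul IH.
- by rewrite wedge_dX !pullback_dX IH wedgeA.
Qed.

Lemma pullback_homog p w : pform_homog p w -> pform_homog p (pullback th w).
Proof.
move=> wp; elim/homog_ind: p w / wp => [p u v IHu IHv||p f w IH|p j w IH|p].
- by rewrite pullbackD homogD.
- by rewrite pullback_pone homog_pone.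
- by rewrite pullback_pmul homog_pmul.
- by rewrite pullback_dX -add1n homog_wedge // homog_d_pform0.
- by rewrite pullback0 pform_homog0.
Qed.

Lemma pullback_pform0 f : pullback th (pform0 f) = pform0 (pbcomp f).
Proof. by rewrite !pform0E pullback_pmul pullback_pone. Qed.

Lemma pform_d_wedge_d n (g : {mpoly rat[n]}) u :
  pform_d (wedge (pform_d (pform0 g)) u) = - wedge (pform_d (pform0 g)) (pform_d u).
Proof.
rewrite pform_d_wedge pform_dd wedge0l add0r (eps_homog (homog_d_pform0 g)).
by rewrite expr1 scaleN1r wedgeNl.
Qed.

Lemma pullback_d w : pullback th (pform_d w) = pform_d (pullback th w).
Proof.
elim/pform_ind: w => [u v IHu IHv||f w IH|j w IH].
- by rewrite !linearD /= IHu IHv.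
- by rewrite pullback_pone !pform_d_pone linear0.
- rewrite pform_d_pmul linearD /= linear_sum /= !pullback_pmul pform_d_pmul IH.
  congr (_ + _); rewrite (eq_bigr (fun j => \sum_i
      dX i (pmul (pbcomp f^`M(j) * (pbT j)^`M(i)) (pullback th w)))) => [|j _].
    rewrite exchange_big; apply: eq_bigr => i _ /=.
    rewrite -linear_sum -pmul_suml mderiv_comp /=; congr (dX i (pmul _ _)).
    by apply: eq_bigr => j _; rewrite tnth_mktuple.
  rewrite pullback_dX pullback_pmul wedge_pmulr wedge_d_pform0 linear_sum.
  by apply: eq_bigr => i _ /=; rewrite -dX_pmul pmulA.
- by rewrite pform_d_dX linearN /= !pullback_dX IH pform_d_wedge_d.
Qed.

End Pullback.

Lemma sum_barycentric k : \sum_i @barycentric k i = 1.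
Proof.
rewrite big_ord_recl /barycentric unlift_none.
by under [X in _ + X]eq_bigr => i _ do rewrite liftK; rewrite subrK.
Qed.

(** For the eliminated coordinate t_0 this follows from the other ones, since the barycentric
    coordinates sum to 1 on both simplices. *)
Lemma pbcomp_barycentric k l (th : 'I_k.+1 -> 'I_l.+1) j :
  pbcomp th (barycentric j) = \sum_(i | th i == j) barycentric i.
Proof.
have H j' : pbcomp th (barycentric (lift ord0 j')) = pbT th j'.
  by rewrite /barycentric liftK pbcompX.
case: (unliftP ord0 j) => [j' ->|->]; first exact: H.
rewrite {1}/barycentric unlift_none /pbcomp rmorphB rmorph1 /=.
rewrite (_ : _ \mPo _ = \sum_i pbT th i); last first.
  by rewrite raddf_sum; apply: eq_bigr => i _; exact: pbcompX.
apply/(@addIr _ (\sum_i pbT th i)); rewrite subrK -(sum_barycentric k).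
by rewrite (partition_big th xpredT) //= big_ord_recl.
Qed.

Lemma pullback_comp k l n (mu : 'I_k.+1 -> 'I_l.+1) (th : 'I_l.+1 -> 'I_n.+1) w :
  pullback mu (pullback th w) = pullback (th \o mu) w.
Proof.
have pbE j : pbcomp mu (pbT th j) = pbT (th \o mu) j.
  rewrite /pbT /pbcomp raddf_sum /=.
  under eq_bigr => i _ do rewrite -/(pbcomp mu _) pbcomp_barycentric.
  rewrite [RHS](partition_big mu (fun i => th i == lift ord0 j)) //=.
  apply: eq_bigr => i /eqP thi; apply: eq_bigl => i'.
  by have [->|] := eqVneq (mu i') i; rewrite ?andbF // thi eqxx.
apply: (pullback_unique (phi := pullback mu \o pullback th)) => [u v||f u|j u] /=.
- by rewrite !linearD.
- by rewrite !pullback_pone.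
- rewrite !pullback_pmul; congr pmul; rewrite /pbcomp comp_mpoly_comp.
  congr (_ \mPo _); apply: eq_from_tnth => j; rewrite !tnth_mktuple.
  exact: pbE.
- rewrite !pullback_dX pullback_wedge; congr wedge.
  by rewrite /dT pullback_d pullback_pform0 pbE.
Qed.

Lemma pullback_id k (w : pform k) : pullback id w = w.
Proof.
have pbE (j : 'I_k) : pbT id j = 'X_j.
  by rewrite /pbT big_pred1_eq /barycentric liftK.
apply: esym; apply: (pullback_unique (phi := id)) => [u v||f u|j u] //.
  congr pmul; rewrite -{1}[f]comp_mpoly_id; congr (_ \mPo _).
  by apply: eq_from_tnth => j; rewrite !tnth_mktuple.
rewrite /dT pbE wedge_d_pform0 (bigD1 j) //= big1 ?addr0.
  by rewrite mderivX mnm1E eqxx scale1r (_ : (_ - _)%MM = 0%MM) ?mpolyX0 ?pmul1 //;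
    apply/mnmP => a; rewrite mnmBE mnm0E subnn.
by move=> i ij; rewrite mderivX mnm1E eq_sym (negPf ij) scale0r pmul0 linear0.
Qed.

End SimplexPullback.

(** * The Poincare lemma on a simplex *)

Module Export SimplexPoincare.
Import mpoly.
#[local] Opaque pullback wedge pform_d.

Section Parts.
Variable k : nat.
Implicit Types (w e : pform k) (f : {mpoly rat[k]}) (S : {set 'I_k}).

Definition hpart (p : nat) w : pform k := [ffun S : {set 'I_k} => if #|S| == p then w S else 0].

Lemma hpart_linear p : linear (hpart p).
Proof.
by move=> a u v; apply/ffunP => S; rewrite !ffunE; case: ifP => _; rewrite ?scaler0 ?addr0.
Qed.
HB.instance Definition _ p :=
  GRing.isLinear.Build rat (pform k) (pform k) _ (hpart p) (hpart_linear p).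

Lemma hpart_homog p w : pform_homog p (hpart p w).
Proof. by apply/pform_homogP => S /negPf E; rewrite ffunE E. Qed.

Lemma hpart_id p w : pform_homog p w -> hpart p w = w.
Proof.
move=> /pform_homogP H; apply/ffunP => S; rewrite ffunE.
by case: ifPn => // /H ->.
Qed.

Lemma hpart_neq p q w : pform_homog q w -> p != q -> hpart p w = 0.
Proof.
move=> /pform_homogP H pq; apply/ffunP => S; rewrite !ffunE.
by case: eqP => // Sp; apply: H; rewrite Sp.
Qed.

Lemma sum_hpart w : w = \sum_(p < k.+1) hpart p w.
Proof.
apply/ffunP => S; rewrite sum_ffunE.
have lS : (#|S| < k.+1)%N by rewrite ltnS -[X in (_ <= X)%N]card_ord max_card.
rewrite (bigD1 (Ordinal lS)) //= ffunE eqxx big1 ?addr0 // => p.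
by rewrite ffunE -val_eqE /= eq_sym => /negPf->.
Qed.

Lemma hpart_d p w : hpart p.+1 (pform_d w) = pform_d (hpart p w).
Proof.
rewrite [in LHS](sum_hpart w) !linear_sum /= [in RHS](sum_hpart w) !linear_sum /=.
apply: eq_bigr => q _; have hq := hpart_homog q w.
have [->|pq] := eqVneq p q.
  by rewrite (hpart_id (homog_d hq)) (hpart_id hq).
by rewrite (hpart_neq (homog_d hq)) ?(hpart_neq hq) ?linear0.
Qed.

(** The interior product with d/dt_j. *)
Definition contract (j : 'I_k) w : pform k :=
  [ffun S : {set 'I_k} => if j \in S then 0 else below j S *: w (j |: S)].

Lemma contract_linear j : linear (contract j).
Proof.
move=> a u v; apply/ffunP => S; rewrite !ffunE; case: ifP => _.
  by rewrite scaler0 addr0.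
by rewrite scalerDr !scalerA mulrC.
Qed.
HB.instance Definition _ j :=
  GRing.isLinear.Build rat (pform k) (pform k) _ (contract j) (contract_linear j).

Lemma contract_pmul j f w : contract j (pmul f w) = pmul f (contract j w).
Proof.
by apply/ffunP => S; rewrite !ffunE; case: ifP; rewrite ?mulr0 // scalerAr.
Qed.

Lemma contract_pone j : contract j (pone k) = 0.
Proof.
apply/ffunP => S; rewrite !ffunE; case: ifP => // _; case: eqP => [E|_].
  by have := setU11 j S; rewrite E inE.
by rewrite scaler0.
Qed.

Lemma contract_dX j i w :
  contract j (dX i w) = (if i == j then w else 0) - dX i (contract j w).
Proof.
apply/ffunP => S; rewrite !ffunE.
have [<-|nij] := eqVneq i j.
  case: ifPn => iS.
    by rewrite in_setD1 eqxx /= setD1K // scalerA belowD1 // ltnn mulr1 -expr2 sqrr_sign scale1r subrr.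
  by rewrite setU11 setU1K // scalerA belowU1 // ltnn mulr1 -expr2 sqrr_sign scale1r subr0.
rewrite ffunE sub0r in_setD1 (eq_sym j) nij /= !inE (negPf nij) /=.
case: ifPn => jS; case: ifPn => iS; rewrite ?scaler0 ?oppr0 //.
rewrite !scalerA -scaleNr; congr (_ *: w _).
  rewrite belowD1 // belowU1 //.
  by case: (ltngtP i j) nij => // [_ _|_ _|/val_inj->]; rewrite ?eqxx //; ring.
by apply/setP => a; rewrite !inE; have [->|] := eqVneq a j; rewrite //= eq_sym nij.
Qed.

(** The interior product with the Euler vector field centred at the vertex 0, the origin of the
    coordinates t_1, ..., t_k. *)
Definition euler w : pform k := \sum_j pmul 'X_j (contract j w).

Lemma euler_linear : linear euler.
Proof.
move=> a u v; rewrite /euler scaler_sumr -big_split; apply: eq_bigr => j _ /=.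
by rewrite !linearP.
Qed.
HB.instance Definition _ :=
  GRing.isLinear.Build rat (pform k) (pform k) _ euler euler_linear.

Lemma euler_pmul f w : euler (pmul f w) = pmul f (euler w).
Proof.
rewrite /euler linear_sum; apply: eq_bigr => j _ /=.
by rewrite contract_pmul !pmulA mulrC.
Qed.
Lemma euler_pone : euler (pone k) = 0.
Proof. by rewrite /euler big1 // => j _; rewrite contract_pone linear0. Qed.
Lemma euler_dX j w : euler (dX j w) = pmul 'X_j w - dX j (euler w).
Proof.
rewrite /euler linear_sum /=.
rewrite (eq_bigr (fun i => (if j == i then pmul 'X_i w else 0) -
    dX j (pmul 'X_i (contract i w)))) => [|i _].
  rewrite sumrB -big_mkcond /=; congr (_ - _).
  by rewrite (eq_bigl (pred1 j)) ?big_pred1_eq // => i; rewrite eq_sym.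
by rewrite contract_dX linearB /= dX_pmul; case: eqP => //; rewrite linear0.
Qed.
Lemma homog_contract p j w : pform_homog p.+1 w -> pform_homog p (contract j w).
Proof.
move=> /pform_homogP H; apply/pform_homogP => S nS; rewrite ffunE; case: ifPn => // jS.
by rewrite H ?scaler0 // cardsU1 jS.
Qed.
Lemma homog_euler p w : pform_homog p.+1 w -> pform_homog p (euler w).
Proof. by move=> H; apply: homog_sum => j; apply/homog_pmul/homog_contract. Qed.

(* the part of degree n, where both t_i and dt_i have degree 1 *)
Definition wpart (n : nat) w : pform k :=
  [ffun S : {set 'I_k} => if (#|S| <= n)%N then pihomog mdeg (n - #|S|) (w S) else 0].

Lemma wpart_linear n : linear (wpart n).
Proof.
move=> a u v; apply/ffunP => S; rewrite !ffunE; case: ifP => _; first by rewrite linearP.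
by rewrite scaler0 addr0.
Qed.
HB.instance Definition _ n :=
  GRing.isLinear.Build rat (pform k) (pform k) _ (wpart n) (wpart_linear n).

Lemma pihomog_mulX d (i : 'I_k) f :
  pihomog mdeg d ('X_i * f) = if d is d'.+1 then 'X_i * pihomog mdeg d' f else 0.
Proof.
rewrite [f]mpolyE mulr_sumr !linear_sum /=.
case: d => [|d]; [rewrite big1 // => m _|rewrite linear_sum mulr_sumr /=].
  by rewrite -scalerAr linearZ /= -mpolyXD pihomogX /= mdegD mdeg1 scaler0.
apply: eq_bigr => m _; rewrite -scalerAr !linearZ /= -mpolyXD !pihomogX /= mdegD mdeg1 eqSS.
by rewrite -scalerAr; case: ifP; rewrite ?mulr0 // mpolyXD.
Qed.

Lemma wpart_mulX n i w :
  wpart n (pmul 'X_i w) = if n is n'.+1 then pmul 'X_i (wpart n' w) else 0.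
Proof.
apply/ffunP => S; case: n => [|n]; rewrite !ffunE pihomog_mulX.
  by rewrite sub0n; case: ifP.
case: ltngtP => [Sn|Sn|->]; last by rewrite subnn ltnn mulr0.
  by rewrite -ltnS Sn subSn.
by rewrite leqNgt (ltnW Sn) mulr0.
Qed.

Lemma wpart_dX n i w :
  wpart n (dX i w) = if n is n'.+1 then dX i (wpart n' w) else 0.
Proof.
apply/ffunP => S; case: n => [|n]; rewrite !ffunE; case: (boolP (i \in S)) => iS.
- by rewrite (cardsD1 i) iS.
- by rewrite linear0; case: ifP.
- by rewrite (cardsD1 i) iS add1n ltnS subSS; case: ifP; rewrite ?scaler0 // linearZ.
- by rewrite linear0; case: ifP.
Qed.

Lemma wpart_pone n : wpart n (pone k) = if n == 0%N then pone k else 0.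
Proof.
apply/ffunP => S; rewrite ffunE.
have -> : (if n == 0%N then pone k else 0) S =
          if n == 0%N then (if S == set0 then 1 else 0) else 0.
  by case: ifP; rewrite !ffunE.
rewrite ffunE; have [->|S0] := eqVneq S set0; last by rewrite linear0 !if_same.
by rewrite cards0 leq0n subn0 -mpolyX0 pihomogX /= mdeg0 eq_sym.
Qed.

Lemma weight_ind (P : pform k -> Prop) :
  (forall u v, P u -> P v -> P (u + v)) -> (forall a w, P w -> P (a *: w)) ->
  P (pone k) -> (forall i w, P w -> P (pmul 'X_i w)) ->
  (forall j w, P w -> P (dX j w)) -> forall w, P w.
Proof.
move=> PD PZ P1 PM PX; apply: pform_ind => // f w Pw.
elim/mpoly_gen_ind: f => [f g Pf Pg|c|i f Pf].
- by rewrite pmulDl; apply: PD.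
- by rewrite -scale_pmul; apply: PZ.
- by rewrite -pmulA; apply: PM.
Qed.

Lemma pform_d_mulX i w : pform_d (pmul 'X_i w) = dX i w + pmul 'X_i (pform_d w).
Proof.
rewrite pform_d_pmul; congr (_ + _); rewrite (bigD1 i) //= big1 ?addr0.
  by rewrite mderivX mnm1E eqxx scale1r (_ : (_ - _)%MM = 0%MM) ?mpolyX0 ?pmul1 //;
    apply/mnmP => a; rewrite mnmBE mnm0E subnn.
by move=> j ij; rewrite mderivX mnm1E eq_sym (negPf ij) scale0r pmul0 linear0.
Qed.

Lemma wpart_d n w : wpart n (pform_d w) = pform_d (wpart n w).
Proof.
elim/weight_ind: w n => [u v IHu IHv|a w IH||i w IH|j w IH] n.
- by rewrite !linearD /= IHu IHv.
- by rewrite !linearZ /= IH.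
- by rewrite wpart_pone pform_d_pone linear0; case: eqP; rewrite ?linear0 ?pform_d_pone.
- rewrite pform_d_mulX linearD /= wpart_dX !wpart_mulX.
  by case: n => [|n]; rewrite ?linear0 ?addr0 // IH pform_d_mulX.
- rewrite pform_d_dX linearN /= !wpart_dX; case: n => [|n]; rewrite ?linear0 ?oppr0 //.
  by rewrite IH pform_d_dX.
Qed.

(** Cartan's formula: the Lie derivative along the Euler field multiplies a form of weight n by
    n. *)
Lemma cartan n w :
  pform_d (euler (wpart n w)) + euler (pform_d (wpart n w)) = n%:R *: wpart n w.
Proof.
elim/weight_ind: w n => [u v IHu IHv|a w IH||i w IH|j w IH] n.
- by rewrite !linearD /= addrACA IHu IHv.
- by rewrite !linearZ /= -scalerDr IH !scalerA mulrC.
- rewrite wpart_pone; case: eqP => [->|_]; last by rewrite !linear0 addr0.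
  by rewrite euler_pone pform_d_pone !linear0 addr0 scale0r.
- rewrite wpart_mulX; case: n => [|n]; first by rewrite !linear0 addr0.
  rewrite euler_pmul !pform_d_mulX linearD /= euler_dX euler_pmul.
  rewrite addrACA [X in X + _]addrC subrK -linearD IH linearZ /=.
  by rewrite -[n.+1]add1n natrD scalerDl scale1r.
- rewrite wpart_dX; case: n => [|n]; first by rewrite !linear0 addr0.
  rewrite euler_dX linearB /= pform_d_mulX !pform_d_dX [euler (- _)]linearN /= euler_dX opprK opprB.
  set a := dX j _; set b := pmul _ _; set c := dX j _.
  rewrite -[n.+1]add1n natrD scalerDl scale1r.
  have <- : c + dX j (euler (pform_d (wpart n w))) = n%:R *: a by rewrite -linearD IH linearZ.
  by rewrite [a + b + c]addrAC addrACA subrr addr0 addrA.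
Qed.

Lemma wpart_homog p n w : pform_homog p w -> pform_homog p (wpart n w).
Proof.
move=> /pform_homogP H; apply/pform_homogP => S /H E; rewrite ffunE E linear0.
exact: if_same.
Qed.

Definition weight_bound w : nat := (\sum_S (msize (w S) + #|S|)).+1.

Lemma wpart_large n w : (weight_bound w <= n)%N -> wpart n w = 0.
Proof.
move=> H; apply/ffunP => S; rewrite !ffunE; case: ifP => // Sn.
have nS : (msize (w S) <= n - #|S|)%N.
  rewrite leq_subRL // addnC; apply: leq_trans (ltnW H).
  by rewrite (bigD1 S) //= leq_addr.
rewrite pihomogE big_seq_cond big_pred0 // => m; apply/negbTE/negP => /andP[mS /eqP E].
by have := msize_mdeg_lt mS; rewrite ltnNge -/(mdeg m) [mdeg m]E nS.
Qed.

Lemma sum_wpart N w : (weight_bound w <= N)%N -> w = \sum_(n < N) wpart n w.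
Proof.
move=> HN.
suff [N0 H0] : exists N0, forall N, (N0 <= N)%N -> w = \sum_(n < N) wpart n w.
  rewrite [LHS](H0 _ (leq_maxl N0 N)) -(subnKC (leq_maxr N0 N)) big_split_ord /=.
  by rewrite [X in _ + X]big1 ?addr0 // => i _; apply/wpart_large/(leq_trans HN)/leq_addr.
elim/weight_ind: w {HN} => [u v [A Hu] [B Hv]|a w [A Hw]||i w [A Hw]|j w [A Hw]].
- exists (maxn A B) => n; rewrite geq_max => /andP[/Hu En /Hv En'].
  by rewrite {1}En {1}En' -big_split; apply: eq_bigr => q _; rewrite linearD.
- exists A => n /Hw En; rewrite {1}En scaler_sumr.
  by apply: eq_bigr => q _; rewrite linearZ.
- exists 1%N => -[//|n] _; rewrite big_ord_recl wpart_pone /= big1 ?addr0 // => q _.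
  by rewrite wpart_pone.
- exists A.+1 => -[//|n] /Hw En; rewrite big_ord_recl wpart_mulX add0r {1}En linear_sum.
  by apply: eq_bigr => q _; rewrite wpart_mulX.
- exists A.+1 => -[//|n] /Hw En; rewrite big_ord_recl wpart_dX add0r {1}En linear_sum.
  by apply: eq_bigr => q _; rewrite wpart_dX.
Qed.

(* The integral of w along the segments issuing from the vertex 0; the term n = 0
   vanishes because 0^-1 = 0. *)
Definition cone_integral w : pform k :=
  \sum_(n < weight_bound w) n%:R^-1 *: euler (wpart n w).

Lemma cone_integralE N w : (weight_bound w <= N)%N ->
  cone_integral w = \sum_(n < N) n%:R^-1 *: euler (wpart n w).
Proof.
move=> HN; rewrite -(subnKC HN) big_split_ord /= [X in _ + X]big1 ?addr0 // => i _.
by rewrite wpart_large ?leq_addr // linear0 scaler0.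
Qed.

Lemma homog_cone_integral p w : pform_homog p.+1 w -> pform_homog p (cone_integral w).
Proof.
move=> wp; apply: homog_sum => n; rewrite scale_pmul; apply/homog_pmul/homog_euler.
exact: wpart_homog.
Qed.

Lemma d_cone_integral p w : pform_homog p.+1 w -> pform_d w = 0 ->
  pform_d (cone_integral w) = w.
Proof.
move=> wp dw; rewrite [RHS](sum_wpart (leqnn _)) linear_sum; apply: eq_bigr => n _ /=.
have := cartan n w; rewrite -wpart_d dw !linear0 addr0 linearZ /= => ->.
(* Division by n leaves out n = 0, but only constant functions have weight 0, and w has positive
   degree. *)
case: (val n) => [|q]; last by rewrite scalerA mulVf ?scale1r // pnatr_eq0.
rewrite !scale0r scaler0; apply/ffunP => S; rewrite !ffunE leqn0 cards_eq0.
case: eqP => // ->; move/pform_homogP: wp => ->; last by rewrite cards0.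
by rewrite linear0.
Qed.

End Parts.

Lemma pullback_hpart k l (th : 'I_k.+1 -> 'I_l.+1) p w :
  pullback th (hpart p w) = hpart p (pullback th w).
Proof.
rewrite [in RHS](sum_hpart w) [in LHS](sum_hpart w) !pullback_sum.
rewrite !(linear_sum (hpart p)) pullback_sum; apply: eq_bigr => q _ /=.
have hq := hpart_homog q w; have hq' := pullback_homog th hq.
have [->|pq] := eqVneq p q; first by rewrite (hpart_id hq) (hpart_id hq').
by rewrite (hpart_neq hq) // (hpart_neq hq') // pullback0.
Qed.

Section Vertex0.
Variables (k l : nat) (th : 'I_k.+1 -> 'I_l.+1).
Hypothesis th0 : th ord0 = ord0.

Let I j := [pred i | th (lift ord0 i) == lift ord0 j].

(** As [th] fixes the vertex 0, it is linear in t_1, ..., t_k without a constant term. Therefore it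
    respects weights and the Euler field, and commutes with [cone_integral]. *)
Lemma pbT_vertex0 j : pbT th j = \sum_(i in I j) 'X_i.
Proof.
rewrite /pbT big_mkcond big_ord_recl th0 (negPf (neq_lift _ _)) /= add0r.
by rewrite -big_mkcond; apply: eq_bigr => i _; rewrite /barycentric liftK.
Qed.

Let pullback_mulX j w : pullback th (pmul 'X_j w) = \sum_(i in I j) pmul 'X_i (pullback th w).
Proof. by rewrite pullback_pmul pbcompX pbT_vertex0 pmul_suml. Qed.

Let pullback_dX0 j w : pullback th (dX j w) = \sum_(i in I j) dX i (pullback th w).
Proof.
rewrite pullback_dX /dT pbT_vertex0 pform0E pmul_suml (linear_sum (@pform_d k)) wedge_suml.
apply: eq_bigr => i _ /=; rewrite pform_d_mulX pform_d_pone linear0 addr0.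
by rewrite wedge_dX wedge1l.
Qed.

Lemma euler_pullback w : euler (pullback th w) = pullback th (euler w).
Proof.
elim/weight_ind: w => [u v IHu IHv|a w IH||j w IH|j w IH].
- by rewrite pullbackD !linearD /= IHu IHv.
- by rewrite pullbackZ !linearZ /= IH.
- by rewrite pullback_pone !euler_pone pullback0.
- by rewrite euler_pmul !pullback_pmul euler_pmul IH.
- rewrite pullback_dX0 linear_sum euler_dX pullbackD pullbackN /= pullback_dX0 pullback_mulX -IH.
  by rewrite -sumrB; apply: eq_bigr => i _; rewrite euler_dX.
Qed.

Lemma wpart_pullback n w : wpart n (pullback th w) = pullback th (wpart n w).
Proof.
elim/weight_ind: w n => [u v IHu IHv|a w IH||j w IH|j w IH] n.
- by rewrite pullbackD !linearD /= IHu IHv.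
- by rewrite pullbackZ !linearZ /= IH.
- rewrite pullback_pone !wpart_pone.
  by case: eqP => _; rewrite ?pullback_pone ?pullback0.
- rewrite pullback_mulX linear_sum wpart_mulX; case: n => [|n].
    by rewrite big1 ?pullback0 // => i _; rewrite /= wpart_mulX.
  by rewrite pullback_mulX; apply: eq_bigr => i _; rewrite /= wpart_mulX IH.
- rewrite pullback_dX0 linear_sum wpart_dX; case: n => [|n].
    by rewrite big1 ?pullback0 // => i _; rewrite /= wpart_dX.
  by rewrite pullback_dX0; apply: eq_bigr => i _; rewrite /= wpart_dX IH.
Qed.

Lemma cone_integral_pullback w : cone_integral (pullback th w) = pullback th (cone_integral w).
Proof.
set N := maxn (weight_bound w) (weight_bound (pullback th w)).
rewrite (@cone_integralE _ N) ?leq_maxr // (@cone_integralE _ N w) ?leq_maxl //.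
rewrite pullback_sum; apply: eq_bigr => n _.
by rewrite pullbackZ wpart_pullback euler_pullback.
Qed.

End Vertex0.

Lemma cone_integral0 k : cone_integral (0 : pform k) = 0.
Proof. by rewrite /cone_integral big1 // => n _; rewrite !linear0. Qed.

Lemma pone_neq0 k : pone k != 0.
Proof.
apply/eqP => /ffunP /(_ set0); rewrite !ffunE eqxx => /eqP.
by rewrite oner_eq0.
Qed.

Lemma closed_homog0 k (w : pform k) : pform_homog 0 w -> pform_d w = 0 ->
  exists a : rat, w = a *: pone k.
Proof.
move=> /pform_homogP w0 dw; exists (w set0)@_0%MM.
apply/ffunP => S; rewrite !ffunE; have [->|S0] := eqVneq S set0; last first.
  by rewrite (w0 S) ?cards_eq0 // scaler0.
apply/mpolyP => m; rewrite mcoeffZ mcoeff1.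
have [->|m0] := eqVneq m 0%MM; first by rewrite mulr1.
have /existsP[i mi] : [exists i, m i != 0%N].
  apply: contraR m0 => /existsPn H; apply/eqP/mnmP => i.
  by rewrite mnm0E; apply/eqP; have := H i; rewrite negbK.
(* Up to sign, this coefficient is m_i times the coefficient of w at m, and m_i is not 0. *)
have : (pform_d w [set i])@_(m - U_(i)) = 0 by rewrite dw ffunE mcoeff0.
rewrite pform_dE sum_ffunE (bigD1 i) //= big1 ?addr0 => [|j ji].
  rewrite !ffunE set11 setDv mcoeffZ mcoeff_mderiv submK ?lep1mP // => E.
  have {E} : (below i [set i] : rat) * ((w set0)@_m * ((m - U_(i))%MM i).+1%:R) = 0.
    by rewrite mulr_natr; exact: E.
  move/eqP; rewrite !mulf_eq0 signr_eq0 /= pnatr_eq0 orbF => /eqP ->.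
  by rewrite mulr0.
by rewrite !ffunE inE (negPf ji).
Qed.

Lemma pullback_bmul k l (th : 'I_k.+1 -> 'I_l.+1) j w :
  pullback th (pmul (barycentric j) w) =
  \sum_(i | th i == j) pmul (barycentric i) (pullback th w).
Proof. by rewrite pullback_pmul pbcomp_barycentric pmul_suml. Qed.

Lemma sum_bmul k (w : pform k) : \sum_i pmul (barycentric i) w = w.
Proof. by rewrite -pmul_suml sum_barycentric pmul1. Qed.

End SimplexPoincare.

(** * Integration over a simplex and Stokes' theorem *)

Module Export SimplexStokes.
Import mpoly ssrcomplements.
#[local] Opaque pullback wedge pform_d.

Lemma sum_two (V : zmodType) (I : finType) (F : I -> V) i j : j != i ->
  (forall l, l != i -> l != j -> F l = 0) -> \sum_l F l = F i + F j.
Proof.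
move=> ji F0; rewrite (bigD1 i) // (bigD1 j) //= big1 ?addr0 // => l /andP[].
exact: F0.
Qed.

Section Integral.
Variable k : nat.
Implicit Types (f g : {mpoly rat[k]}).

Definition dirichlet (m : 'X_{1..k}) : rat := (\prod_(i < k) (m i)`!)%:R / ((k + mdeg m)`!)%:R.
Definition mint f : rat := \sum_(m <- msupp f) f@_m * dirichlet m.

Lemma mint_wide N f : (msize f <= N)%N ->
  mint f = \sum_(m : 'X_{1..k < N}) f@_m * dirichlet m.
Proof.
move=> fN; rewrite /mint (big_mksub 'X_{1..k < N}) ?msupp_uniq //=; last first.
  by move=> m /msize_mdeg_lt /leq_trans; apply.
by rewrite big_rmcond // => m /memN_msupp_eq0 ->; rewrite mul0r.
Qed.

Lemma mint_linear : linear (mint : {mpoly rat[k]} -> rat^o).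
Proof.
move=> a f g; set N := maxn (msize (a *: f + g)) (maxn (msize f) (msize g)).
rewrite (@mint_wide N) ?leq_maxl // (@mint_wide N f) ?(@mint_wide N g) //; last first.
- by rewrite /N; lia.
- by rewrite /N; lia.
rewrite scaler_sumr -big_split; apply: eq_bigr => m _ /=.
by rewrite mcoeffD mcoeffZ mulrDl -mulrA.
Qed.
HB.instance Definition _ := GRing.isLinear.Build rat {mpoly rat[k]} rat^o _ mint mint_linear.

Lemma mint0 : mint 0 = 0.
Proof. exact: linear0. Qed.
Lemma mintD f g : mint (f + g) = mint f + mint g.
Proof. exact: linearD. Qed.
Lemma mintZ a f : mint (a *: f) = a * mint f.
Proof. exact: linearZ. Qed.
Lemma mintB f g : mint (f - g) = mint f - mint g.
Proof. exact: linearB. Qed.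
Lemma mint_sum (I : Type) (r : seq I) (P : pred I) (F : I -> {mpoly rat[k]}) :
  mint (\sum_(i <- r | P i) F i) = \sum_(i <- r | P i) mint (F i).
Proof. exact: (big_morph _ mintD mint0). Qed.

Lemma mintX m : mint 'X_[m] = dirichlet m.
Proof. by rewrite /mint msuppX big_seq1 mcoeffX eqxx mul1r. Qed.

Lemma pform_intE (w : pform k) : pform_int w = mint (w [set: 'I_k]).
Proof. by apply: eq_bigr => m _; rewrite mulrA. Qed.

Lemma prod_fact_addU (m : 'X_{1..k}) j :
  \prod_(i < k) ((m + U_(j))%MM i)`! = ((m j).+1 * \prod_(i < k) (m i)`!)%N.
Proof.
rewrite (bigD1 j) //= [in RHS](bigD1 j) //= mnmDE mnm1E eqxx addn1 factS mulnA.
by congr muln; apply: eq_bigr => i ij; rewrite mnmDE mnm1E eq_sym (negPf ij) addn0.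
Qed.

(** Dirichlet's formula with a power of t_0 as well, which the inclusion of the face opposite the
    vertex 0 introduces. The induction on e expands one factor t_0 = 1 - \sum_j t_j. *)
Lemma mint_barycentric0 e m :
  mint ((1 - \sum_(j < k) 'X_j) ^+ e * 'X_[m]) =
  (e`! * \prod_(i < k) (m i)`!)%:R / ((k + e + mdeg m)`!)%:R.
Proof.
elim: e m => [|e IH] m; first by rewrite expr0 mul1r mintX mul1n addn0.
rewrite exprSr -mulrA mulrBl mul1r mulr_suml mulrBr mulr_sumr.
rewrite mintB IH mint_sum.
rewrite (eq_bigr (fun j : 'I_k => (m j).+1%:R *
   ((e`! * \prod_(i < k) (m i)`!)%:R / ((k + e + mdeg m).+1`!)%:R))) => [|j _]; last first.
  rewrite -mpolyXD addmC IH mdegD mdeg1 prod_fact_addU addn1 addnS.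
  by rewrite mulnCA natrM mulrA.
rewrite -mulr_suml -natr_sum; set q := (_ * \prod_(_ < _) _)%N.
(* The two terms combine because (k + e + |m| + 1) - (k + |m|) = e + 1. *)
have -> : (\sum_(j < k) (m j).+1 = mdeg m + k)%N.
  rewrite mdegE -[X in (_ + X)%N]card_ord -sum1_card -big_split.
  by apply: eq_bigr => j _; rewrite /= addn1.
rewrite [e.+1`!]factS -mulnA -/q addnS addSn [(k + e + mdeg m).+1`!]factS !natrM !invfM.
have n0 p : (p`!)%:R != 0 :> rat by rewrite pnatr_eq0 -lt0n fact_gt0.
have := n0 (k + e + mdeg m)%N; have : (k + e + mdeg m).+1%:R != 0 :> rat by rewrite pnatr_eq0.
rewrite -natr1 !natrD => h1 h2; field.
by rewrite h1 h2.
Qed.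

End Integral.

Section Stokes.
Variable k : nat.
Implicit Types (f : {mpoly rat[k.+1]}) (S : {set 'I_k.+1}).

Lemma pbT_lift0 (j : 'I_k.+1) : pbT (lift ord0 : 'I_k.+1 -> 'I_k.+2) j = barycentric j.
Proof.
by rewrite /pbT (eq_bigl (pred1 j)) ?big_pred1_eq // => i; rewrite (inj_eq lift_inj).
Qed.

Lemma pbT_lift_eq (j : 'I_k.+1) : pbT (lift (lift ord0 j)) j = 0.
Proof. by rewrite /pbT big_pred0 // => i; rewrite eq_sym (negPf (neq_lift _ _)). Qed.

Lemma pbT_lift_lift (j : 'I_k.+1) (i : 'I_k) : pbT (lift (lift ord0 j)) (lift j i) = 'X_i.
Proof.
rewrite /pbT (eq_bigl (pred1 (lift ord0 i))) ?big_pred1_eq.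
  by rewrite /barycentric liftK.
move=> a /=; have E : lift (lift ord0 j) (lift ord0 i) = lift ord0 (lift j i).
  by apply: val_inj; rewrite /= /bump; lia.
by rewrite -E (inj_eq lift_inj).
Qed.

(** The fundamental theorem of calculus in the direction of the j-th coordinate x_j, along segments
    from the face x_j = 0 to the face t_0 = 0. On a monomial without x_j the two face integrals
    cancel; on any other the one over x_j = 0 vanishes. *)
Lemma mint_stokes f (j : 'I_k.+1) :
  mint f^`M(j) = mint (pbcomp (lift ord0) f) - mint (pbcomp (lift (lift ord0 j)) f).
Proof.
suff H m : mint ('X_[m])^`M(j) = mint (pbcomp (lift ord0 : 'I_k.+1 -> 'I_k.+2) 'X_[m]) -
    mint (pbcomp (lift (lift ord0 j) : 'I_k.+1 -> 'I_k.+2) 'X_[m]).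
  rewrite /pbcomp [f]mpolyE; apply: (big_ind (fun f => mint f^`M(j) =
     mint (f \mPo _) - mint (f \mPo _))) => [|f1 f2 E1 E2|m _].
  - by rewrite mderiv0 !comp_mpoly0 !mint0 subrr.
  - rewrite mderivD !comp_mpolyD !mintD.
    by rewrite E1 E2 opprD addrACA.
  - rewrite mderivZ !comp_mpolyZ !mintZ.
    by rewrite H mulrBr.
rewrite /pbcomp mderivX mintZ mintX !comp_mpolyX.
rewrite (eq_bigr (fun i => barycentric i ^+ m i)); last first.
  by move=> i _; rewrite tnth_mktuple pbT_lift0.
have -> : mint (\prod_(i < k.+1) barycentric i ^+ m i) =
          (\prod_(i < k.+1) (m i)`!)%:R / ((k + mdeg m)`!)%:R.
  rewrite big_ord_recl /barycentric unlift_none.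
  rewrite (_ : \prod_(i < k) _ = 'X_[[multinom m (lift ord0 i) | i < k]]); last first.
    rewrite [RHS]mpolyXE_id; apply: eq_bigr => i _; rewrite mnmE.
    by rewrite liftK.
  rewrite mint_barycentric0 mdegE [in RHS]big_ord_recl mdegE [in RHS]big_ord_recl addnA.
  by do 2?congr (_%:R / _%:R); [congr muln|congr (_ `!); congr addn]; apply: eq_bigr => i _;
    rewrite mnmE.
have -> : mint (\prod_(i < k.+1) tnth [tuple pbT (lift (lift ord0 j)) j0 | j0 < k.+1] i ^+ m i) =
          if m j == 0%N then (\prod_(i < k.+1) (m i)`!)%:R / ((k + mdeg m)`!)%:R else 0.
  rewrite (bigD1_ord j) //= tnth_mktuple pbT_lift_eq.
  case: eqP => mj; last by case: (m j) mj => // q _; rewrite expr0n /= mul0r mint0.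
  rewrite mj mul1r (_ : \prod_(i < k) _ = 'X_[[multinom m (lift j i) | i < k]]); last first.
    rewrite [RHS]mpolyXE_id; apply: eq_bigr => i _; rewrite mnmE.
    by rewrite tnth_mktuple pbT_lift_lift.
  rewrite mintX /dirichlet !mdegE [in RHS](bigD1_ord j) // [in RHS](bigD1_ord j) //= mj mul1n add0n.
  by congr (_%:R / _%:R); [|congr (_ `!); congr addn]; apply: eq_bigr => i _; rewrite mnmE.
case: ifPn => [/eqP mj0|mj].
  by rewrite mj0 mul0r subrr.
rewrite subr0 /dirichlet.
have {mj} -> : (m = (m - U_(j)) + U_(j))%MM by rewrite submK // lep1mP.
move: (m - U_(j))%MM => {}m; rewrite addmK prod_fact_addU mnmDE mnm1E eqxx addn1.
rewrite mdegD mdeg1 addn1 -addSnnS [RHS]mulrC natrM mulrA mulrC -mulrA.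
by congr (_ * _); rewrite mulrC.
Qed.

Lemma enum_setC1_lift (j : 'I_k.+1) : enum (~: [set j]) = map (lift j) (enum 'I_k).
Proof.
apply: (inj_map val_inj); apply: (irr_sorted_eq ltn_trans ltnn).
- rewrite (subseq_sorted ltn_trans (s2 := map val (enum 'I_k.+1))) ?val_enum_ord ?iota_ltn_sorted //.
  by rewrite -val_enum_ord map_subseq // {1}/enum_mem -enumT filter_subseq.
- rewrite -map_comp sorted_map; have := iota_ltn_sorted 0 k.
  rewrite -val_enum_ord sorted_map; apply: sub_sorted => a b /=; rewrite /bump; lia.
- move=> a; apply/mapP/mapP => -[b].
    rewrite mem_enum !inE => bj ->; case: (unliftP j b) bj => [i ->|->]; rewrite ?eqxx // => _.
    by exists (lift j i); rewrite ?map_f ?mem_enum.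
  case/mapP => i _ -> ->; exists (lift j i); rewrite // mem_enum !inE eq_sym.
  exact: neq_lift.
Qed.

Lemma pullback_face_top (th : 'I_k.+1 -> 'I_k.+2) (j : 'I_k.+1) :
  (forall i, pbT th (lift j i) = 'X_i) -> pullback th (mono (~: [set j]) 1) = mono setT 1.
Proof.
move=> H; rewrite -[RHS]pullback_id !pullback_mono /pbcomp !comp_mpoly1 !pmul1.
rewrite enum_setC1_lift big_map enum_setT -enumT; apply: eq_bigr => i _.
by rewrite /dT H /pbT big_pred1_eq /barycentric liftK.
Qed.

Lemma pform_int_homog n p (w : pform n) : pform_homog p w -> p != n -> pform_int w = 0.
Proof.
move=> /pform_homogP wp pn; rewrite pform_intE wp ?mint0 //.
by rewrite cardsT card_ord eq_sym.
Qed.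

Lemma pform_int0 n : pform_int (0 : pform n) = 0.
Proof. by rewrite pform_intE ffunE mint0. Qed.
Lemma pform_intD n (u v : pform n) : pform_int (u + v) = pform_int u + pform_int v.
Proof. by rewrite !pform_intE ffunE mintD. Qed.
Lemma pform_intZ n a (u : pform n) : pform_int (a *: u) = a * pform_int u.
Proof. by rewrite !pform_intE ffunE mintZ. Qed.

Lemma homog_mono n (S : {set 'I_n}) (f : {mpoly rat[n]}) : pform_homog #|S| (mono S f).
Proof.
apply/pform_homogP => T nT; rewrite ffunE.
by have [E|//] := eqVneq T S; rewrite E eqxx in nT.
Qed.

Lemma d_mono_setC1 j f :
  pform_d (mono (~: [set j]) f) = (-1) ^+ j *: mono setT f^`M(j).
Proof.
rewrite pform_dE (bigD1 j) //= big1 ?addr0 => [|i ij].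
  have -> : pderiv j (mono (~: [set j]) f) = mono (~: [set j]) f^`M(j).
    by apply/ffunP => S; rewrite !ffunE; case: ifP; rewrite ?linear0.
  rewrite dX_mono !inE eqxx /=; congr (_ *: mono _ _); last by rewrite setUCr.
  rewrite /below; congr (_ ^+ _); rewrite -[RHS]card_ord.
  have jk : (j <= k.+1)%N by apply: ltnW.
  have h : injective (widen_ord jk) by move=> a b /(congr1 val) /= /val_inj.
  rewrite -[RHS](card_imset _ h).
  apply: eq_card => i; rewrite !inE -val_eqE /=; apply/idP/imsetP => [/andP[_ ij]|[a _ ->] /=].
    by exists (Ordinal ij) => //; apply: val_inj.
  by rewrite ltn_ord ltn_eqF.
have -> : pderiv i (mono (~: [set j]) f) = mono (~: [set j]) f^`M(i).
  by apply/ffunP => S; rewrite !ffunE; case: ifP; rewrite ?linear0.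
by rewrite dX_mono !inE ij.
Qed.

Lemma pullback_face0_top (j : 'I_k.+1) :
  pullback (lift ord0 : 'I_k.+1 -> 'I_k.+2) (mono (~: [set j]) 1) = (-1) ^+ j *: mono setT 1.
Proof.
set th : 'I_k.+1 -> 'I_k.+2 := lift ord0.
have top0 : pullback th (mono (~: [set ord0]) 1) = mono setT 1.
  apply: pullback_face_top => i; rewrite pbT_lift0 /barycentric.
  by rewrite liftK.
case: (unliftP ord0 j) => [j' jE|->]; last by rewrite top0 expr0 scale1r.
have j0 : ord0 != j by rewrite jE neq_lift.
(* On the face opposite the vertex 0 the coordinates sum to 1, so that the sum of all dt_i vanishes.
   Multiplying it by u, the product of the dt_i with i different from [ord0] and j, leaves two
   terms, and this compares the cases [ord0] and j. *)
set u : pform k.+1 := mono (~: [set ord0; j]) 1.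
have sumd : \sum_i wedge (dT th i) (pullback th u) = 0.
  rewrite -wedge_suml (_ : \sum_i _ = 0) ?wedge0l //.
  rewrite -[LHS](linear_sum (@pform_d k)) /=.
  rewrite (_ : \sum_i _ = pone k) ?pform_d_pone //.
  rewrite -[RHS]pmul1 -(sum_barycentric k) pmul_suml; apply: eq_bigr => i _.
  by rewrite -pform0E pbT_lift0.
have : \sum_i pullback th (dX i u) = 0.
  by rewrite -[RHS]sumd; apply: eq_bigr => i _; rewrite pullback_dX.
have j0' : j != ord0 by rewrite eq_sym.
rewrite (sum_two j0') => [|i i0 ij]; last first.
  rewrite dX_mono !inE (negPf i0) (negPf ij) /=.
  exact: pullback0.
rewrite !dX_mono !inE !eqxx orbT /= !pullbackZ.
have -> : j |: ~: [set ord0; j] = ~: [set ord0].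
  by apply/setP => i; rewrite !inE; have [->|] := eqVneq i j; rewrite ?orbF // eq_sym (negPf j0).
have -> : ord0 |: ~: [set ord0; j] = ~: [set j].
  by apply/setP => i; rewrite !inE; have [->|] := eqVneq i ord0; rewrite ?j0.
rewrite top0; have -> : below ord0 (~: [set ord0; j]) = 1.
  by rewrite /below eq_card0 // => i; rewrite !inE andbF.
have -> : below j (~: [set ord0; j]) = (-1) ^+ j'.
  rewrite /below; congr (_ ^+ _); rewrite -[RHS]card_ord.
  have h : injective (fun a : 'I_j' => inord a.+1 : 'I_k.+1).
    move=> a b /(congr1 val) /=; have := ltn_ord j; rewrite jE /= /bump /= => jk.
    by rewrite !inordK ?(leq_trans _ jk) ?add1n ?ltnS ?(ltnW (ltn_ord _)) // => -[] /val_inj.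
  rewrite -[RHS](card_imset _ h); apply: eq_card => i; rewrite !inE.
  have jk := ltn_ord j; rewrite jE /= /bump /= in jk.
  apply/idP/imsetP => [/andP[]|[a _ ->]].
    rewrite negb_or -!val_eqE /= jE /= /bump /= => /andP[i0 _] ij.
    have ij' : (i.-1 < j')%N.
      by case: (nat_of_ord i) i0 ij => // q _; rewrite add1n ltnS.
    exists (Ordinal ij') => //; apply: val_inj; rewrite /= prednK ?lt0n // inordK //.
  have ak : (a.+1 < k.+1)%N by rewrite (leq_trans _ jk) // add1n !ltnS ltnW.
  rewrite negb_or -!val_eqE /= jE /= /bump /= inordK // add1n ltnS ltn_ord eqSS.
  by rewrite andbT /= neq_ltn ltn_ord.
rewrite scale1r => /eqP; rewrite addr_eq0 => /eqP ->.
by rewrite jE /= /bump /= exprS mulN1r scaleNr.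
Qed.

(** By linearity and degree, w is a function times the product of all dt_i but one, dt_j. Only the
    faces opposite the vertices 0 and [lift ord0 j] contribute, and [mint_stokes] compares them. *)
Lemma pform_stokes (w : pform k.+1) :
  pform_int (pform_d w) = \sum_(i < k.+2) (-1) ^+ i * pform_int (pullback (lift i) w).
Proof.
suff H S f : pform_int (pform_d (mono S f)) =
   \sum_(i < k.+2) (-1) ^+ i * pform_int (pullback (lift i) (mono S f)).
  rewrite (pform_mono w); apply: (big_ind (fun w => pform_int (pform_d w) =
    \sum_(i < k.+2) (-1) ^+ i * pform_int (pullback (lift i) w))) => [|u v Hu Hv|S _].
  - rewrite linear0 pform_int0 big1 // => i _.
    by rewrite pullback0 pform_int0 mulr0.
  - rewrite linearD pform_intD Hu Hv -big_split; apply: eq_bigr => i _ /=.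
    by rewrite pullbackD pform_intD mulrDr.
  - exact: H.
have [Sk|Sk] := eqVneq #|S| k; last first.
  have hS := homog_mono S f.
  rewrite (pform_int_homog (homog_d hS)) ?eqSS // big1 // => i _.
  by rewrite (pform_int_homog (pullback_homog _ hS)) // mulr0.
have [j Sj] : exists j, S = ~: [set j].
  have /cards1P[j E] : #|~: S| == 1%N.
    by rewrite -(eqn_add2l #|S|) cardsC card_ord Sk addn1.
  by exists j; rewrite -E setCK.
rewrite Sj d_mono_setC1 pform_intZ pform_intE ffunE eqxx mint_stokes.
have j0 : lift ord0 j != ord0 by rewrite eq_sym neq_lift.
rewrite (sum_two j0) => [|i0 i0N].
  rewrite expr0 mul1r /bump /= exprS mulN1r mulrBr -mulNr; congr (_ + _).
    rewrite mono_pmul pullback_pmul pullback_face0_top linearZ /= pform_intZ pform_intE.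
    by rewrite 2!ffunE eqxx mulr1.
  rewrite mono_pmul pullback_pmul (pullback_face_top (pbT_lift_lift j)) pform_intE.
  by rewrite 2!ffunE eqxx mulr1.
(* On the face opposite [lift ord0 i], with i different from j, the factor dt_i restricts to 0. *)
case: (unliftP ord0 i0) i0N => [i ->|->]; last by rewrite eqxx.
move=> _; rewrite (inj_eq lift_inj) => ij.
have iS : i \in ~: [set j] by rewrite !inE.
rewrite mono_pmul (mono_dX iS) pullback_pmul pullbackZ pullback_dX /dT pbT_lift_eq.
rewrite pform0E pmul0 linear0 wedge0l scaler0 linear0 pform_int0 mulr0 //.
Qed.

End Stokes.
End SimplexStokes.

(** * Linear and additive maps on free modules *)

Module Export FreeModuleTheory.
Import finmap monalg.

Lemma free_mod_expand (A : nzRingType) (K : choiceType) (c : free_mod A K) :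
  c = \sum_(k <- msupp c) c@_k *: gen A k.
Proof.
rewrite [LHS]monalgE; apply: eq_bigr => k _.
apply/malgP => k'; rewrite /gen mcoeffZ !mcoeffU.
by case: (k == k'); rewrite ?mulr1n ?mulr1 // !mulr0n mulr0.
Qed.

Lemma free_mod_ind (A : nzRingType) (K : choiceType) (P : free_mod A K -> Prop) :
  P 0 -> (forall a k c, P c -> P (a *: gen A k + c)) -> forall c, P c.
Proof. by move=> P0 PD c; rewrite [c]free_mod_expand; elim/big_rec: _ => // k c' _; apply: PD. Qed.

Lemma sum_msupp_wide (A : nzRingType) (K : choiceType) (V : zmodType) (s : {fset K})
    (F : K -> A -> V) (c : free_mod A K) : (forall k, F k 0 = 0) -> (msupp c `<=` s)%fset ->
  \sum_(k <- msupp c) F k c@_k = \sum_(k <- s) F k c@_k.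
Proof.
move=> F0 cs; apply: big_fset_incl => // k _ kc.
by rewrite mcoeff_outdom.
Qed.

Section LinearExtension.
Variables (K : choiceType) (U : lmodType rat) (f : K -> U).

Definition lext (c : free_mod rat K) : U := \sum_(k <- msupp c) c@_k *: f k.

Lemma lext_linear : linear lext.
Proof.
move=> a c c'; set s := (msupp (a *: c + c')%R `|` (msupp c `|` msupp c'))%fset.
pose F k (x : rat) := x *: f k; have F0 k : F k 0 = 0 by rewrite /F scale0r.
have W c1 : (msupp c1 `<=` s)%fset -> lext c1 = \sum_(k <- s) F k c1@_k.
  by move=> cs; rewrite /lext -(sum_msupp_wide F0 cs).
rewrite !W ?fsubsetUl //; last 2 first.
- by apply: fsubset_trans (fsubsetUr _ _); apply: fsubsetUr.
- by apply: fsubset_trans (fsubsetUr _ _); apply: fsubsetUl.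
rewrite scaler_sumr -big_split; apply: eq_bigr => k _ /=.
by rewrite /F mcoeffD mcoeffZ scalerDl scalerA.
Qed.
HB.instance Definition _ :=
  GRing.isLinear.Build rat (free_mod rat K) U _ lext lext_linear.

Lemma lext_gen k : lext (gen rat k) = f k.
Proof. by rewrite /lext /gen msuppU oner_eq0 big_seq_fset1 mcoeffUU scale1r. Qed.

End LinearExtension.

Section IntegerExtension.
Variables (K : choiceType) (V : zmodType) (f : K -> V).

Lemma zext_zmod_morphism : zmod_morphism (zext f).
Proof.
move=> c c'; set s := (msupp (c - c')%R `|` (msupp c `|` msupp c'))%fset.
pose F k (x : int) := f k *~ x; have F0 k : F k 0 = 0 by rewrite /F mulr0z.
have W c1 : (msupp c1 `<=` s)%fset -> zext f c1 = \sum_(k <- s) F k c1@_k.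
  by move=> cs; rewrite /zext -(sum_msupp_wide F0 cs).
rewrite !W ?fsubsetUl //; last 2 first.
- by apply: fsubset_trans (fsubsetUr _ _); apply: fsubsetUr.
- by apply: fsubset_trans (fsubsetUr _ _); apply: fsubsetUl.
rewrite -sumrB; apply: eq_bigr => k _ /=.
by rewrite /F mcoeffB mulrzBr.
Qed.

Lemma zext0 : zext f 0 = 0.
Proof. by rewrite -[0](subrr 0) zext_zmod_morphism subrr. Qed.
Lemma zextN c : zext f (- c) = - zext f c.
Proof. by rewrite -[- c]sub0r zext_zmod_morphism zext0 sub0r. Qed.
Lemma zextD c c' : zext f (c + c') = zext f c + zext f c'.
Proof. by rewrite -{1}[c']opprK zext_zmod_morphism zextN opprK. Qed.
Lemma zext_sum (I : Type) (r : seq I) (P : pred I) (F : I -> free_mod int K) :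
  zext f (\sum_(i <- r | P i) F i) = \sum_(i <- r | P i) zext f (F i).
Proof. exact: (big_morph _ zextD zext0). Qed.
Lemma zext_gen k : zext f (gen int k) = f k.
Proof. by rewrite /zext /gen msuppU oner_eq0 big_seq_fset1 mcoeffUU mulr1z. Qed.
Lemma zextMz c (a : int) : zext f (c *~ a) = zext f c *~ a.
Proof.
have H n : zext f (c *+ n) = zext f c *+ n.
  by elim: n => [|n IH]; rewrite ?mulr0n ?zext0 // !mulrS zextD IH.
by case: a => n; rewrite ?NegzE ?mulrNz ?zextN -?pmulrn H.
Qed.
Lemma zextZ (a : int) c : zext f (a *: c) = zext f c *~ a.
Proof.
rewrite -zextMz; congr zext; apply/malgP => k.
by rewrite mcoeffZ (raddfMz (mcoeff k)) /= mulrzz mulrC.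
Qed.
Lemma zextE_morph (W : zmodType) (g : V -> W) : {morph g : x y / x + y} -> g 0 = 0 ->
  forall c, g (zext f c) = zext (g \o f) c.
Proof.
move=> gD g0 c; rewrite /zext (big_morph _ gD g0); apply: eq_bigr => k _ /=.
have gN x : g (- x) = - g x by apply/eqP; rewrite -addr_eq0 -gD addNr g0.
have H n x : g (x *+ n) = g x *+ n.
  by elim: n => [|n IH]; rewrite ?mulr0n ?g0 // !mulrS gD IH.
by case: (c@_k) => n; rewrite ?NegzE ?mulrNz ?gN -?pmulrn H.
Qed.

End IntegerExtension.

Lemma eq_zext (K : choiceType) (V : zmodType) (f g : K -> V) : f =1 g -> zext f =1 zext g.
Proof. by move=> E c; apply: eq_bigr => k _; rewrite E. Qed.

Lemma zextDf (K : choiceType) (V : zmodType) (f g : K -> V) c :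
  zext (fun k => f k + g k) c = zext f c + zext g c.
Proof. by rewrite /zext -big_split; apply: eq_bigr => k _; rewrite mulrzDl. Qed.

End FreeModuleTheory.

From mathcomp Require Import all_classical reals topology normedtype realfun.
Import numFieldNormedType.Exports.

#[local] Opaque pullback wedge pform_d pform_int.

(** * Extension of forms from the boundary of the simplex *)

Definition monotone k l (th : 'I_k.+1 -> 'I_l.+1) := {homo th : i j / (i <= j)%N}.
Definition misses k l (th : 'I_k.+1 -> 'I_l.+1) (j : 'I_l.+1) := forall i, th i != j.
(** The monotone maps of this kind form the boundary of the simplex as a simplicial set, degenerate
    simplices included; data on the boundary are indexed by them. *)
Definition nonsurj k l (th : 'I_k.+1 -> 'I_l.+1) := exists j, misses th j.

Lemma monotone_comp k l n (mu : 'I_k.+1 -> 'I_l.+1) (th : 'I_l.+1 -> 'I_n.+1) :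
  monotone th -> monotone mu -> monotone (th \o mu).
Proof. by move=> mth mmu i j ij; apply/mth/mmu. Qed.

Lemma misses_comp k l n (mu : 'I_k.+1 -> 'I_l.+1) (th : 'I_l.+1 -> 'I_n.+1) j :
  misses th j -> misses (th \o mu) j.
Proof. by move=> mth i; apply: mth. Qed.

Lemma leq_lift n (h : 'I_n) (i j : 'I_n.-1) : (lift h i <= lift h j)%N = (i <= j)%N.
Proof. by rewrite /= leq_bump2. Qed.

Lemma monotone_lift k (j : 'I_k.+2) : monotone (lift j : 'I_k.+1 -> 'I_k.+2).
Proof. by move=> a b; rewrite leq_lift. Qed.

Lemma misses_lift k (j : 'I_k.+2) : misses (lift j : 'I_k.+1 -> 'I_k.+2) j.
Proof. by move=> i; rewrite eq_sym neq_lift. Qed.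

(** The retraction onto the face opposite [r] that sends the vertex [r] to [i]. It need not be
    monotone, which [pullback] and [sing_restrict] allow. *)
Definition collapse k (r : 'I_k.+2) (i : 'I_k.+1) (a : 'I_k.+2) : 'I_k.+1 :=
  odflt i (unlift r a).

Lemma collapse_lift k (r : 'I_k.+2) i a : collapse r i (lift r a) = a.
Proof. by rewrite /collapse liftK. Qed.

Lemma lift_collapseE k l (r : 'I_k.+2) i (th : 'I_l.+1 -> 'I_k.+2) a :
  misses th r -> lift r (collapse r i (th a)) = th a.
Proof.
move=> mr; rewrite /collapse.
by case: unliftP (mr a) => [b ->|->] //=; rewrite eqxx.
Qed.

Lemma lift_collapse k l (r : 'I_k.+2) i (th : 'I_l.+1 -> 'I_k.+2) :
  misses th r -> lift r \o (collapse r i \o th) = th.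
Proof. by move=> mr; apply/funext => a; apply: lift_collapseE. Qed.

Lemma monotone_collapse k l (r : 'I_k.+2) i (th : 'I_l.+1 -> 'I_k.+2) :
  misses th r -> monotone th -> monotone (collapse r i \o th).
Proof.
by move=> mr mth a b ab; rewrite -(leq_lift r) !lift_collapseE //; apply: mth.
Qed.

Lemma misses_collapse k l (r : 'I_k.+2) i j (th : 'I_l.+1 -> 'I_k.+2) :
  misses th (lift r j) -> i != j -> misses (collapse r i \o th) j.
Proof.
move=> mj ij a /=; rewrite /collapse; have := mj a.
by case: unliftP => [b ->|->] //=; rewrite (inj_eq lift_inj).
Qed.

(** [mu] need not be monotone, but it factors through the inclusion of the face opposite j, which
    is. *)
Lemma pullback_misses0 k l (v : pform k) j (mu : 'I_l.+1 -> 'I_k.+1) :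
  misses mu j ->
  (forall n (th : 'I_n.+1 -> 'I_k.+1), monotone th -> misses th j -> pullback th v = 0) ->
  pullback mu v = 0.
Proof.
case: k v j mu => [|k] v j mu mj H; first by have := mj ord0; rewrite !ord1.
rewrite -(lift_collapse ord0 mj) -pullback_comp H ?pullback0 //.
  exact: monotone_lift.
exact: misses_lift.
Qed.

(** The faces are treated one after the other: w is right on the faces j < r, and v is its defect on
    the face R. The correction is the sum over the vertices i of this face of t_i times the pullback
    of v by the retraction sending R to i. It restricts to v on the face R, where these t_i sum to
    1, and it is polynomial, unlike a pullback by the projection from the vertex R. *)
Lemma form_filler p k (g : forall l, ('I_l.+1 -> 'I_k.+1) -> pform l) :
  (forall l (th : 'I_l.+1 -> 'I_k.+1), monotone th -> nonsurj th -> pform_homog p (g l th)) ->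
  (forall l n (th : 'I_l.+1 -> 'I_k.+1) (mu : 'I_n.+1 -> 'I_l.+1),
     monotone th -> nonsurj th -> monotone mu -> g n (th \o mu) = pullback mu (g l th)) ->
  exists2 w, pform_homog p w &
    forall l (th : 'I_l.+1 -> 'I_k.+1), monotone th -> nonsurj th -> pullback th w = g l th.
Proof.
case: k g => [|k] g gp gc.
  by exists 0 => [|l th _ [j /(_ ord0)]]; rewrite ?pform_homog0 // !ord1.
suff /(_ k.+2 (leqnn _))[w wp wg] : forall r, (r <= k.+2)%N -> exists2 w, pform_homog p w &
    forall l (th : 'I_l.+1 -> 'I_k.+2), monotone th ->
      (exists2 j : 'I_k.+2, (j < r)%N & misses th j) -> pullback th w = g l th.
  by exists w => // l th mth [j mj]; apply: wg => //; exists j.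
elim=> [|r IH] rk; first by exists 0; [exact: pform_homog0|move=> l th _ []].
have [w wp wg] := IH (ltnW rk); pose R := Ordinal rk.
pose face : 'I_k.+1 -> 'I_k.+2 := lift R.
pose v := g _ face - pullback face w.
have vp : pform_homog p v.
  rewrite /v -scaleN1r addrC; apply: pform_homog_linear; first exact: pullback_homog.
  by apply: gp; [exact: monotone_lift|exists R; exact: misses_lift].
have vE n (th' : 'I_n.+1 -> 'I_k.+1) :
    pullback th' v = pullback th' (g _ face) - pullback (face \o th') w.
  by rewrite /v pullbackD pullbackN pullback_comp.
exists (w + \sum_i pmul (barycentric (lift R i)) (pullback (collapse R i) v)).
  by apply: homogD => //; apply: homog_sum => i; apply/homog_pmul/pullback_homog.
move=> l th mth [j jr mj].
rewrite pullbackD pullback_sum.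
have mface : monotone face by exact: monotone_lift.
have nface : nonsurj face by exists R; exact: misses_lift.
have [mR|nR] := pselect (misses th R).
  set u := g l th - pullback th w.
  suff -> : \sum_i pullback th (pmul (barycentric (lift R i)) (pullback (collapse R i) v)) = u.
    by rewrite /u addrC subrK.
  symmetry.
  rewrite -[LHS]sum_bmul (partition_big (collapse R ord0 \o th) xpredT) //=.
  apply: eq_bigr => i _; rewrite pullback_bmul pullback_comp.
  have mth2 := monotone_collapse i mR mth.
  have E : face \o (collapse R i \o th) = th by exact: lift_collapse.
  rewrite vE -(gc _ _ face _ mface nface mth2) E -/u.
  apply: eq_bigl => a; rewrite -(inj_eq (@lift_inj _ R)); congr (_ == _).
  by rewrite /= lift_collapseE.
have {jr} jr : (j < r)%N.
  have : j != R by apply: contra_notN nR => /eqP <-.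
  by rewrite -val_eqE /= => jR; rewrite ltn_neqAle jR -ltnS.
rewrite (wg _ _ mth); last by exists j.
rewrite big1 ?addr0 // => i _; rewrite pullback_bmul.
(* The correction must vanish on the earlier face j: the term of the vertex j does because t_j = 0
   there, the others because v is 0 on the intersection of the faces j and R. *)
have [ij|ij] := eqVneq (lift R i) j.
  by rewrite ij big_pred0 // => a; apply/negbTE/mj.
rewrite pullback_comp.
case: (unliftP R j) => [j' jE|jR]; last by rewrite jR ltnn in jr.
have mu : misses (collapse R i \o th) j'.
  by apply: misses_collapse; rewrite -?jE // -(inj_eq (@lift_inj _ R)) -jE.
suff -> : pullback (collapse R i \o th) v = 0 by rewrite big1 // => a _; rewrite linear0.
apply: (pullback_misses0 mu) => n th' mth' mj'.
have mfth' : misses (face \o th') j by move=> a; rewrite jE /= (inj_eq lift_inj).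
have mth2 : monotone (face \o th') by apply: monotone_comp.
rewrite vE -(gc _ _ face _ mface nface mth') (wg _ _ mth2) ?subrr //.
by exists j.
Qed.

Definition bd_zero k (w : pform k) := forall l (th : 'I_l.+1 -> 'I_k.+1),
  monotone th -> nonsurj th -> pullback th w = 0.

(** A face opposite j != 0 contains the vertex 0, and with each point the segment over which the
    cone integral is taken. In the proof [th] gets a new first vertex sent to 0: [th'] still misses
    j, and [cone_integral] commutes with it. *)
Lemma cone_integral_bd k (w : pform k) l (th : 'I_l.+1 -> 'I_k.+1) j :
  bd_zero w -> monotone th -> misses th j -> j != ord0 ->
  pullback th (cone_integral w) = 0.
Proof.
move=> bw mth mj j0.
pose th' (a : 'I_l.+2) := if unlift ord0 a is Some b then th b else ord0.
have mth' : monotone th'.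
  move=> a b; rewrite /th'; case: unliftP => [a' ->|-> //].
  by case: unliftP => [b' ->|->]; rewrite ?leq_lift; [exact: mth|].
have mj' : misses th' j.
  by move=> a; rewrite /th'; case: unliftP => [a' _|_]; [exact: mj|rewrite eq_sym].
have -> : th = th' \o lift ord0 by apply/funext => a; rewrite /th' /= liftK.
rewrite -pullback_comp -cone_integral_pullback; last by rewrite /th' unlift_none.
by rewrite bw ?cone_integral0 ?pullback0 //; exists j.
Qed.

(** The cone primitive u0 vanishes on all faces but the one opposite the vertex 0, where it
    restricts to a closed form v vanishing on the boundary. By induction v = d y; with Y a form
    extending y on that face and 0 on the others, u0 - d Y is the primitive sought. *)
Lemma relative_poincare p k (w : pform k) : (p.+1 < k)%N ->
  pform_homog p.+1 w -> pform_d w = 0 -> bd_zero w ->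
  exists u, [/\ pform_homog p u, bd_zero u & pform_d u = w].
Proof.
elim: p k w => [|p IH] [//|[//|k]] w pk wp dw bw.
all: set u0 := cone_integral w.
all: have u0p := homog_cone_integral wp.
all: have du0 : pform_d u0 = w by exact: d_cone_integral wp dw.
all: pose v := pullback (lift ord0 : 'I_k.+2 -> 'I_k.+3) u0.
all: have mface : monotone (lift ord0 : 'I_k.+2 -> 'I_k.+3) by exact: monotone_lift.
all: have nface : nonsurj (lift ord0 : 'I_k.+2 -> 'I_k.+3) by exists ord0; exact: misses_lift.
all: have dv : pform_d v = 0 by rewrite -pullback_d du0 bw.
all: have bv : bd_zero v.
1, 3: move=> l th mth [j mj]; rewrite /v pullback_comp.
1, 2: apply: (cone_integral_bd bw (j := lift ord0 j)); rewrite ?neq_lift //.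
  (* For p = 0, v is a constant function. The face has positive dimension, so its vertices lie on
     its boundary, and the constant is 0. *)
  have [a va] := closed_homog0 (pullback_homog _ u0p) dv.
  have v0 : v = 0.
    have mth : monotone (fun _ : 'I_1 => ord0 : 'I_k.+2) by [].
    have nth : nonsurj (fun _ : 'I_1 => ord0 : 'I_k.+2) by exists ord_max.
    have := bv _ _ mth nth; rewrite -/v in va; rewrite va pullbackZ pullback_pone => /eqP.
    rewrite scaler_eq0 (negPf (pone_neq0 _)) orbF => /eqP ->.
    by rewrite scale0r.
  exists u0; split => // l th mth [j mj].
  have [j0|j0] := eqVneq j ord0; last exact: cone_integral_bd bw mth mj j0.
  rewrite j0 in mj; rewrite -(lift_collapse ord0 mj) -pullback_comp -/v v0.
  exact: pullback0.
have [y [yp yb dy]] := IH _ v pk (pullback_homog _ u0p) dv bv.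
pose g l (th : 'I_l.+1 -> 'I_k.+3) : pform l :=
  if `[< misses th ord0 >] then pullback (collapse ord0 ord0 \o th) y else 0.
have [l th mth nth|l n th mu mth nth mmu|Y Yp Yg] := @form_filler p k.+2 g.
- by rewrite /g; case: ifP => _; [exact: pullback_homog|exact: pform_homog0].
- rewrite /g; case: asboolP => [m0|m0]; case: asboolP => [m0'|m0'].
  + by rewrite pullback_comp.
  + case: nth => j mj.
    case: (unliftP ord0 j) mj => [j' ->|->] mj; last by case: m0'.
    rewrite pullback0 yb //; last first.
      exists j' => a; have := mj (mu a); rewrite -[th (mu a)](lift_collapseE ord0 a m0) /=.
      by rewrite (inj_eq lift_inj).
    by apply: monotone_collapse => //; apply: monotone_comp.
  + by case: m0; apply: misses_comp.
  + by rewrite pullback0.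
exists (u0 - pform_d Y); split; last by rewrite linearB /= pform_dd subr0.
  by apply: homogD => //; rewrite -scaleN1r scale_pmul; apply/homog_pmul/homog_d.
move=> l th mth nth; rewrite pullbackD pullbackN pullback_d (Yg _ _ mth nth) /g.
case: asboolP => [m0|m0].
  have -> : pullback th u0 = pullback (collapse ord0 ord0 \o th) v.
    by rewrite /v pullback_comp (lift_collapse ord0 m0).
  by rewrite -dy pullback_d subrr.
case: nth => j mj; rewrite linear0 subr0; apply: (cone_integral_bd bw mth mj).
by apply: contra_notN m0 => /eqP <-.
Qed.

(** * Sections of simplicial presheaves *)

Lemma not_nonsurj k l (th : 'I_k.+1 -> 'I_l.+1) :
  ~ nonsurj th -> forall j, exists i, th i = j.
Proof.
move=> nn j; apply: contrapT => H; apply: nn; exists j => i.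
by apply/eqP => E; apply: H; exists i.
Qed.

Lemma monotone_surj_id k (th : 'I_k.+1 -> 'I_k.+1) : monotone th -> ~ nonsurj th -> th = id.
Proof.
move=> mth /not_nonsurj sth.
have inj : injective th.
  have [s sK] := choice sth.
  have [t sE tK] : bijective s by apply/injF_bij/(can_inj sK).
  by apply: (can_inj (g := s)) => i; rewrite -{1}(tK i) sK tK.
have E : map th (enum 'I_k.+1) = enum 'I_k.+1.
  apply: (inj_map val_inj); apply: (sorted_eq leq_trans anti_leq).
  - rewrite sorted_map; apply: (homo_sorted_in (e := relpre val leq) (P := predT)) => //.
    + by move=> a b _ _; apply: mth.
    + exact: all_predT.
    + by rewrite -sorted_map val_enum_ord iota_sorted.
  - by rewrite val_enum_ord iota_sorted.
  - apply: perm_map; apply: uniq_perm; [by rewrite map_inj_uniq // enum_uniq|exact: enum_uniq|].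
    move=> j.
    by rewrite mem_enum inE; apply/mapP; have [i <-] := sth j; exists i; rewrite ?mem_enum.
apply/funext => i; have := congr1 (fun s => nth ord0 s i) E.
by rewrite (nth_map ord0) ?size_enum_ord // nth_ord_enum.
Qed.

(** Any choice of preimages is monotone, so that of [th a] can be prescribed. Comparing [th] with
    another degeneracy along such sections, one [a] at a time, shows in [skeleton_step] that the two
    agree. *)
Lemma monotone_section k l (th : 'I_k.+1 -> 'I_l.+1) (a : 'I_k.+1) :
  monotone th -> ~ nonsurj th ->
  exists s, [/\ monotone s, th \o s = id & s (th a) = a].
Proof.
move=> mth /not_nonsurj sth.
have [s0 s0K] := choice sth.
exists (fun j => if j == th a then a else s0 j).
set s := (fun j => _); have sK j : th (s j) = j by rewrite /s; case: eqP => [->|].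
split; [|by apply/funext|by rewrite /s eqxx].
move=> i j ij; rewrite leqNgt; apply/negP => ji.
have := mth _ _ (ltnW ji); rewrite !sK => ji'.
have E : i = j by apply: val_inj; apply/eqP; rewrite eqn_leq ij ji'.
by rewrite E ltnn in ji.
Qed.

Section Extension.
Variables (X F : nat -> Type).
Variable rX : forall k l, ('I_k.+1 -> 'I_l.+1) -> X l -> X k.
Variable rF : forall k l, ('I_k.+1 -> 'I_l.+1) -> F l -> F k.
Hypothesis rX_id : forall k (x : X k), rX id x = x.
Hypothesis rX_comp : forall k l n (mu : 'I_k.+1 -> 'I_l.+1) (th : 'I_l.+1 -> 'I_n.+1) x,
  rX mu (rX th x) = rX (th \o mu) x.
Hypothesis rF_comp : forall k l n (mu : 'I_k.+1 -> 'I_l.+1) (th : 'I_l.+1 -> 'I_n.+1) x,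
  rF mu (rF th x) = rF (th \o mu) x.

Variable P : forall k, X k -> F k -> Prop.
Hypothesis P_restrict : forall k l (th : 'I_k.+1 -> 'I_l.+1) x y,
  monotone th -> P x y -> P (rX th x) (rF th y).

(** f is a total function, with arbitrary values outside A, in place of a function on a dependent
    domain. *)
Definition section_on (A : forall k, X k -> Prop) (f : forall k, X k -> F k) :=
  forall l (x : X l), A l x -> P x (f l x) /\
    forall k (th : 'I_k.+1 -> 'I_l.+1), monotone th -> f k (rX th x) = rF th (f l x).

Variable A : forall k, X k -> Prop.
Hypothesis A_restrict : forall k l (th : 'I_k.+1 -> 'I_l.+1) x,
  monotone th -> A x -> A (rX th x).

Variable D : nat -> Prop.
Hypothesis D_le : forall j k, (j <= k)%N -> D k -> D j.

Definition compatible_boundary k (x : X k) (g : forall l, ('I_l.+1 -> 'I_k.+1) -> F l) :=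
  (forall l (th : 'I_l.+1 -> 'I_k.+1), monotone th -> nonsurj th -> P (rX th x) (g l th)) /\
  (forall l n (th : 'I_l.+1 -> 'I_k.+1) (mu : 'I_n.+1 -> 'I_l.+1),
     monotone th -> nonsurj th -> monotone mu -> g n (th \o mu) = rF mu (g l th)).

Hypothesis filler : forall k (x : X k) g, D k -> ~ A x -> compatible_boundary x g ->
  exists2 w, P x w & forall l (th : 'I_l.+1 -> 'I_k.+1),
    monotone th -> nonsurj th -> rF th w = g l th.

(** [D] holds the dimensions in which fillers exist. Degenerate simplices are included in every
    dimension, as their values are forced. *)
Definition skeleton n k (x : X k) :=
  A x \/ exists j (s : X j) (th : 'I_k.+1 -> 'I_j.+1), [/\ (j < n)%N, D j, monotone th & x = rX th s].

Definition generated k (x : X k) :=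
  A x \/ exists j (s : X j) (th : 'I_k.+1 -> 'I_j.+1), [/\ D j, monotone th & x = rX th s].

Lemma skeleton_restrict n k l (th : 'I_k.+1 -> 'I_l.+1) x :
  monotone th -> skeleton n x -> skeleton n (rX th x).
Proof.
move=> mth [Ax|[j [s [mu [jn Dj mmu ->]]]]]; first by left; apply: A_restrict.
right; exists j, s, (mu \o th); split => //.
exact: monotone_comp.
Qed.

Lemma skeleton_le n n' k (x : X k) : (n <= n')%N -> skeleton n x -> skeleton n' x.
Proof.
move=> nn' [Ax|[j [s [mu [jn Dj mmu E]]]]]; [by left|right].
by exists j, s, mu; split => //; apply: leq_trans nn'.
Qed.

Lemma skeleton_face n k (s : X n) (th : 'I_k.+1 -> 'I_n.+1) :
  D n -> monotone th -> nonsurj th -> skeleton n (rX th s).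
Proof.
case: n s th => [|n] s th Dn mth [j mj]; first by have := mj ord0; rewrite !ord1.
right; exists n, (rX (lift j) s), (collapse j ord0 \o th); split => //.
- exact: D_le Dn.
- exact: monotone_collapse.
- by rewrite rX_comp (lift_collapse ord0 mj).
Qed.

(** A simplex of the new skeleton that is not in the old one is the restriction of an n-simplex s
    along a surjection th, and s and th are unique, as in the Eilenberg-Zilber lemma. Its value is
    that of a filler w s for the boundary of s, restricted along th. *)
Lemma skeleton_step n f : D n -> section_on (skeleton n) f ->
  exists2 f', section_on (skeleton n.+1) f' &
    forall k (x : X k), skeleton n x -> f' k x = f k x.
Proof.
move=> Dn Hf.
have fill (s : X n) : exists w, ~ skeleton n s -> P s w /\
    forall l (th : 'I_l.+1 -> 'I_n.+1), monotone th -> nonsurj th -> rF th w = f l (rX th s).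
  have [sks|nsk] := pselect (skeleton n s); first by exists (f n s).
  have [||w Pw wE] := @filler n s (fun l th => f l (rX th s)) Dn.
  - by move=> As; apply: nsk; left.
  - split => [l th mth nth|l k th mu mth nth mmu].
      by apply: (Hf _ _ _).1; apply: skeleton_face.
    by rewrite -rX_comp (Hf _ _ (skeleton_face s Dn mth nth)).2.
  by exists w => _.
have [w Hw] := choice fill.
have surj k (s : X n) (th : 'I_k.+1 -> 'I_n.+1) : monotone th ->
    ~ skeleton n (rX th s) -> ~ nonsurj th /\ ~ skeleton n s.
  move=> mth nx; split => [nth|sks]; apply: nx; first exact: skeleton_face.
  exact: skeleton_restrict.
have uniq k (s s' : X n) (th th' : 'I_k.+1 -> 'I_n.+1) : monotone th -> monotone th' ->
    ~ skeleton n (rX th s) -> rX th s = rX th' s' -> s = s' /\ th = th'.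
  move=> mth mth' nx E.
  have [nth ns] := surj _ _ _ mth nx.
  (* For a section mu of th, s is the restriction of s' along th' \o mu. This map is surjective
     since s is not in the skeleton, hence is the identity. *)
  have idE mu : monotone mu -> th \o mu = id -> th' \o mu = id /\ s = s'.
    move=> mmu muK; have sE : s = rX (th' \o mu) s'.
      by rewrite -rX_comp -E rX_comp muK rX_id.
    have id' : th' \o mu = id.
      apply: monotone_surj_id; first exact: monotone_comp.
      by move=> n'; apply: ns; rewrite sE; apply: skeleton_face => //; apply: monotone_comp.
    by rewrite sE id' rX_id.
  split; first by have [mu [mmu /(idE _ mmu)[]]] := monotone_section ord0 mth nth.
  apply/funext => a; have [mu [mmu /(idE _ mmu)[E' _] mua]] := monotone_section a mth nth.
  by rewrite -{2}mua -[RHS]/((th' \o mu) (th a)) E'.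
pose rep k (x : X k) := exists p : X n * ('I_k.+1 -> 'I_n.+1), monotone p.2 /\ x = rX p.2 p.1.
pose f' k (x : X k) : F k :=
  if pselect (skeleton n x) then f k x else
  if pselect (rep k x) is left e then rF (projT1 (cid e)).2 (w (projT1 (cid e)).1) else f k x.
have f'1 k (x : X k) : skeleton n x -> f' k x = f k x.
  by move=> sk; rewrite /f'; case: pselect.
have f'2 k (s : X n) (th : 'I_k.+1 -> 'I_n.+1) : monotone th ->
    ~ skeleton n (rX th s) -> f' k (rX th s) = rF th (w s).
  move=> mth ns; rewrite /f'; case: (pselect (skeleton n _)) => [//|?].
  case: (pselect (rep _ _)) => [e|nr]; last by case: nr; exists (s, th).
  by case: (cid e) => -[s' th'] /= [mth' /(uniq _ _ _ _ _ mth mth' ns)[-> ->]].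
exists f' => // l x skx.
have [sknx|nskx] := pselect (skeleton n x).
  rewrite f'1 //; split; first exact: (Hf _ _ sknx).1.
  by move=> k th mth; rewrite f'1 ?(Hf _ _ sknx).2 //; apply: skeleton_restrict.
case: skx => [Ax|]; first by case: nskx; left.
case=> j [s [th [jn Dj mth xE]]].
have jE : j = n.
  apply/eqP; rewrite eqn_leq -ltnS jn leqNgt; apply/negP => jn'; apply: nskx.
  by right; exists j, s, th.
subst j; rewrite xE in nskx *; rewrite f'2 //.
have [nth ns] := surj _ _ _ mth nskx; have [Pw wE] := Hw s ns.
split=> [|k mu mmu]; first exact: P_restrict.
have mthmu : monotone (th \o mu) by exact: monotone_comp.
(* If the restriction falls into the old skeleton, th \o mu is not surjective, since a section of it
   would put s there too; so [wE] applies. *)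
rewrite rX_comp rF_comp; have [sk|nsk] := pselect (skeleton n (rX (th \o mu) s)).
  rewrite f'1 // wE //; apply: contrapT => nn; apply: ns.
  have [t [mt tK _]] := monotone_section ord0 mthmu nn.
  by rewrite -[s]rX_id -tK -rX_comp; apply: skeleton_restrict.
by rewrite f'2.
Qed.

(** The value on a k-simplex is read off at stage k + 1: by then every generated k-simplex has been
    reached, and later stages do not change it. *)
Theorem simplicial_extension f0 : section_on A f0 ->
  exists2 f, section_on generated f & forall k (x : X k), A x -> f k x = f0 k x.
Proof.
move=> Hf0.
have H0 : section_on (skeleton 0) f0 by move=> l x [Ax|[j [s [th []]]]] //; exact: Hf0.
(* Partial sections are kept in a sigma type, so that each stage extends the one chosen before. In a
   dimension outside D the skeleton does not grow. *)
have step n (f : {f | section_on (skeleton n) f}) :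
    {f' : {f' | section_on (skeleton n.+1) f'} |
      forall k (x : X k), skeleton n x -> sval f' k x = sval f k x}.
  case: f => f Hf; apply: cid; have [Dn|nDn] := pselect (D n).
    by have [f' Hf' E] := skeleton_step Dn Hf; exists (exist _ f' Hf').
  have sk k (x : X k) : skeleton n.+1 x -> skeleton n x.
    case=> [Ax|[j [s [th [jn Dj mth ->]]]]]; [by left|right; exists j, s, th; split=> //].
    by move: jn; rewrite ltnS leq_eqVlt => /orP[/eqP jE|//]; rewrite jE in Dj.
  by exists (exist _ f (fun l x skx => Hf l x (sk l x skx))).
pose F' := fix F' n : {f | section_on (skeleton n) f} :=
  if n is n'.+1 then sval (step n' (F' n')) else exist _ f0 H0.
have F'_le n n' k (x : X k) : (n <= n')%N -> skeleton n x -> sval (F' n') k x = sval (F' n) k x.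
  move=> /subnKC <-; elim: (n' - n)%N => [|q IH]; first by rewrite addn0.
  move=> skx; rewrite addnS /= (svalP (step _ _)) ?IH //.
  by apply: skeleton_le skx; rewrite leq_addr.
pose f k (x : X k) := sval (F' k.+1) k x.
have gsk k (x : X k) : generated x -> skeleton k.+1 x.
  case=> [Ax|[j [s [th [Dj mth xE]]]]]; [by left|right].
  have [jk|kj] := leqP j k; first by exists j, s, th; split.
  by exists k, x, id; split => //; apply: D_le Dj; apply: ltnW.
exists f => [l x gx|k x Ax]; last by rewrite /f (@F'_le 0) //; left.
split=> [|k th mth]; first exact: (svalP (F' l.+1) _ _ (gsk _ _ gx)).1.
have gx' : generated (rX th x).
  case: gx => [Ax|[j [s [mu [Dj mmu ->]]]]]; first by left; apply: A_restrict.
  right; exists j, s, (mu \o th); split => //.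
  exact: monotone_comp.
rewrite /f -(@F'_le _ (maxn l.+1 k.+1) _ _ _ (gsk _ _ gx')) ?leq_maxr //.
rewrite -(@F'_le _ (maxn l.+1 k.+1) _ _ _ (gsk _ _ gx)) ?leq_maxl //.
apply: (svalP (F' _) _ _ _).2 => //; apply: skeleton_le (gsk _ _ gx).
exact: leq_maxl.
Qed.

End Extension.

(** * Forms on topological spaces *)

Section Restriction.
Variables (R : realType) (X Y : topologicalType).

Lemma simplex_map_comp k l n (mu : 'I_k.+1 -> 'I_l.+1) (th : 'I_l.+1 -> 'I_n.+1) x :
  simplex_map R th (simplex_map R mu x) = simplex_map R (th \o mu) x.
Proof.
apply: val_inj => /=; apply/rowP => j; rewrite !mxE.
rewrite [RHS](partition_big mu (fun i => th i == j)) //=.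
apply: eq_bigr => i /eqP thi; rewrite mxE; apply: eq_bigl => i'.
by have [->|] := eqVneq (mu i') i; rewrite ?andbF // thi eqxx.
Qed.

Lemma simplex_map_id k x : simplex_map R (id : 'I_k.+1 -> 'I_k.+1) x = x.
Proof. by apply: val_inj => /=; apply/rowP => j; rewrite mxE big_pred1_eq. Qed.

Lemma sing_restrictE k l (th : 'I_k.+1 -> 'I_l.+1) (s : sing R l X) x :
  sing_restrict th s x = s (simplex_map R th x).
Proof. by []. Qed.

Lemma sing_restrict_id k (s : sing R k X) : sing_restrict id s = s.
Proof. by apply/continuousEP => x; rewrite sing_restrictE simplex_map_id. Qed.

Lemma sing_restrict_comp k l n (mu : 'I_k.+1 -> 'I_l.+1) (th : 'I_l.+1 -> 'I_n.+1)
    (s : sing R n X) : sing_restrict mu (sing_restrict th s) = sing_restrict (th \o mu) s.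
Proof. by apply/continuousEP => x; rewrite !sing_restrictE simplex_map_comp. Qed.

Lemma sing_restrict_push (f : continuousType X Y) k l (th : 'I_k.+1 -> 'I_l.+1) (s : sing R l X) :
  sing_restrict th (sing_push f s) = sing_push f (sing_restrict th s).
Proof. exact/continuousEP. Qed.

Lemma sing_push_inj (f : continuousType X Y) k : injective f ->
  injective (@sing_push R X Y k f).
Proof. by move=> fI s t E; apply/continuousEP => x; apply: fI; exact: (congr1 (fun g : sing R k Y => g x) E). Qed.

End Restriction.

Section Forms.
Variables (R : realType) (X : topologicalType).
Local Notation form := (pre_form R X).
Local Notation PL := (PL_forms R X).
Implicit Types (w e u : form).

Lemma PL_formsP w : reflect
  (forall k l (th : 'I_k.+1 -> 'I_l.+1) (s : sing R l X), monotone th ->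
    w k (sing_restrict th s) = pullback th (w l s)) (w \in PL).
Proof. exact: asboolP. Qed.

Lemma homogP p w : reflect (forall k s, pform_homog p (w k s)) (w \in homog R X p).
Proof. exact: asboolP. Qed.

Lemma PL_dform w : w \in PL -> dform w \in PL.
Proof.
by move=> /PL_formsP H; apply/PL_formsP => k l th s mth; rewrite /dform H // pullback_d.
Qed.
Lemma PL_wedgeF w e : w \in PL -> e \in PL -> wedgeF w e \in PL.
Proof.
move=> /PL_formsP Hw /PL_formsP He; apply/PL_formsP => k l th s mth.
by rewrite /wedgeF Hw // He // pullback_wedge.
Qed.
Lemma homog_dform p w : w \in homog R X p -> dform w \in homog R X p.+1.
Proof. by move=> /homogP H; apply/homogP => k s; apply: homog_d. Qed.
Lemma homog_wedgeF p q w e : w \in homog R X p -> e \in homog R X q ->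
  wedgeF w e \in homog R X (p + q).
Proof. by move=> /homogP Hw /homogP He; apply/homogP => k s; apply: homog_wedge. Qed.

Definition hpartF (p : nat) w : form := fun k s => hpart p (w k s).

Lemma PL_hpartF p w : w \in PL -> hpartF p w \in PL.
Proof.
by move=> /PL_formsP H; apply/PL_formsP => k l th s mth; rewrite /hpartF H // pullback_hpart.
Qed.
Lemma homog_hpartF p w : hpartF p w \in homog R X p.
Proof. by apply/homogP => k s; apply: hpart_homog. Qed.
Lemma hpartF_id p w : w \in homog R X p -> hpartF p w = w.
Proof. by move=> /homogP H; apply: pre_formP => k s; apply: hpart_id. Qed.
Lemma hpartF_d p w : hpartF p.+1 (dform w) = dform (hpartF p w).
Proof. by apply: pre_formP => k s; apply: hpart_d. Qed.
Lemma hpart0_d w : hpartF 0 (dform w) = 0.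
Proof.
apply: pre_formP => k s; rewrite /hpartF /dform (sum_hpart (w k s)) linear_sum linear_sum.
by rewrite big1 // => i _ /=; rewrite (hpart_neq (homog_d (hpart_homog i _))).
Qed.

Lemma dformD w e : dform (w + e) = dform w + dform e.
Proof. exact: linearD. Qed.
Lemma dformZ a w : dform (a *: w) = a *: dform w.
Proof. exact: linearZ. Qed.
Lemma dform0 : dform (0 : form) = 0.
Proof. exact: linear0. Qed.
Lemma dform_dform w : dform (dform w) = 0.
Proof. by apply: pre_formP => k s; apply: pform_dd. Qed.

Lemma wedgeFDl w w' e : wedgeF (w + w') e = wedgeF w e + wedgeF w' e.
Proof. by apply: pre_formP => k s; apply: wedgeDl. Qed.
Lemma wedgeFDr w e e' : wedgeF w (e + e') = wedgeF w e + wedgeF w e'.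
Proof. by apply: pre_formP => k s; apply: linearD. Qed.
Lemma wedgeFZl a w e : wedgeF (a *: w) e = a *: wedgeF w e.
Proof. by apply: pre_formP => k s; apply: wedgeZl. Qed.
Lemma wedgeFZr a w e : wedgeF w (a *: e) = a *: wedgeF w e.
Proof. by apply: pre_formP => k s; apply: linearZ. Qed.
Lemma wedgeF0l e : wedgeF 0 e = 0.
Proof. by apply: pre_formP => k s; apply: wedge0l. Qed.
Lemma wedgeF0r e : wedgeF e 0 = 0.
Proof. by apply: pre_formP => k s; apply: linear0. Qed.
Lemma wedgeFBl w w' e : wedgeF (w - w') e = wedgeF w e - wedgeF w' e.
Proof. by rewrite -scaleN1r wedgeFDl wedgeFZl scaleN1r. Qed.
Lemma wedgeFBr w e e' : wedgeF w (e - e') = wedgeF w e - wedgeF w e'.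
Proof. by rewrite -scaleN1r wedgeFDr wedgeFZr scaleN1r. Qed.
Lemma wedgeFA w e u : wedgeF w (wedgeF e u) = wedgeF (wedgeF w e) u.
Proof. by apply: pre_formP => k s; apply: wedgeA. Qed.
Lemma wedgeFC p q w e : w \in homog R X p -> e \in homog R X q ->
  wedgeF w e = (-1) ^+ (p * q) *: wedgeF e w.
Proof. by move=> /homogP Hw /homogP He; apply: pre_formP => k s; apply: wedgeC. Qed.
Lemma dform_wedgeF p w e : w \in homog R X p ->
  dform (wedgeF w e) = wedgeF (dform w) e + (-1) ^+ p *: wedgeF w (dform e).
Proof.
move=> /homogP Hw; apply: pre_formP => k s; rewrite /dform /wedgeF pform_d_wedge.
by rewrite (eps_homog (Hw k s)) wedgeZl.
Qed.

Lemma integralD k (c : chain R X k) w e : integral c (w + e) = integral c w + integral c e.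
Proof. by rewrite /integral -zextDf; apply: eq_zext => s; apply: pform_intD. Qed.
Lemma integralZ k (c : chain R X k) a w : integral c (a *: w) = a * integral c w.
Proof.
rewrite /integral (zextE_morph _ (g := fun x => a * x)) ?mulr0 // => [|x y]; last by rewrite mulrDr.
by apply: eq_zext => s; apply: pform_intZ.
Qed.
Lemma integral0 k (c : chain R X k) : integral c 0 = 0.
Proof. by rewrite -(scale0r 0) integralZ mul0r. Qed.
Lemma integralB k (c : chain R X k) w e : integral c (w - e) = integral c w - integral c e.
Proof. by rewrite -scaleN1r integralD integralZ mulN1r. Qed.
Lemma integralDc k (c c' : chain R X k) w : integral (c + c') w = integral c w + integral c' w.
Proof. exact: zextD. Qed.
Lemma integralNc k (c : chain R X k) w : integral (- c) w = - integral c w.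
Proof. exact: zextN. Qed.

Lemma stokes k (c : chain R X k.+1) w : w \in PL ->
  integral c (dform w) = integral (chain_boundary c) w.
Proof.
move=> /PL_formsP Hw; rewrite /integral /chain_boundary /boundary_succ.
rewrite (zextE_morph _ (zextD (fun s => pform_int (w k s))) (zext0 _)).
apply: eq_zext => s /=; rewrite /dform pform_stokes zext_sum; apply: eq_bigr => i _.
rewrite zextZ zext_gen /face Hw; last exact: monotone_lift.
by rewrite -mulrzl rmorphXn /= rmorphN1.
Qed.

End Forms.

Section Pushforward.
Variables (R : realType) (M W : topologicalType) (f : continuousType M W).

Lemma PL_restrict_form w : w \in PL_forms R W -> restrict_form f w \in PL_forms R M.
Proof.
move=> /PL_formsP H; apply/PL_formsP => k l th s mth.
by rewrite /restrict_form -sing_restrict_push H.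
Qed.
Lemma homog_restrict_form p w : w \in homog R W p -> restrict_form f w \in homog R M p.
Proof. by move=> /homogP H; apply/homogP => k s; apply: H. Qed.
Lemma restrict_wedgeF w e :
  restrict_form f (wedgeF w e : pre_form R W) = wedgeF (restrict_form f w) (restrict_form f e).
Proof. by []. Qed.
Lemma restrict_dform w : restrict_form f (dform w : pre_form R W) = dform (restrict_form f w).
Proof. by []. Qed.
Lemma integral_push k (c : chain R M k) w :
  integral (chain_push f c) w = integral c (restrict_form f w).
Proof.
rewrite /integral /chain_push (zextE_morph _ (zextD (fun s => pform_int (w k s))) (zext0 _)).
by apply: eq_zext => s /=; rewrite zext_gen.
Qed.

(* Forms are extended one nondegenerate simplex at a time. *)
Lemma PL_forms_extend p w : injective f -> w \in PL_forms R M -> w \in homog R M p ->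
  exists2 e, e \in PL_forms R W & e \in homog R W p /\ restrict_form f e = w.
Proof.
move=> fI /PL_formsP Hw /homogP wp.
pose A k (s : sing R k W) := exists t : sing R k M, s = sing_push f t.
pose w0 k (s : sing R k W) : pform k :=
  if pselect (A k s) is left e then w k (projT1 (cid e)) else 0.
have w0E k (t : sing R k M) : w0 k (sing_push f t) = w k t.
  rewrite /w0; case: (pselect _) => [e|nA]; last by case: nA; exists t.
  by case: (cid e) => t' /= /(sing_push_inj fI) ->.
have sec : section_on (fun k l th s => sing_restrict th s) (fun k l th => pullback th)
    (fun k _ => pform_homog p) A w0.
  move=> l _ [t ->]; rewrite w0E; split=> [|k th mth]; first exact: wp.
  by rewrite sing_restrict_push w0E Hw.
have [||||||k s g _ _ [gp gc]|e He Ee] := @simplicial_extension (fun k => sing R k W) pform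
  (fun k l th s => sing_restrict th s) (fun k l th => pullback th) _ _ _
  (fun k _ => pform_homog p) _ A _ (fun _ => True) _ _ w0 sec.
- by move=> k s; apply: sing_restrict_id.
- by move=> k l n mu th s; apply: sing_restrict_comp.
- by move=> k l n mu th x; apply: pullback_comp.
- by move=> k l th s x _; apply: pullback_homog.
- by move=> k l th _ _ [t ->]; exists (sing_restrict th t); rewrite sing_restrict_push.
- by [].
- have [u up uE] := form_filler gp gc; by exists u.
have gen k (s : sing R k W) : generated (fun k l th s => sing_restrict th s) A (fun _ => True) s.
  by right; exists k, s, id; split => //; rewrite sing_restrict_id.
exists e; first by apply/PL_formsP => k l th s mth; rewrite (He _ _ (gen _ s)).2.
split; first by apply/homogP => k s; exact: (He _ _ (gen _ s)).1.
by apply: pre_formP => k s; rewrite /restrict_form Ee ?w0E //; exists s.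
Qed.
End Pushforward.

(** * Spheres, disks and simplices *)

Local Open Scope classical_set_scope.

Section General.
Variables (S T U : topologicalType).

Lemma within_comp (A : set S) (B : set T) (f : S -> T) (g : T -> U) :
  {within A, continuous f} -> {within B, continuous g} ->
  (forall x, A x -> B (f x)) -> {within A, continuous (g \o f)}.
Proof.
move=> cf cg AB; apply/subspace_continuousP => x Ax.
have cfx := (subspace_continuousP _ f).1 cf x Ax.
have cgx := (subspace_continuousP _ g).1 cg (f x) (AB x Ax).
apply: (@cvg_comp _ _ _ f g _ (within B (nbhs (f x)))) => // V VB.
have := cfx _ VB; rewrite /= !nbhs_simpl /= => H.
move: H; rewrite /within /=; apply: filterS => y H' Ay; exact: H' Ay (AB y Ay).
Qed.

Lemma within_glue n (A : set S) (C : 'I_n -> set S) (h : 'I_n -> S -> U) (f : S -> U) :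
  (forall i, exists2 V, closed V & V `&` A = C i `&` A) ->
  (forall i, {within A, continuous (h i)}) ->
  (forall x, A x -> exists i, C i x) ->
  (forall x i, A x -> C i x -> f x = h i x) ->
  {within A, continuous f}.
Proof.
move=> cC ch AC fE; apply/continuous_closedP => D cD.
apply/closed_subspaceP.
have HV i : exists V, closed V /\ V `&` A = C i `&` h i @^-1` D `&` A.
  have [V1 cV1 V1E] := cC i.
  have /continuous_closedP /(_ _ cD) /closed_subspaceP[V2 cV2 V2E] := ch i.
  exists (V1 `&` V2); split; first exact: closedI.
  by rewrite -[A]setIid setIACA V1E V2E setIACA setIid.
have [V HV'] := choice HV.
exists (\bigcup_i V i).
  by apply: closed_bigcup => [|i _]; [exact: finite_finset|exact: (HV' i).1].
apply/seteqP; split=> x [].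
  move=> [i _ Vx] Ax; split => //.
  have : (V i `&` A) x by [].
  rewrite (HV' i).2 => -[[Cx hx] _]; change (D (f x)).
  by rewrite (fE _ _ Ax Cx).
move=> fx Ax; split => //; have [i Cx] := AC x Ax.
exists i => //.
suff [] : (V i `&` A) x by [].
rewrite (HV' i).2; split => //; split => //; change (D (h i x)).
by rewrite -(fE _ _ Ax Cx).
Qed.

End General.

Section RealFunctions.
Variables (R : realType) (T : topologicalType) (x : T).
Implicit Types f g : T -> R.

Lemma cfor_opp f : {for x, continuous f} -> {for x, continuous (fun y => - f y)}.
Proof. exact: continuousN. Qed.
Lemma cfor_add f g : {for x, continuous f} -> {for x, continuous g} ->
  {for x, continuous (fun y => f y + g y)}.
Proof. by move=> cf cg; apply: cvgD. Qed.
Lemma cfor_mul f g : {for x, continuous f} -> {for x, continuous g} ->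
  {for x, continuous (fun y => f y * g y)}.
Proof. by move=> cf cg; apply: cvgM. Qed.
Lemma cfor_inv f : f x != 0 -> {for x, continuous f} -> {for x, continuous (fun y => (f y)^-1)}.
Proof. exact: continuousV. Qed.
Lemma cfor_max f g : {for x, continuous f} -> {for x, continuous g} ->
  {for x, continuous (fun y => Num.max (f y) (g y))}.
Proof. exact: continuous_max. Qed.
Lemma cfor_cst (a : R) : {for x, continuous (fun _ : T => a)}.
Proof. exact: cst_continuous. Qed.
Lemma cfor_sqrt f : {for x, continuous f} -> {for x, continuous (fun y => Num.sqrt (f y))}.
Proof. by move=> cf; apply: continuous_comp cf _; apply: sqrt_continuous. Qed.

Lemma cfor_big (I : Type) (op : R -> R -> R) idx (r : seq I) (F : I -> T -> R) :
  (forall f g : T -> R, {for x, continuous f} -> {for x, continuous g} ->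
     {for x, continuous (fun y => op (f y) (g y))}) ->
  (forall i, {for x, continuous (F i)}) ->
  {for x, continuous (fun y => \big[op/idx]_(i <- r) F i y)}.
Proof.
move=> Hop HF; elim: r => [|i r IH].
  rewrite (_ : (fun y => _) = (fun=> idx)); last by apply/funext => y; rewrite big_nil.
  exact: cfor_cst.
rewrite (_ : (fun y => _) = (fun y => op (F i y) (\big[op/idx]_(i <- r) F i y))).
  exact: Hop.
by apply/funext => y; rewrite big_cons.
Qed.

End RealFunctions.

Section BoundaryFill.
Variables (R : realType) (k : nat).
Local Notation N := (k.+2%:R : R).
Implicit Types (u : 'rV[R]_k.+1) (t : 'rV[R]_k.+2).

Lemma rV_continuous (T : topologicalType) n (A : set T) (F : T -> 'rV[R]_n) :
  (forall j, {within A, continuous (fun x => F x ord0 j)}) -> {within A, continuous F}.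
Proof.
move=> cF; apply/subspace_continuousP => x Ax V [P Px sPV].
have H j : \forall y \near within A (nbhs x), P ord0 j (F y ord0 j).
  exact: (subspace_continuousP _ _).1 (cF j) x Ax _ (Px ord0 j).
have : \forall y \near within A (nbhs x), forall j, P ord0 j (F y ord0 j).
  exact: (@filter_forall _ _ (fun j y => P ord0 j (F y ord0 j)) (within A (nbhs x))).
by apply: filterS => y Py; apply: sPV => i j; rewrite ord1.
Qed.

(* The points of the simplex are the N^-1 (1 + t) with \sum_i t_i = 0 and t_i >= -1.
   The vectors t of sum 0 are parametrized by [flat], and [gauge] <= 1 says that
   t_i >= -1 for all i. *)
Definition flat u : 'rV[R]_k.+2 :=
  \row_i if unlift ord0 i is Some j then u ord0 j else - \sum_j u ord0 j.

Definition gauge u : R := \big[Num.max/0]_(i < k.+2) - flat u ord0 i.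

(** The radial projection from the barycentre: [gauge] is the Minkowski functional of the simplex,
    and dividing by it puts the point on the boundary. *)
Definition to_boundary u : 'rV[R]_k.+2 := \row_i (N^-1 * (1 + flat u ord0 i / gauge u)).

Definition centered t : 'rV[R]_k.+1 := \row_j (t ord0 (lift ord0 j) - N^-1).

(** A radial map that inverts [to_boundary] on the boundary of the simplex. The product of the
    coordinates vanishes exactly there, so that boundary points get norm 1, while it keeps the
    denominator positive at the barycentre. *)
Definition to_disk t : 'rV[R]_k.+1 :=
  (Num.sqrt (\sum_j centered t ord0 j ^+ 2) + \prod_i t ord0 i)^-1 *: centered t.

Lemma flat0 u : flat u ord0 ord0 = - \sum_j u ord0 j.
Proof. by rewrite mxE unlift_none. Qed.
Lemma flatS u j : flat u ord0 (lift ord0 j) = u ord0 j.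
Proof. by rewrite mxE liftK. Qed.
Lemma sum_flat u : \sum_i flat u ord0 i = 0.
Proof.
rewrite big_ord_recl flat0 [X in _ + X](eq_bigr (fun j => u ord0 j)) ?addNr // => j _.
exact: flatS.
Qed.

Lemma gauge_ge u i : - flat u ord0 i <= gauge u.
Proof. exact: (le_bigmax _ (fun i => - flat u ord0 i)). Qed.

Lemma gauge_gt0 u : u != 0 -> 0 < gauge u.
Proof.
move=> u0; rewrite lt_neqAle; apply/andP; split; last first.
  exact: bigmax_ge_id.
apply: contra u0 => /eqP g0.
have ge0 i : 0 <= flat u ord0 i by have := gauge_ge u i; rewrite -g0 oppr_le0.
have := sum_flat u => /eqP; rewrite psumr_eq0 // => /allP f0.
apply/eqP/rowP => j; rewrite mxE -flatS; apply/eqP.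
by have := f0 (lift ord0 j); rewrite mem_index_enum => /(_ isT).
Qed.

Lemma gauge_attained u : u != 0 -> exists i, - flat u ord0 i = gauge u.
Proof.
move=> u0; have := gauge_gt0 u0; rewrite /gauge.
have : \big[Num.max/0]_(i < k.+2) - flat u ord0 i = 0 \/
  exists i, - flat u ord0 i = \big[Num.max/0]_(i < k.+2) - flat u ord0 i.
  elim/big_ind: _ => [|x y [->|[i xE]] [->|[j yE]]|i _]; [by left|left; exact: maxxx| | | |].
  - by have [] := leP 0 y => _; [right; exists j|left].
  - by have [] := leP x 0 => _; [left|right; exists i].
  - by have [] := leP x y => _; right; [exists j|exists i].
  - by right; exists i.
by case=> [->|//]; rewrite ltxx.
Qed.

Lemma to_boundary_simplex u : u != 0 ->
  @simplex R k.+1 (to_boundary u) /\ exists i, to_boundary u ord0 i = 0.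
Proof.
move=> u0; have g0 := gauge_gt0 u0; split; last first.
  have [i iE] := gauge_attained u0; exists i; rewrite mxE -iE.
  by rewrite invrN mulrN mulfV ?subrr ?mulr0 // -oppr_eq0 iE gt_eqF.
split=> [i|].
  rewrite mxE mulr_ge0 ?invr_ge0 ?ler0n // -lerBlDl sub0r -lerN2 opprK.
  by rewrite -mulNr ler_pdivrMr // mul1r gauge_ge.
under eq_bigr do rewrite mxE.
rewrite -mulr_sumr big_split /= sumr_const card_ord -mulr_suml sum_flat mul0r addr0.
by rewrite mulVf // pnatr_eq0.
Qed.

Lemma continuous_flat i u : {for u, continuous (fun u => flat u ord0 i)}.
Proof.
case: (unliftP ord0 i) => [j ->|->].
  rewrite (_ : (fun u => _) = fun u : 'rV[R]_k.+1 => u ord0 j); last by apply/funext => v; rewrite flatS.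
  exact: coord_continuous.
rewrite (_ : (fun u => _) = fun u : 'rV[R]_k.+1 => - \sum_j u ord0 j); last by apply/funext => v; rewrite flat0.
apply/cfor_opp/cfor_big => [f g|j]; first exact: cfor_add.
exact: coord_continuous.
Qed.

Lemma continuous_gauge u : {for u, continuous gauge}.
Proof.
apply: cfor_big => [f g|i]; first exact: cfor_max.
by apply: cfor_opp; apply: continuous_flat.
Qed.

Lemma to_boundary_continuous : {within [set u | u != 0], continuous to_boundary}.
Proof.
apply: rV_continuous => i; apply: continuous_in_subspaceT => u; rewrite inE /= => u0.
rewrite (_ : (fun u => _) = fun u => N^-1 * (1 + flat u ord0 i / gauge u)); last first.
  by apply/funext => v; rewrite mxE.
suff H : {for u, continuous (fun u => N^-1 * (1 + flat u ord0 i / gauge u))} by exact: H.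
apply: cfor_mul; first exact: cfor_cst.
apply: cfor_add; first exact: cfor_cst.
apply: cfor_mul; first exact: continuous_flat.
by apply: cfor_inv; [rewrite gt_eqF // gauge_gt0|exact: continuous_gauge].
Qed.

Lemma flat_centered t i : simplex t -> flat (centered t) ord0 i = t ord0 i - N^-1.
Proof.
move=> [_ t1]; case: (unliftP ord0 i) => [j ->|->]; first by rewrite flatS mxE.
rewrite flat0; under eq_bigr do rewrite mxE.
rewrite sumrB sumr_const card_ord -[N^-1 *+ _]mulr_natl.
have <- : 1 - t ord0 ord0 = \sum_(j < k.+1) t ord0 (lift ord0 j).
  by apply/eqP; rewrite subr_eq -t1 big_ord_recl addrC.
have -> : k.+1%:R * N^-1 = 1 - N^-1 :> R.
  have n0 : N != 0 by rewrite pnatr_eq0.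
  by apply: (mulIf n0); rewrite mulrBl mulfVK // mulVf // mul1r -[k.+2]addn1 natrD addrK.
by ring.
Qed.

(** The norm vanishes only at the barycentre, where the product does not. *)
Lemma disk_radius_gt0 t : simplex t ->
  0 < Num.sqrt (\sum_j centered t ord0 j ^+ 2) + \prod_i t ord0 i.
Proof.
move=> st; have [t0 _] := st.
have p0 : 0 <= \prod_i t ord0 i by apply: prodr_ge0 => i _; exact: t0.
rewrite lt_neqAle addr_ge0 ?sqrtr_ge0 // andbT eq_sym paddr_eq0 ?sqrtr_ge0 //.
apply/negP => /andP[]; rewrite sqrtr_eq0 => s0 /prodf_eq0[i _ /eqP ti].
have {s0} : \sum_j centered t ord0 j ^+ 2 == 0.
  by rewrite eq_le s0 sumr_ge0 // => j _; rewrite sqr_ge0.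
rewrite psumr_eq0 => [/allP c0|j _]; last exact: sqr_ge0.
have c00 : centered t = 0.
  apply/rowP => j; rewrite [RHS]mxE; apply/eqP; rewrite -sqrf_eq0.
  by have := c0 j; rewrite mem_index_enum => /(_ isT).
have := flat_centered i st; rewrite c00 ti => /eqP.
suff -> : flat 0 ord0 i = 0 by rewrite sub0r eq_sym oppr_eq0 invr_eq0 pnatr_eq0.
case: (unliftP ord0 i) => [j ->|->]; first by rewrite flatS mxE.
by rewrite flat0 big1 ?oppr0 // => j _; rewrite mxE.
Qed.

Lemma to_disk_continuous : {within @simplex R k.+1, continuous to_disk}.
Proof.
apply: rV_continuous => j; apply: continuous_in_subspaceT => t; rewrite inE /= => st.
have cc i : {for t, continuous (fun t => centered t ord0 i)}.
  rewrite (_ : (fun v => _) = fun t : 'rV[R]_k.+2 => t ord0 (lift ord0 i) + - N^-1).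
    by apply: cfor_add; [exact: coord_continuous|exact: cfor_cst].
  by apply/funext => v; rewrite mxE.
rewrite (_ : (fun v => _) = fun t => (Num.sqrt (\sum_j centered t ord0 j ^+ 2) +
   \prod_i t ord0 i)^-1 * centered t ord0 j); last by apply/funext => v; rewrite mxE.
suff H : {for t, continuous (fun t => (Num.sqrt (\sum_j centered t ord0 j ^+ 2) +
   \prod_i t ord0 i)^-1 * centered t ord0 j)} by exact: H.
apply: cfor_mul => //; apply: cfor_inv; first by rewrite gt_eqF // disk_radius_gt0.
apply: cfor_add; last first.
  by apply: cfor_big => [f g|i]; [exact: cfor_mul|exact: coord_continuous].
apply: cfor_sqrt; apply: cfor_big => [f g|i]; first exact: cfor_add.
exact: cfor_mul.
Qed.

Lemma to_diskP t : simplex t -> disk (to_disk t).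
Proof.
move=> st; rewrite /disk /= /to_disk; set d := _ + _.
have d0 : 0 < d by exact: disk_radius_gt0.
under eq_bigr do rewrite mxE exprMn.
rewrite -mulr_sumr exprVn mulrC ler_pdivrMr ?exprn_gt0 // mul1r.
have [t0 _] := st.
have s0 : 0 <= \sum_j centered t ord0 j ^+ 2 by apply: sumr_ge0 => j _; apply: sqr_ge0.
rewrite -[leLHS]sqr_sqrtr // ler_sqr ?nnegrE ?sqrtr_ge0 ?(ltW d0) // lerDl.
by apply: prodr_ge0 => i _; exact: t0.
Qed.

Lemma to_disk_boundary t i : simplex t -> t ord0 i = 0 ->
  sphere (to_disk t) /\ to_boundary (to_disk t) = t.
Proof.
move=> st ti; rewrite /to_disk (bigD1 i) //= ti mul0r addr0.
have := disk_radius_gt0 st; rewrite (bigD1 i) //= ti mul0r addr0.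
set d := Num.sqrt _ => d0.
have dE : d ^+ 2 = \sum_j centered t ord0 j ^+ 2.
  by rewrite sqr_sqrtr // sumr_ge0 // => j _; apply: sqr_ge0.
split.
  rewrite /sphere /=; under eq_bigr do rewrite mxE exprMn.
  by rewrite -mulr_sumr -dE -exprMn mulVf ?expr1n // gt_eqF.
have n0 : N != 0 by rewrite pnatr_eq0.
have flatE a : flat (d^-1 *: centered t) ord0 a = d^-1 * (t ord0 a - N^-1).
  rewrite -(flat_centered a st); case: (unliftP ord0 a) => [j ->|->].
    by rewrite !flatS mxE.
  rewrite !flat0 mulrN mulr_sumr; congr (- _); apply: eq_bigr => j _.
  by rewrite mxE.
(* The maximum is attained at the index i, where t_i = 0. *)
have gE : gauge (d^-1 *: centered t) = d^-1 * N^-1.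
  apply/eqP; rewrite eq_le; apply/andP; split.
    apply/bigmax_leP; split=> [|a _].
      by rewrite mulr_ge0 ?invr_ge0 ?ler0n // ltW.
    rewrite flatE -mulrN ler_pM2l ?invr_gt0 // opprB gerBl.
    by have [t0 _] := st; apply: t0.
  by have := gauge_ge (d^-1 *: centered t) i; rewrite flatE ti sub0r mulrN opprK.
apply/rowP => a; rewrite mxE flatE gE invfM !invrK mulrACA mulVf ?mul1r; last first.
  by rewrite gt_eqF.
by rewrite mulrBl mulVf // addrC subrK mulrCA mulVf // mulr1.
Qed.

End BoundaryFill.

(** * Exactness in low degrees *)

Section Fill.
Variables (R : realType) (X : topologicalType).

Definition extends_sphere k := forall f : 'rV[R]_k.+1 -> X,
  {within @sphere R k, continuous f} ->
  exists2 g : 'rV[R]_k.+1 -> X, {within @disk R k, continuous g} &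
    forall x, sphere x -> g x = f x.

(** The G i define a map on the boundary, by G i on the i-th face. Composed with [to_boundary] it
    becomes a map of the sphere; the extension of the latter to the disk, composed with [to_disk],
    is rho. Each G i is given on the whole simplex, but only its values on the i-th face count. *)
Lemma boundary_fill k (G : 'I_k.+2 -> sing R k.+1 X) :
  extends_sphere k ->
  (forall i j (x : @simplex R k.+1), val x ord0 i = 0 -> val x ord0 j = 0 -> G i x = G j x) ->
  exists rho : sing R k.+1 X, forall i (x : @simplex R k.+1), val x ord0 i = 0 -> rho x = G i x.
Proof.
move=> ext agree; pose Delta := @simplex R k.+1.
have v0 : Delta (\row_i (i == ord0)%:R).
  split=> [i|]; first by rewrite mxE ler0n.
  by rewrite (bigD1 ord0) //= mxE eqxx big1 ?addr0 // => i /negPf i0; rewrite mxE i0.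
pose x0 := G ord0 (SigSub (mem_set v0)).
have valE (f : Delta -> X) (x : Delta) : 'valL_x0 f (val x) = f x.
  by have := congr1 (fun h => h x) (valLK x0 f).
pose G' (t : 'rV[R]_k.+2) := if pselect (exists i, t ord0 i = 0) is left e
  then 'valL_x0 (G (projT1 (cid e))) t else x0.
have G'E t i : Delta t -> t ord0 i = 0 -> G' t = 'valL_x0 (G i) t.
  move=> st ti; rewrite /G'; case: pselect => [e|[]]; last by exists i.
  case: (cid e) => j /= tj; pose x : Delta := SigSub (mem_set st).
  exact: etrans (valE (G j) x) (etrans (agree _ _ x tj ti) (esym (valE (G i) x))).
have sphere0 : @sphere R k `<=` [set u | u != 0].
  move=> u su /=; apply: contra_eqN su => /eqP ->; rewrite big1 ?oner_eq0 1?eq_sym ?oner_eq0 // => i _.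
  by rewrite mxE expr0n.
have cb : {within @sphere R k, continuous (@to_boundary R k)}.
  by apply: continuous_subspaceW (@to_boundary_continuous R k).
have cG i : {within Delta, continuous ('valL_x0 (G i))}.
  apply/subspace_valL_continuousP'; exact: cts_fun.
have Dmap u : sphere u -> Delta (to_boundary u).
  by move=> /sphere0 /= /to_boundary_simplex[].
have cf : {within @sphere R k, continuous (G' \o @to_boundary R k)}.
  apply: (@within_glue _ _ _ _ (fun i => [set u | to_boundary u ord0 i = 0])
     (fun i => 'valL_x0 (G i) \o @to_boundary R k)) => [i|i|u su|u i su ui].
  - apply/closed_subspaceP.
    have ci : {within @sphere R k, continuous (fun u => to_boundary u ord0 i)}.
      apply: (@within_comp _ _ _ _ setT _ (fun t : 'rV[R]_k.+2 => t ord0 i) cb) => //.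
      by apply: continuous_subspaceT; apply: coord_continuous.
    have /continuous_closedP /(_ [set 0]) := ci; apply.
    exact: closed_eq.
  - exact: within_comp cb (cG i) Dmap.
  - by have [_] := to_boundary_simplex (sphere0 _ su).
  - exact: G'E (Dmap _ su) ui.
have [g cg gE] := ext _ cf.
have crho : continuous (sigL Delta (g \o @to_disk R k)).
  apply/subspace_sigL_continuousP.
  exact: within_comp (@to_disk_continuous R k) cg (@to_diskP R k).
exists (mkcts crho) => i x xi.
have sx : Delta (val x) by exact: set_mem (valP x).
have [sd bd] := to_disk_boundary sx xi.
change (g (to_disk (val x)) = G i x); rewrite gE //.
change (G' (to_boundary (to_disk (val x))) = G i x).
by rewrite bd (G'E _ i) //; apply: valE.
Qed.

(** The join with a new first vertex. Cones in X are treated as a presheaf whose values in dimension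
    k are singular simplices of dimension k + 1, restricted along [cone th]. *)
Definition cone k l (th : 'I_k.+1 -> 'I_l.+1) (a : 'I_k.+2) : 'I_l.+2 :=
  if unlift ord0 a is Some b then lift ord0 (th b) else ord0.

Lemma cone0 k l (th : 'I_k.+1 -> 'I_l.+1) : cone th ord0 = ord0.
Proof. by rewrite /cone unlift_none. Qed.
Lemma coneS k l (th : 'I_k.+1 -> 'I_l.+1) a : cone th (lift ord0 a) = lift ord0 (th a).
Proof. by rewrite /cone liftK. Qed.
Lemma cone_comp k l n (mu : 'I_k.+1 -> 'I_l.+1) (th : 'I_l.+1 -> 'I_n.+1) :
  cone th \o cone mu = cone (th \o mu).
Proof.
apply/funext => a; case: (unliftP ord0 a) => [b ->|->] /=; first by rewrite !coneS.
by rewrite !cone0.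
Qed.
Lemma cone_lift0 k l (th : 'I_k.+1 -> 'I_l.+1) : cone th \o lift ord0 = lift ord0 \o th.
Proof. by apply/funext => a; rewrite /= coneS. Qed.
Lemma monotone_cone k l (th : 'I_k.+1 -> 'I_l.+1) : monotone th -> monotone (cone th).
Proof.
move=> mth a b; case: (unliftP ord0 a) => [a' ->|-> _]; last by rewrite cone0.
case: (unliftP ord0 b) => [b' ->|->]; last by [].
by rewrite !coneS !leq_lift; apply: mth.
Qed.
Lemma cone_lift k (j : 'I_k.+2) : cone (lift j : 'I_k.+1 -> 'I_k.+2) = lift (lift ord0 j).
Proof.
apply/funext => a; case: (unliftP ord0 a) => [b ->|->].
  by rewrite coneS; apply: val_inj; rewrite /= /bump; lia.
by rewrite cone0; apply: val_inj; rewrite /= /bump; lia.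
Qed.

Lemma simplex_face k (r : 'I_k.+2) i (x : @simplex R k.+1) : val x ord0 r = 0 ->
  simplex_map R (lift r) (simplex_map R (collapse r i) x) = x.
Proof.
move=> xr; rewrite simplex_map_comp; apply: val_inj => /=; apply/rowP => j; rewrite mxE.
case: (unliftP r j) => [j' ->|->].
  rewrite (bigD1 (lift r j')) /=; last by rewrite collapse_lift.
  rewrite big1 ?addr0 // => a /andP[]; case: (unliftP r a) => [b ->|->]; last by rewrite xr.
  by rewrite collapse_lift => /eqP/lift_inj ->; rewrite eqxx.
rewrite xr big_pred0 // => a; apply/negbTE; rewrite eq_sym; exact: neq_lift.
Qed.

Lemma simplex_map_misses k l (th : 'I_k.+1 -> 'I_l.+1) x j :
  misses th j -> val (simplex_map R th x) ord0 j = 0.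
Proof. by move=> mj; rewrite mxE big_pred0 // => i; apply/negbTE/mj. Qed.

Definition base_vertex k : 'I_1 -> 'I_k.+1 := fun _ => ord0.

Definition cone_over (x0 : X) k (s : sing R k X) (rho : sing R k.+1 X) : Prop :=
  sing_restrict (lift ord0) rho = s /\
  forall y, sing_restrict (base_vertex k.+1) rho y = x0.

Lemma cone_over_restrict x0 k l (th : 'I_k.+1 -> 'I_l.+1) s rho :
  cone_over x0 s rho -> cone_over x0 (sing_restrict th s) (sing_restrict (cone th) rho).
Proof.
move=> [<- rho0]; split; first by rewrite !sing_restrict_comp cone_lift0.
move=> y; rewrite -(rho0 y) sing_restrict_comp; congr (sing_restrict _ rho y).
by apply/funext => a; rewrite /base_vertex /= cone0.
Qed.

Lemma simplex_map_lift k (r : 'I_k.+2) b (y : @simplex R k) :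
  val (simplex_map R (lift r) y) ord0 (lift r b) = val y ord0 b.
Proof. by rewrite mxE (eq_bigl (pred1 b)) ?big_pred1_eq // => i; rewrite (inj_eq lift_inj). Qed.

Lemma misses_cone k l (th : 'I_k.+1 -> 'I_l.+1) j : misses th j -> misses (cone th) (lift ord0 j).
Proof.
move=> mj a; case: (unliftP ord0 a) => [b ->|->]; last by rewrite cone0 neq_lift.
by rewrite coneS (inj_eq lift_inj).
Qed.

Lemma simplex_face2 k (j j' : 'I_k.+3) (x : @simplex R k.+3) : j != j' ->
  val x ord0 (lift ord0 j) = 0 -> val x ord0 (lift ord0 j') = 0 ->
  exists (th : 'I_k.+1 -> 'I_k.+3) z, [/\ monotone th, misses th j, misses th j' &
    x = simplex_map R (cone th) z].
Proof.
move=> jj' xj xj'; case: (unliftP j j') jj' xj' => [b ->|->]; last by rewrite eqxx.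
move=> _ xb; exists (lift j \o lift b : 'I_k.+1 -> 'I_k.+3).
pose y := simplex_map R (collapse (lift ord0 j) ord0) x.
have xE : simplex_map R (cone (lift j)) y = x by rewrite cone_lift simplex_face.
pose z := simplex_map R (collapse (lift ord0 b) ord0) y.
have yE : simplex_map R (cone (lift b)) z = y.
  rewrite cone_lift simplex_face // -(simplex_map_lift (lift ord0 j)) -cone_lift xE.
  by rewrite coneS.
exists z; split.
- by apply: monotone_comp; apply: monotone_lift.
- by move=> a; rewrite /= eq_sym neq_lift.
- by move=> a; rewrite /= (inj_eq lift_inj) eq_sym neq_lift.
- by rewrite -cone_comp -simplex_map_comp yE xE.
Qed.

Lemma simplex_vertex0 k (x : @simplex R k.+1) : (forall j, val x ord0 (lift ord0 j) = 0) ->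
  exists y, x = simplex_map R (base_vertex k.+1) y.
Proof.
move=> x0; exists (simplex_map R (fun=> ord0) x); rewrite simplex_map_comp.
apply: val_inj; apply/rowP => j; rewrite mxE.
case: (unliftP ord0 j) => [j' ->|->].
  by rewrite x0 big_pred0 // => i; apply/negbTE.
by rewrite big_ord_recl /= big1 ?addr0 // => i _; rewrite x0.
Qed.

(** The boundary of the cone consists of the base, where rho has to be s, and of the cones over the
    faces of s, where it is given by g. Once these agree on intersections, [boundary_fill]
    applies. *)
Lemma cone_filler x0 k (s : sing R k X) (g : forall l, ('I_l.+1 -> 'I_k.+1) -> sing R l.+1 X) :
  extends_sphere k ->
  compatible_boundary (fun k l (th : 'I_k.+1 -> 'I_l.+1) (s : sing R l X) => sing_restrict th s)
    (fun k l th (rho : sing R l.+1 X) => sing_restrict (cone th) rho) (@cone_over x0) s g ->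
  exists2 rho, cone_over x0 s rho &
    forall l (th : 'I_l.+1 -> 'I_k.+1), monotone th -> nonsurj th ->
      sing_restrict (cone th) rho = g l th.
Proof.
move=> ext [gP gc].
have [Gj [GjE Gj0]] : exists Gj : 'I_k.+1 -> sing R k.+1 X,
  (forall j l (th : 'I_l.+1 -> 'I_k.+1) z, monotone th -> misses th j ->
      Gj j (simplex_map R (cone th) z) = g l th z) /\
  (forall j y, Gj j (simplex_map R (base_vertex k.+1) y) = x0).
  (* For k = 0 there are no faces to be coned: besides the base, the boundary of the cone is the
     cone vertex, sent to x0. *)
  case: k s g ext gP gc => [|k] s g ext gP gc.
    exists (fun=> mkcts (@cst_continuous _ _ x0)); split=> // j l th z _ /(_ ord0).
    by rewrite !ord1.
  have gPl (j : 'I_k.+2) : cone_over x0 (sing_restrict (lift j : 'I_k.+1 -> 'I_k.+2) s) (g k (lift j)).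
    by apply: gP; [exact: monotone_lift|exists j; exact: misses_lift].
  exists (fun j : 'I_k.+2 => sing_restrict (cone (collapse j ord0)) (g k (lift j))).
  split=> [j l th z mth mj|j y].
    rewrite sing_restrictE simplex_map_comp cone_comp -sing_restrictE -gc.
    - by rewrite lift_collapse.
    - exact: monotone_lift.
    - by exists j; exact: misses_lift.
    - exact: monotone_collapse.
  have [_ /(_ y) <-] := gPl j.
  rewrite sing_restrictE simplex_map_comp sing_restrictE; congr (g _ _ (simplex_map R _ y)).
  by apply/funext => a; rewrite /= /base_vertex cone0.
pose G i := if unlift ord0 i is Some j then Gj j else sing_restrict (collapse ord0 ord0) s.
have GS j : G (lift ord0 j) = Gj j by rewrite /G liftK.
have G0 : G ord0 = sing_restrict (collapse ord0 ord0) s by rewrite /G unlift_none.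
have agreeS (j j' : 'I_k.+1) (x : @simplex R k.+1) : val x ord0 (lift ord0 j) = 0 ->
    val x ord0 (lift ord0 j') = 0 -> Gj j x = Gj j' x.
  (* Two distinct faces through the cone vertex: there are none for k = 0; for k = 1 they meet in
     that vertex only; for larger k they meet in the cone over a face of codimension 2 of the
     base. *)
  have [->//|jj'] := eqVneq j j'; case: k s g ext gP gc Gj GjE Gj0 G GS G0 j j' x jj' => [|[|k]] s g
     ext gP gc Gj GjE Gj0 G GS G0 j j' x jj' xj xj'.
  - by rewrite !ord1 eqxx in jj'.
  - have [a|y ->] := @simplex_vertex0 _ x; last by rewrite !Gj0.
    have : (a == j) || (a == j').
      by move: jj'; rewrite -!val_eqE /=; case: a j j' {xj xj'} => [[|[|?]] ?] [[|[|?]] ?] [[|[|?]] ?].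
    by case/orP => /eqP ->.
  - have [th [z [mth mj mj' ->]]] := simplex_face2 jj' xj xj'.
    by rewrite !GjE.
have agree0 (j : 'I_k.+1) (x : @simplex R k.+1) : val x ord0 ord0 = 0 ->
    val x ord0 (lift ord0 j) = 0 -> G ord0 x = Gj j x.
  move=> xz xj; rewrite G0; rewrite -{2}(simplex_face ord0 xz) sing_restrictE.
  set y := simplex_map R _ x; have {xj} yj : val y ord0 j = 0.
    by rewrite -(simplex_map_lift ord0) (simplex_face ord0 xz).
  case: k s g ext gP gc Gj GjE Gj0 G GS G0 agreeS j x xz y yj => [|k] s g
     ext gP gc Gj GjE Gj0 G GS G0 agreeS j x xz y yj.
    have [_] := set_mem (valP y); rewrite big_ord_recl big_ord0 addr0 => y1.
    by move: yj; rewrite (ord1 j) => yj; move/eqP: y1; rewrite yj eq_sym oner_eq0.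
  rewrite -(simplex_face ord0 yj); set z := simplex_map R (collapse j ord0) y.
  rewrite [X in Gj j X]simplex_map_comp -cone_lift0 -simplex_map_comp.
  rewrite GjE; [|exact: monotone_lift|exact: misses_lift].
  rewrite -!sing_restrictE; have [<- _] := gP _ (lift j) (@monotone_lift _ j)
     (ex_intro _ j (@misses_lift _ j)).
  by [].
have [i i' x xi xi'|rho rhoE] := @boundary_fill k G ext.
  case: (unliftP ord0 i) xi => [j ->|->] xi; case: (unliftP ord0 i') xi' => [j' ->|->] xi'.
  - by rewrite !GS; apply: agreeS.
  - by rewrite GS; apply/esym/agree0.
  - by rewrite GS; apply: agree0.
  - by [].
exists rho; first split.
- apply/continuousEP => y; rewrite sing_restrictE (rhoE ord0); last exact/simplex_map_misses/misses_lift.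
  rewrite G0 sing_restrictE simplex_map_comp (_ : _ \o _ = id) ?simplex_map_id //.
  by apply/funext => a; rewrite /= collapse_lift.
- move=> y; rewrite sing_restrictE (rhoE (lift ord0 ord0)) ?GS //.
  exact: simplex_map_misses.
- move=> l th mth [j mj]; apply/continuousEP => z; rewrite sing_restrictE (rhoE (lift ord0 j)).
    by rewrite GS GjE.
  exact/simplex_map_misses/misses_cone.
Qed.

End Fill.

Section Vanishing.
Variables (R : realType) (X : topologicalType) (N : nat).
Hypothesis connX : highly_connected R X N.

Local Notation restr := (fun k l (th : 'I_k.+1 -> 'I_l.+1) (s : sing R l X) => sing_restrict th s).
Local Notation low := (fun k => (k <= N)%N : Prop).

Lemma low_generated k (s : sing R k X) : (k <= N)%N ->
  generated restr (fun _ _ => False) low s.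
Proof. by move=> kN; right; exists k, s, id; split => //; rewrite sing_restrict_id. Qed.

(** The extension principle with A empty and fillers in the dimensions k <= N, where maps of the
    k-sphere extend to the disk. h contracts the part of the singular complex generated in these
    dimensions. *)
Lemma cones_exist : exists h : forall k, sing R k X -> sing R k.+1 X,
  forall l (s : sing R l X), generated restr (fun _ _ => False) low s ->
  sing_restrict (lift ord0) (h l s) = s /\
  forall k (th : 'I_k.+1 -> 'I_l.+1), monotone th ->
    h k (sing_restrict th s) = sing_restrict (cone th) (h l s).
Proof.
have [[x0 _] ext] := connX.
pose h0 k (s : sing R k X) : sing R k.+1 X := sing_restrict (collapse ord0 ord0) s.
have [||||||k s g kN _ H|//|h Hh _] := @simplicial_extension (fun k => sing R k X)
  (fun k => sing R k.+1 X) restr (fun k l th rho => sing_restrict (cone th) rho) _ _ _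
  (@cone_over R X x0) _ (fun _ _ => False) _ low _ _ h0.
- by move=> k s; apply: sing_restrict_id.
- by move=> k l n mu th s; apply: sing_restrict_comp.
- by move=> k l n mu th s; rewrite sing_restrict_comp cone_comp.
- by move=> k l th s rho _; apply: cone_over_restrict.
- by [].
- by move=> j k jk; apply: leq_trans.
- apply: cone_filler => // f cf; have [u cu uE] := ext k f kN cf; by exists u.
exists h => l s gs; have [[E _] H] := Hh l s gs; by split.
Qed.

(** In dimensions up to N the primitive is the cone integral over h(s), restricted to the base s. On
    a new simplex of dimension k > N the values on the boundary are extended by [form_filler] to u0;
    the error w - d u0 is closed and 0 on the boundary, and [relative_poincare] removes it, as p + 1
    <= N < k. *)
Lemma closed_form_exact p w : (p.+1 <= N)%N ->
  w \in PL_forms R X -> w \in homog R X p.+1 -> dform w = 0 ->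
  exists2 e, e \in PL_forms R X & e \in homog R X p /\ dform e = w.
Proof.
move=> pN /PL_formsP Hw /homogP wp dw.
have dwE k (s : sing R k X) : pform_d (w k s) = 0 by rewrite -[LHS]/(@dform R X w k s) dw.
have [h Hh] := cones_exist.
pose A k (s : sing R k X) := generated restr (fun _ _ => False) low s.
pose e0 k (s : sing R k X) : pform k := pullback (lift ord0) (cone_integral (w _ (h k s))).
have mono0 k : monotone (lift ord0 : 'I_k.+1 -> 'I_k.+2) by exact: monotone_lift.
pose P k (s : sing R k X) (f : pform k) := pform_homog p f /\ pform_d f = w k s.
have sec : section_on restr (fun k l th => pullback th) P A e0.
  move=> l s /Hh[hs hth]; split=> [|k th mth].
    split; first by apply/pullback_homog/homog_cone_integral.
    by rewrite -pullback_d (d_cone_integral (wp _ _)) // -Hw ?hs.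
  rewrite /e0 hth // (Hw _ _ (cone th)); last exact: monotone_cone.
  by rewrite cone_integral_pullback ?cone0 // !pullback_comp cone_lift0.
have [||||||k s g _ nA [gP gc]|e He _] := @simplicial_extension (fun k => sing R k X)
  pform restr (fun k l th => pullback th) _ _ _ P _ A _ (fun _ => True) _ _ e0 sec.
- by move=> k s; apply: sing_restrict_id.
- by move=> k l n mu th s; apply: sing_restrict_comp.
- by move=> k l n mu th x; apply: pullback_comp.
- move=> k l th s x mth [xp dx]; split; first exact: pullback_homog.
  by rewrite -pullback_d dx Hw.
- move=> k l th s mth [//|[j [t [mu [jN mmu ->]]]]]; right; exists j, t, (mu \o th).
  by split; rewrite ?sing_restrict_comp //; apply: monotone_comp.
- by [].
- have kN : (N < k)%N by rewrite ltnNge; apply/negP => kN; apply: nA; apply: low_generated.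
  have [||u0 u0p u0g] := @form_filler p k g.
  + by move=> l th mth nth; exact: (gP _ th mth nth).1.
  + exact: gc.
  have [||||v [vp vb dv]] := @relative_poincare p k (w k s - pform_d u0).
  + exact: leq_ltn_trans pN kN.
  + by apply: homogD => //; rewrite -scaleN1r scale_pmul; apply/homog_pmul/homog_d.
  + by rewrite linearB /= pform_dd subr0.
  + move=> l th mth nth; rewrite pullbackD pullbackN pullback_d u0g // -Hw //.
    by rewrite (gP _ th mth nth).2 subrr.
  exists (u0 + v); first by split; [exact: homogD|rewrite linearD /= dv addrC subrK].
  by move=> l th mth nth; rewrite pullbackD vb // addr0 u0g.
have gen k (s : sing R k X) : generated restr A (fun _ => True) s.
  by right; exists k, s, id; split => //; rewrite sing_restrict_id.
exists e; first by apply/PL_formsP => k l th s mth; rewrite (He _ _ (gen _ s)).2.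
split; first by apply/homogP => k s; exact: (He _ _ (gen _ s)).1.1.
by apply: pre_formP => k s; exact: (He _ _ (gen _ s)).1.2.
Qed.

End Vanishing.

(** * Linear selections *)

Local Close Scope classical_set_scope.

Section LinearSelection.
Local Open Scope classical_set_scope.
Variables (U V : lmodType rat) (S : U -> V -> Prop).
Hypothesis S_linear : forall a x y x' y', S x y -> S x' y' -> S (a *: x + x') (a *: y + y').
Hypothesis S_total : forall x, exists y, S x y.

Let graph (G : set (U * V)) := [/\ G `<=` [set p | S p.1 p.2],
  forall a p q, G p -> G q -> G (a *: p + q) & forall y, G (0, y) -> y = 0].

(** Zorn's lemma for graphs of partial linear selections: if x is outside the domain of a maximal
    one, adjoining the multiples of some (x, y) with [S x y] gives a larger one. *)
Lemma linear_selection : exists f : {linear U -> V}, forall x, S x (f x).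
Proof.
have S0 : S 0 0.
  by have [y Sy] := S_total 0; have := S_linear (-1) Sy Sy; rewrite !scaleN1r !addNr.
have [G [[GS GD G0] Gmax]] : exists G, graph G /\ forall H, G `<` H -> ~ graph H.
  apply: Zorn_bigcup => F FG Ftot; split=> [p [A FA Ap]|a p q [A FA Ap] [B FB Bq]|y [A FA Ay]].
  - by have [AS _ _] := FG _ FA; apply: AS.
  - have [AB|BA] := Ftot _ _ FA FB.
      by exists B => //; have [_ BD _] := FG _ FB; apply: BD => //; apply: AB.
    by exists A => //; have [_ AD _] := FG _ FA; apply: AD => //; apply: BA.
  - by have [_ _ A0] := FG _ FA; apply: A0.
have Gz : G (0, 0).
  (* The empty relation counts as a graph, because of the empty chain; it is not maximal, being
     contained in that of the zero subspace. *)
  have [[p Gp]|nG] := pselect (exists p, G p).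
    by have := GD (-1) _ _ Gp Gp; rewrite scaleN1r addNr.
  exfalso; apply: (Gmax [set (0, 0)]).
    split=> [p Gp|H]; first by case: nG; exists p.
    by apply: nG; exists (0, 0); apply: H.
  split=> [_ ->|a _ _ -> ->|y []] //=.
  by rewrite scaler0 addr0.
have Gfun x y y' : G (x, y) -> G (x, y') -> y = y'.
  move=> Gy Gy'; apply/eqP; rewrite -subr_eq0; apply/eqP/G0.
  have := GD (-1) _ _ Gy' Gy; rewrite scaleN1r; congr (G _).
  by change ((- x + x, - y' + y) = (0, y - y')); rewrite addNr addrC.
have Gtotal x : exists y, G (x, y).
  apply: contrapT => nx; have [y Sy] := S_total x.
  pose H : set (U * V) := [set r | exists a p, G p /\ r = a *: (x, y) + p].
  have GH : G `<=` H by move=> p Gp; exists 0, p; rewrite scale0r add0r.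
  apply: (Gmax H).
    split=> // HG; apply: nx; exists y; apply: HG; exists 1, (0, 0).
    by split => //; rewrite scale1r addr0.
  split=> [r [a [p [Gp ->]]]|a r r' [b [p [Gp ->]]] [b' [p' [Gp' ->]]]|z [a [[p1 p2] [Gp E]]]].
  - by apply: S_linear => //; apply: (GS _ Gp).
  - exists (a * b + b'), (a *: p + p'); split; first exact: GD.
    by rewrite scalerDr addrACA scalerA -scalerDl.
  - case: E => E1 E2; have [a0|a0] := eqVneq a 0.
      rewrite a0 !scale0r !add0r in E1 E2.
      by rewrite E2; apply: G0; rewrite E1.
    exfalso; apply: nx; exists (- a^-1 *: p2).
    have := GD (- a^-1) _ _ Gp Gz; rewrite addr0; congr (G (_, _)).
    have -> : p1 = - (a *: x) by apply/eqP; rewrite -addr_eq0 addrC -E1.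
    by rewrite /= scalerN scaleNr opprK scalerA mulVf // scale1r.
have [f Gf] := choice Gtotal.
have f_linear : linear f.
  by move=> a x x'; apply: Gfun (Gf _) _; apply: (GD a _ _ (Gf x) (Gf x')).
pose F := GRing.isLinear.Build rat U V _ f f_linear.
exists (HB.pack_for {linear U -> V} f F) => x.
exact: (GS _ (Gf x)).
Qed.
End LinearSelection.

(** * Graded symmetric powers *)

Section QuotientMap.
Variables (V : lmodType rat) (S : submodClosed V).

Lemma to_quotientE a v : to_quotient S (a *: v) = a *: to_quotient S v.
Proof. exact: to_quotientZ. Qed.

Lemma lift_quotientK (x : quotient S) : to_quotient S (lift_quotient x) = x.
Proof. exact: to_quotientK. Qed.

Lemma quotient_lift (U : lmodType rat) (L : {linear V -> U}) :
  (forall v, v \in S -> L v = 0) ->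
  exists L' : {linear quotient S -> U}, forall v, L' (to_quotient S v) = L v.
Proof.
move=> LS; pose L' (x : quotient S) := L (lift_quotient x).
have L'E v : L' (to_quotient S v) = L v.
  apply/eqP; rewrite -subr_eq0 -linearB LS //.
  by rewrite -to_quotient_eq lift_quotientK.
have L'_linear : linear L'.
  move=> a x y; rewrite -{1}(lift_quotientK x) -{1}(lift_quotientK y).
  by rewrite -to_quotientE -raddfD L'E linearP.
pose F := GRing.isLinear.Build rat (quotient S) U _ L' L'_linear.
by exists (HB.pack_for {linear quotient S -> U} L' F).
Qed.

End QuotientMap.

Lemma lin_span_ker (U V : lmodType rat) (L : {linear U -> V}) (G : U -> Prop) v :
  (forall u, G u -> L u = 0) -> v \in lin_span G -> L v = 0.
Proof.
move=> LG /asboolP[s Gs ->]; rewrite linear_sum big_seq big1 // => c cs.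
by rewrite linearZ /= LG ?scaler0 //; apply: Gs.
Qed.

Section SymTheory.
Variables (k : nat) (D : pred nat) (V : nat -> lmodType rat) (d : nat).
Local Notation htuple := (htuple k V).
Local Notation mon := (@monomial k D V d).
Local Notation deg := (@htuple_deg k D V d).
Implicit Types (f : htuple).

Definition swap f (i j : 'I_k) : htuple := [ffun l => f (tperm i j l)].

Lemma htuple_deg_set f i p (x y : V p) : deg (htuple_set f i x) = deg (htuple_set f i y).
Proof.
have tE j : tag (htuple_set f i x j) = tag (htuple_set f i y j).
  by rewrite !ffunE; case: ifP.
rewrite /htuple_deg; congr andb; last by congr eq_op; apply: eq_bigr => j _; rewrite tE.
by apply: eq_forallb => j; rewrite tE.
Qed.

Lemma htuple_deg_swap f i j : deg (swap f i j) = deg f.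
Proof.
rewrite /htuple_deg; congr andb.
  apply/forallP/forallP => H l; last by rewrite ffunE.
  by have := H (tperm i j l); rewrite ffunE tpermK.
congr eq_op; rewrite [RHS](reindex_inj (@perm_inj _ (tperm i j))).
by apply: eq_bigr => l _; rewrite ffunE.
Qed.

Lemma monomialE f (df : deg f) : mon f = to_quotient _ (gen _ (Sub f df : generator k D V d)).
Proof. by rewrite /monomial insubT. Qed.

Lemma monomial_out f : ~~ deg f -> mon f = 0.
Proof. by move=> /negPf df; rewrite /monomial insubF. Qed.

Lemma to_quotient_relation c : Sym_relation c ->
  to_quotient (lin_span (@Sym_relation k D V d)) c = 0.
Proof.
move=> rc; apply/eqP; rewrite -[0](raddf0 (to_quotient _)) to_quotient_eq subr0.
apply/asboolP; exists [:: (1, c)]; last by rewrite big_seq1 scale1r.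
by move=> e; rewrite inE => /eqP ->.
Qed.

Lemma monomial_linear f i p a (x y : V p) :
  mon (htuple_set f i (a *: x + y)) = a *: mon (htuple_set f i x) + mon (htuple_set f i y).
Proof.
have [df|ndf] := boolP (deg (htuple_set f i x)); last first.
  by rewrite !monomial_out ?scaler0 ?addr0 // (htuple_deg_set _ _ _ x).
have dfy := df; rewrite (htuple_deg_set _ _ _ y) in dfy.
have dfz := df; rewrite (htuple_deg_set _ _ _ (a *: x + y)) in dfz.
rewrite !monomialE -to_quotientE -raddfD; apply/eqP; rewrite -subr_eq0 -raddfB.
apply/eqP/to_quotient_relation; exact: (Sym_multilinear (f := f) (i := i)).
Qed.

Lemma monomial_swap f (i j : 'I_k) : j = i.+1 :> nat ->
  mon f = (-1) ^+ (tag (f i) * tag (f j)) *: mon (swap f i j).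
Proof.
move=> ij; have [df|ndf] := boolP (deg f); last first.
  by rewrite !monomial_out ?scaler0 // htuple_deg_swap.
have dfs := df; rewrite -(htuple_deg_swap _ i j) in dfs.
rewrite !monomialE -to_quotientE; apply/eqP; rewrite -subr_eq0 -raddfB.
apply/eqP/to_quotient_relation.
exact: (@Sym_transpose k D V d i j (Sub f df) (Sub (swap f i j) dfs)).
Qed.

Lemma monomial0 f i p : mon (htuple_set f i (0 : V p)) = 0.
Proof.
have := monomial_linear f i 1 (0 : V p) 0; rewrite !scale1r addr0.
by move/eqP; rewrite addrC -subr_eq subrr eq_sym => /eqP.
Qed.

Lemma Sym_ind (P : Sym k D V d -> Prop) : P 0 ->
  (forall a f x, deg f -> P x -> P (a *: mon f + x)) -> forall x, P x.
Proof.
move=> P0 PD x; rewrite -(lift_quotientK x).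
elim/free_mod_ind: (lift_quotient x) => [|a g c IH]; first by rewrite raddf0.
rewrite raddfD /= to_quotientE.
have -> : to_quotient _ (gen rat g) = mon (val g).
  by rewrite (monomialE (valP g)); congr (to_quotient _ (gen _ _)); apply: val_inj.
by apply: PD => //; exact: valP.
Qed.

(** phi extends linearly to the free vector space on tuples, and the two hypotheses say that it
    kills the two kinds of relations. They are asked in total degree d only, because a formula such
    as the cup product into degree d is graded symmetric only there. *)
Lemma inducedE (U : lmodType rat) (phi : htuple -> U) :
  (forall f i p a (x y : V p), deg (htuple_set f i x) ->
     phi (htuple_set f i (a *: x + y)) =
       a *: phi (htuple_set f i x) + phi (htuple_set f i y)) ->
  (forall f (i j : 'I_k), j = i.+1 :> nat -> deg f ->
     phi f = (-1) ^+ (tag (f i) * tag (f j)) *: phi (swap f i j)) ->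
  forall f, deg f -> induced D d phi (mon f) = phi f.
Proof.
move=> phiL phiS.
have [L LE] : exists L : {linear Sym k D V d -> U}, forall f, deg f -> L (mon f) = phi f.
  have [L0 L0E] : exists F : {linear free_mod rat (generator k D V d) -> U},
      forall g, F (gen _ g) = phi (val g).
    by exists (lext (fun g : generator k D V d => phi (val g))); exact: lext_gen.
  have [|L LE] := @quotient_lift _ (lin_span (@Sym_relation k D V d)) U L0.
    move=> v; apply: lin_span_ker => u [f i p a x y g g1 g2 E E1 E2|i j g g' ij E].
      have -> : L0 (gen _ g - (a *: gen _ g1 + gen _ g2)) = phi (val g) - (a *: phi (val g1) + phi (val g2)).
        by rewrite -!L0E linearB linearP.
      rewrite E E1 E2 phiL ?subrr // -E1.
      exact: valP.
    have -> : L0 (gen _ g - (-1) ^+ (tag (val g i) * tag (val g j)) *: gen _ g') =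
        phi (val g) - (-1) ^+ (tag (val g i) * tag (val g j)) *: phi (val g').
      by rewrite -!L0E linearB linearZ.
    rewrite E -phiS ?subrr //.
    exact: valP.
  by exists L => f df; rewrite (monomialE df) LE L0E.
rewrite /induced; case: pselect => [e|[]]; last by exists L.
exact: (projT2 (cid e)).
Qed.

End SymTheory.

Section Sym2.
Variables (D : pred nat) (V : nat -> lmodType rat) (d : nat).

Definition pair2 p q (x : V p) (y : V q) : htuple 2 V :=
  [ffun i : 'I_2 => if i == ord0 then Tagged V x else Tagged V y].

Lemma ord2P (i : 'I_2) : i = ord0 \/ i = ord_max.
Proof. by case: i => [[|[|//]] Hi]; [left|right]; apply: val_inj. Qed.

Lemma pair2E (f : htuple 2 V) : f = pair2 (tagged (f ord0)) (tagged (f ord_max)).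
Proof.
apply/ffunP => i; rewrite ffunE.
by case: (ord2P i) => -> /=; case: (f _).
Qed.

Lemma pair2_deg p q (x : V p) (y : V q) :
  htuple_deg D d (pair2 x y) = [&& D p, D q & p + q == d]%N.
Proof.
rewrite /htuple_deg !big_ord_recl big_ord0 addn0 !ffunE /= andbA; congr andb.
apply/forallP/andP => [H|[Dp Dq] i].
  by have := H ord0; have := H ord_max; rewrite !ffunE.
by case: (ord2P i) => ->; rewrite ffunE.
Qed.

Lemma Sym2_ind (P : Sym 2 D V d -> Prop) : P 0 ->
  (forall a p q (x : V p) (y : V q) z, D p -> D q -> (p + q)%N = d -> P z ->
     P (a *: monomial D d (pair2 x y) + z)) -> forall z, P z.
Proof.
move=> P0 PD; apply: Sym_ind => // a f z; rewrite [f]pair2E pair2_deg.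
by case/and3P => Dp Dq /eqP pq; apply: PD.
Qed.

Lemma htuple_set0 p q r (x : V p) (y : V q) (z : V r) :
  htuple_set (pair2 x y) ord0 z = pair2 z y.
Proof. by apply/ffunP => i; rewrite !ffunE; case: (ord2P i) => ->. Qed.
Lemma htuple_set1 p q r (x : V p) (y : V q) (z : V r) :
  htuple_set (pair2 x y) ord_max z = pair2 x z.
Proof. by apply/ffunP => i; rewrite !ffunE; case: (ord2P i) => ->. Qed.
Lemma swap_pair2 p q (x : V p) (y : V q) : swap (pair2 x y) ord0 ord_max = pair2 y x.
Proof.
by apply/ffunP => i; rewrite !ffunE; case: (ord2P i) => ->; rewrite ?tpermL ?tpermR.
Qed.

(** Linearity in the second variable follows from that in the first one by graded symmetry. *)
Lemma induced2E (U : lmodType rat) (B : forall p q, V p -> V q -> U) :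
  (forall p q a x x' y, D p -> D q -> (p + q)%N = d ->
     B p q (a *: x + x') y = a *: B p q x y + B p q x' y) ->
  (forall p q x y, D p -> D q -> (p + q)%N = d ->
     B p q x y = (-1) ^+ (p * q) *: B q p y x) ->
  forall p q x y, D p -> D q -> (p + q)%N = d ->
  induced D d (fun f : htuple 2 V => B _ _ (tagged (f ord0)) (tagged (f ord_max)))
    (monomial D d (pair2 x y)) = B p q x y.
Proof.
move=> BL BS p q x y Dp Dq pq.
pose B' (s t : {p : nat & V p}) := B _ _ (tagged s) (tagged t).
have BR p1 q1 a x1 y1 y1' : D p1 -> D q1 -> (p1 + q1)%N = d ->
    B p1 q1 x1 (a *: y1 + y1') = a *: B p1 q1 x1 y1 + B p1 q1 x1 y1'.
  move=> D1 D2 E; have E' : (q1 + p1)%N = d by rewrite addnC.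
  by rewrite BS // BL // scalerDr scalerA mulrC -scalerA -!BS.
rewrite (@inducedE 2 D V d U (fun f => B' (f ord0) (f ord_max))).
- by rewrite !ffunE.
- move=> f i p1 a x1 y1; rewrite [f]pair2E.
  case: (ord2P i) => ->; rewrite ?htuple_set0 ?htuple_set1 pair2_deg => /and3P[D1 D2 /eqP E].
    by rewrite !ffunE /= /B' /= BL.
  by rewrite !ffunE /= /B' /= BR.
- move=> f i j ij; have [iE jE] : i = ord0 /\ j = ord_max.
    by split; apply: val_inj; move: ij; case: i j => [[|[|//]] ?] [[|[|//]] ?].
  rewrite iE jE [f]pair2E pair2_deg => /and3P[D1 D2 /eqP E].
  by rewrite swap_pair2 !ffunE /= /B' /= BS.
- by rewrite pair2_deg Dp Dq pq eqxx.
Qed.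

End Sym2.

#[local] Opaque Sym monomial induced.

Section ScaleExchange.
Variables (U : lmodType rat) (a b : rat).
Implicit Types u v w z : U.

Lemma scale_exchange u v w z :
  a *: (b *: u + v) + (b *: w + z) = b *: (a *: u + w) + (a *: v + z).
Proof. by rewrite !scalerDr !scalerA [b * a]mulrC addrACA. Qed.

Lemma scale_exchange2 u w : a *: (b *: u) + b *: w = b *: (a *: u + w).
Proof. by rewrite scalerDr !scalerA [b * a]mulrC. Qed.

Lemma eq_scale_exchange u v w z : v = b *: u -> z = b *: w -> a *: v + z = b *: (a *: u + w).
Proof. by move=> -> ->; exact: scale_exchange2. Qed.

Lemma scalerA4 c d u : a *: (b *: (c *: (d *: u))) = (a * b * c * d) *: u.
Proof. by rewrite !scalerA !mulrA. Qed.

End ScaleExchange.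

Section Sym22.
Variables (D : pred nat) (V : nat -> lmodType rat).

Definition cat22 (f g : htuple 2 V) : htuple 4 V := [ffun i : 'I_(2 + 2) =>
  match fintype.split i with inl j => f j | inr j => g j end].
Definition lidx (i : 'I_2) : 'I_4 := lshift 2 i.
Definition ridx (i : 'I_2) : 'I_4 := rshift 2 i.

Lemma cat22l f g i : cat22 f g (lidx i) = f i.
Proof. by rewrite ffunE (unsplitK (inl i)). Qed.
Lemma cat22r f g i : cat22 f g (ridx i) = g i.
Proof. by rewrite ffunE (unsplitK (inr i)). Qed.
Lemma idx4P (i : 'I_4) : (exists j, i = lidx j) \/ (exists j, i = ridx j).
Proof.
have := splitK (i : 'I_(2 + 2)).
by case: (fintype.split (i : 'I_(2 + 2))) => j <-; [left|right]; exists j.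
Qed.
Lemma lidx_eq i j : (lidx i == lidx j) = (i == j). Proof. exact: (inj_eq (@lshift_inj 2 2)). Qed.
Lemma ridx_eq i j : (ridx i == ridx j) = (i == j). Proof. exact: (inj_eq (@rshift_inj 2 2)). Qed.
Lemma lridx i j : (lidx i == ridx j) = false. Proof. exact: eq_lrshift. Qed.
Lemma rlidx i j : (ridx i == lidx j) = false. Proof. by rewrite eq_sym lridx. Qed.

Lemma htuple4P (P : htuple 4 V -> Prop) : (forall f g, P (cat22 f g)) -> forall h, P h.
Proof.
move=> H h; suff -> : h = cat22 [ffun i => h (lidx i)] [ffun i => h (ridx i)] by exact: H.
by apply/ffunP => i; case: (idx4P i) => -[j ->]; rewrite ?cat22l ?cat22r !ffunE.
Qed.

Lemma cat22_setl f g i p (x : V p) : cat22 (htuple_set f i x) g = htuple_set (cat22 f g) (lidx i) x.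
Proof.
apply/ffunP => l; case: (idx4P l) => -[j ->];
by rewrite ?cat22l ?cat22r [RHS]ffunE ?cat22l ?cat22r ?lidx_eq ?rlidx ?ffunE.
Qed.
Lemma cat22_setr f g i p (x : V p) : cat22 f (htuple_set g i x) = htuple_set (cat22 f g) (ridx i) x.
Proof.
apply/ffunP => l; case: (idx4P l) => -[j ->];
by rewrite ?cat22l ?cat22r [RHS]ffunE ?cat22l ?cat22r ?ridx_eq ?lridx ?ffunE.
Qed.
Lemma cat22_swapl f g i j : cat22 (swap f i j) g = swap (cat22 f g) (lidx i) (lidx j).
Proof.
apply/ffunP => l; case: (idx4P l) => -[a ->]; rewrite ?cat22l ?cat22r [RHS]ffunE.
  by rewrite -(inj_tperm _ _ _ (@lshift_inj 2 2)) cat22l ffunE.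
by rewrite tpermD ?cat22r // lridx.
Qed.
Lemma cat22_swapr f g i j : cat22 f (swap g i j) = swap (cat22 f g) (ridx i) (ridx j).
Proof.
apply/ffunP => l; case: (idx4P l) => -[a ->]; rewrite ?cat22l ?cat22r [RHS]ffunE.
  by rewrite tpermD ?cat22l // rlidx.
by rewrite -(inj_tperm _ _ _ (@rshift_inj 2 2)) cat22r ffunE.
Qed.

Lemma cat22_deg f g d : htuple_deg D d (cat22 f g) =
  [&& [forall i, D (tag (f i))], [forall i, D (tag (g i))]
    & \sum_i tag (f i) + \sum_i tag (g i) == d]%N.
Proof.
rewrite /htuple_deg andbA; congr andb.
  apply/forallP/andP => [H|[/forallP Hf /forallP Hg] i].
    by split; apply/forallP => i; [have := H (lidx i) | have := H (ridx i)];
      rewrite ?cat22l ?cat22r.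
  by case: (idx4P i) => -[j ->]; rewrite ?cat22l ?cat22r.
congr (eq_op _ _); rewrite (@big_split_ord _ _ _ 2 2); congr addn.
  by apply: eq_bigr => i _; rewrite cat22l.
by apply: eq_bigr => i _; rewrite cat22r.
Qed.

Section Mul.
Variables a b d : nat.

Let inner f : {linear Sym 2 D V b -> Sym 4 D V d} :=
  induced D b (fun g => monomial D d (cat22 f g)).

Let inner0 f : inner f 0 = 0. Proof. exact: linear0. Qed.
Let innerP f c y y' : inner f (c *: y + y') = c *: inner f y + inner f y'.
Proof. exact: linearP. Qed.

Lemma innerE f g : htuple_deg D b g -> inner f (monomial D b g) = monomial D d (cat22 f g).
Proof.
apply: inducedE => [{}g i p c x y _|{}g i j ij _].
  by rewrite !cat22_setr monomial_linear.
by rewrite cat22_swapr -!(cat22r f g); apply: monomial_swap; rewrite /= ij.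
Qed.

Lemma outerE y f : htuple_deg D a f -> induced D a (inner ^~ y) (monomial D a f) = inner f y.
Proof.
apply: inducedE => [{}f i p c x x' _|{}f i j ij _].
  elim/Sym_ind: y => [|c' g y dg IH]; first by rewrite !inner0 scaler0 addr0.
  rewrite !innerP !(innerE _ dg) IH !cat22_setl monomial_linear.
  exact: scale_exchange.
elim/Sym_ind: y => [|c' g y dg IH]; first by rewrite !inner0 scaler0.
rewrite !innerP !(innerE _ dg) IH cat22_swapl.
have -> := @monomial_swap _ D V d (cat22 f g) (lidx i) (lidx j) ij.
rewrite !cat22l; exact: scale_exchange2.
Qed.

Lemma Sym22_mulE f g : htuple_deg D a f -> htuple_deg D b g ->
  Sym22_mul d (monomial D a f) (monomial D b g) = monomial D d (cat22 f g).
Proof. by move=> df dg; rewrite -(innerE f dg) -outerE. Qed.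

Lemma Sym22_mul0l (y : Sym 2 D V b) : Sym22_mul d (0 : Sym 2 D V a) y = 0.
Proof. exact: linear0. Qed.
Lemma Sym22_mulPl c (x x' : Sym 2 D V a) (y : Sym 2 D V b) :
  Sym22_mul d (c *: x + x') y = c *: Sym22_mul d x y + Sym22_mul d x' y.
Proof. exact: linearP. Qed.

(** Unlike linearity in x, this is not automatic, since y is a parameter of the formula from which
    the outer map is induced; it is checked for monomials x. *)
Lemma Sym22_mulPr c (x : Sym 2 D V a) (y y' : Sym 2 D V b) :
  Sym22_mul d x (c *: y + y') = c *: Sym22_mul d x y + Sym22_mul d x y'.
Proof.
elim/Sym_ind: x => [|c' f x df IH]; first by rewrite !Sym22_mul0l scaler0 addr0.
have mE z : Sym22_mul d (monomial D a f) z = inner f z by exact: outerE.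
rewrite !Sym22_mulPl IH !mE innerP.
exact: scale_exchange.
Qed.
Lemma Sym22_mul0r (x : Sym 2 D V a) : Sym22_mul d x (0 : Sym 2 D V b) = 0.
Proof.
have := Sym22_mulPr 1 x 0 0; rewrite !scale1r addr0 => /eqP.
by rewrite addrC -subr_eq subrr eq_sym => /eqP.
Qed.

End Mul.
#[local] Opaque Sym22_mul.

Section Quad.
Variables (d p0 p1 p2 p3 : nat) (x0 : V p0) (x1 : V p1) (x2 : V p2) (x3 : V p3).

Lemma swap_mid : swap (cat22 (pair2 x0 x1) (pair2 x2 x3)) (lidx ord_max) (ridx ord0) =
  cat22 (pair2 x0 x2) (pair2 x1 x3).
Proof.
apply/ffunP => l; case: (idx4P l) => -[a ->]; rewrite ?cat22l ?cat22r [LHS]ffunE.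
  case: (ord2P a) => ->; last by rewrite tpermL cat22r !ffunE.
  by rewrite tpermD ?cat22l ?ffunE // ?rlidx // lidx_eq.
case: (ord2P a) => ->; first by rewrite tpermR cat22l !ffunE.
by rewrite tpermD ?cat22r ?ffunE // ?lridx // ridx_eq.
Qed.

Lemma monomial_mid :
  monomial D d (cat22 (pair2 x0 x1) (pair2 x2 x3)) =
  (-1) ^+ (p1 * p2) *: monomial D d (cat22 (pair2 x0 x2) (pair2 x1 x3)).
Proof.
have := @monomial_swap _ D V d (cat22 (pair2 x0 x1) (pair2 x2 x3)) (lidx ord_max) (ridx ord0) erefl.
by rewrite swap_mid cat22l cat22r !ffunE.
Qed.
Lemma monomial_left g :
  monomial D d (cat22 (pair2 x0 x1) g) = (-1) ^+ (p0 * p1) *: monomial D d (cat22 (pair2 x1 x0) g).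
Proof.
have := @monomial_swap _ D V d (cat22 (pair2 x0 x1) g) (lidx ord0) (lidx ord_max) erefl.
by rewrite -cat22_swapl swap_pair2 !cat22l !ffunE.
Qed.
Lemma monomial_right f :
  monomial D d (cat22 f (pair2 x2 x3)) = (-1) ^+ (p2 * p3) *: monomial D d (cat22 f (pair2 x3 x2)).
Proof.
have := @monomial_swap _ D V d (cat22 f (pair2 x2 x3)) (ridx ord0) (ridx ord_max) erefl.
by rewrite -cat22_swapr swap_pair2 !cat22r !ffunE.
Qed.

End Quad.

(** Exchanging the two pairs takes four adjacent transpositions, of total sign (-1)^((p0 + p1)(p2 +
    p3)). *)
Lemma Sym22_mulC a b d (x : Sym 2 D V a) (y : Sym 2 D V b) : (a + b)%N = d ->
  Sym22_mul d x y = (-1) ^+ (a * b) *: Sym22_mul d y x.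
Proof.
move=> abd.
elim/Sym2_ind: x => [|c p0 p1 x0 x1 x D0 D1 E01 IHx].
  by rewrite Sym22_mul0l Sym22_mul0r scaler0.
rewrite Sym22_mulPl Sym22_mulPr; apply: (eq_scale_exchange _ _ IHx).
elim/Sym2_ind: y {IHx} => [|c' p2 p3 x2 x3 y D2 D3 E23 IHy].
  by rewrite Sym22_mul0l Sym22_mul0r scaler0.
rewrite Sym22_mulPl Sym22_mulPr; apply: (eq_scale_exchange _ _ IHy).
have Da : htuple_deg D a (pair2 x0 x1) by rewrite pair2_deg D0 D1 E01 eqxx.
have Db : htuple_deg D b (pair2 x2 x3) by rewrite pair2_deg D2 D3 E23 eqxx.
rewrite (Sym22_mulE _ Da Db) (Sym22_mulE _ Db Da).
rewrite (monomial_mid _ x0) monomial_left monomial_right monomial_mid.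
apply: (etrans (scalerA4 _ _ _ _ _)); apply: (congr1 ( *:%R^~ _)).
rewrite -E01 -E23 mulnDl !mulnDr !exprD.
by ring.
Qed.

End Sym22.

Section FormPowers.
Variables (R : realType) (X : topologicalType) (D : pred nat) (V : nat -> lmodType rat).
Variable A : forall p, {linear V p -> pre_form R X}.
Hypothesis A_homog : forall p (x : V p), D p -> A p x \in homog R X p.

Definition form_pow2 d : {linear Sym 2 D V d -> pre_form R X} :=
  induced D d (fun f : htuple 2 V => wedgeF (A _ (tagged (f ord0))) (A _ (tagged (f ord_max)))).

Lemma form_pow2E d p q (x : V p) (y : V q) : D p -> D q -> (p + q)%N = d ->
  form_pow2 d (monomial D d (pair2 x y)) = wedgeF (A _ x) (A _ y).
Proof.
move=> Dp Dq pq; rewrite /form_pow2.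
rewrite (@induced2E D V d (pre_form R X) (fun p q x y => wedgeF (A _ x) (A _ y))) //.
  by move=> *; rewrite linearP wedgeFDl wedgeFZl.
by move=> p' q' x' y' Dp' Dq' _; exact: wedgeFC (A_homog _ Dp') (A_homog _ Dq').
Qed.

Let phi (h : htuple 4 V) : pre_form R X :=
  wedgeF (wedgeF (A _ (tagged (h (lidx ord0)))) (A _ (tagged (h (lidx ord_max)))))
         (wedgeF (A _ (tagged (h (ridx ord0)))) (A _ (tagged (h (ridx ord_max))))).

Lemma form_pow4_ex d : exists L : {linear Sym 4 D V d -> pre_form R X},
  forall h, htuple_deg D d h -> L (monomial D d h) = phi h.
Proof.
exists (induced D d phi); apply: inducedE.
  move=> h i p a x y; elim/htuple4P: h => f g.
  rewrite [f]pair2E [g]pair2E => _.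
  case: (idx4P i) => -[j ->]; rewrite -?cat22_setl -?cat22_setr;
  case: (ord2P j) => ->; rewrite ?htuple_set0 ?htuple_set1 /phi !cat22l !cat22r !ffunE /= linearP.
  - by rewrite wedgeFDl wedgeFZl wedgeFDl wedgeFZl.
  - by rewrite wedgeFDr wedgeFZr wedgeFDl wedgeFZl.
  - by rewrite wedgeFDl wedgeFZl wedgeFDr wedgeFZr.
  - by rewrite wedgeFDr wedgeFZr wedgeFDr wedgeFZr.
move=> h i j; elim/htuple4P: h => f g.
rewrite [f]pair2E [g]pair2E.
move: (tag _) (tagged _) (tag _) (tagged _) (tag _) (tagged _) (tag _) (tagged _)
  => p3 x3 p2 x2 p1 x1 p0 x0.
move=> ij; rewrite cat22_deg => /and3P[/forallP H1 /forallP H2 _].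
have h0 : A _ x0 \in homog R X p0 by apply: A_homog; have := H1 ord0; rewrite ffunE.
have h1 : A _ x1 \in homog R X p1 by apply: A_homog; have := H1 ord_max; rewrite ffunE.
have h2 : A _ x2 \in homog R X p2 by apply: A_homog; have := H2 ord0; rewrite ffunE.
have h3 : A _ x3 \in homog R X p3 by apply: A_homog; have := H2 ord_max; rewrite ffunE.
have [] : [\/ i = lidx ord0 /\ j = lidx ord_max, i = lidx ord_max /\ j = ridx ord0
    | i = ridx ord0 /\ j = ridx ord_max].
- by case: i j ij => [[|[|[|[|//]]]] Hi] [[|[|[|[|//]]]] Hj] //= _;
    [apply: Or31|apply: Or32|apply: Or33]; split; apply: val_inj.
- move=> [-> ->]; rewrite -cat22_swapl swap_pair2 /phi !cat22l !cat22r !ffunE /=.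
  by rewrite (wedgeFC h0 h1) wedgeFZl.
- move=> [-> ->]; rewrite swap_mid /phi !cat22l !cat22r !ffunE /=.
  rewrite -!wedgeFA -wedgeFZr -wedgeFZl; congr wedgeF.
  by rewrite wedgeFA (wedgeFC h1 h2) !wedgeFZl wedgeFA.
- move=> [-> ->]; rewrite -cat22_swapr swap_pair2 /phi !cat22l !cat22r !ffunE /=.
  by rewrite (wedgeFC h2 h3) wedgeFZr.
Qed.

(** A product of four forms is graded symmetric under all adjacent transpositions, including the
    middle one, which mixes the two pairs. It is used on M, to see that the Bianchi-Massey form is
    closed on B, and on W, to kill the integral of alpha^2(e) alpha^2(e'). *)
Lemma form_pow4 d : exists L : {linear Sym 4 D V d -> pre_form R X},
  forall a b (x : Sym 2 D V a) (y : Sym 2 D V b), (a + b)%N = d ->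
    L (Sym22_mul d x y) = wedgeF (form_pow2 a x) (form_pow2 b y).
Proof.
have [L LE] := form_pow4_ex d; exists L => a b x y abd.
elim/Sym2_ind: x => [|c p0 p1 x0 x1 x D0 D1 E01 IHx].
  by rewrite Sym22_mul0l ?linear0 ?wedgeF0l.
rewrite Sym22_mulPl // !linearP IHx wedgeFDl wedgeFZl; congr (_ *: _ + _).
elim/Sym2_ind: y {IHx} => [|c' p2 p3 x2 x3 y D2 D3 E23 IHy].
  by rewrite Sym22_mul0r ?linear0 ?wedgeF0r.
rewrite Sym22_mulPr // !linearP IHy wedgeFDr wedgeFZr; congr (_ *: _ + _).
rewrite Sym22_mulE ?pair2_deg ?D0 ?D1 ?D2 ?D3 ?E01 ?E23 ?eqxx // LE.
  by rewrite !form_pow2E // /phi !cat22l !cat22r !ffunE.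
rewrite cat22_deg !big_ord_recl !big_ord0 !ffunE /= !addn0 E01 E23 abd eqxx andbT.
by apply/andP; split; apply/forallP => i; case: (ord2P i) => ->; rewrite ffunE.
Qed.

End FormPowers.

(** * Cohomology classes *)

Lemma subspace_valK (V : lmodType rat) (S : submodClosed V) (z : Defs.subspace S) :
  insubd 0 (val z) = z.
Proof. exact: valKd. Qed.

Section Classes.
Variables (R : realType) (X : topologicalType) (C : submodClosed (pre_form R X)) (p : nat).
Local Notation cls := (class C p).
Implicit Types w e : pre_form R X.

Lemma cocycleP w : reflect [/\ w \in C, w \in homog R X p & dform w = 0] (w \in cocycle C p).
Proof. by apply: (iffP and3P) => -[h1 h2 h3]; split=> //; apply/eqP. Qed.

Lemma class_val (z : Defs.subspace (cocycle C p)) :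
  cls (sval z) = to_quotient (@exact_cocycle R X C p) z.
Proof. exact: (congr1 (to_quotient _) (subspace_valK z)). Qed.

Lemma cocycle_sub w : w \in cocycle C p -> exists z : Defs.subspace (cocycle C p), w = sval z.
Proof. by move=> Hw; exists (exist _ w Hw). Qed.

Lemma rep_cocycle (x : cohomology C p) : rep x \in cocycle C p.
Proof. exact: valP. Qed.

Lemma class_rep (x : cohomology C p) : cls (rep x) = x.
Proof. by rewrite /rep class_val lift_quotientK. Qed.

Lemma classP a w e : w \in cocycle C p -> e \in cocycle C p ->
  cls (a *: w + e) = a *: cls w + cls e.
Proof.
move=> /cocycle_sub[y ->] /cocycle_sub[z ->].
have -> : a *: sval y + sval z = sval (a *: y + z) by [].
by rewrite !class_val -to_quotientE -raddfD.
Qed.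

Lemma class0 : cls 0 = 0.
Proof.
have -> : 0 = sval (0 : Defs.subspace (cocycle C p)) by [].
by rewrite class_val raddf0.
Qed.

Lemma class_eq w e : w \in cocycle C p -> e \in cocycle C p ->
  cls w = cls e <-> exists2 u, u \in C & w - e = dform u.
Proof.
move=> /cocycle_sub[y ->] /cocycle_sub[z ->].
have -> : sval y - sval z = sval (y - z) by [].
rewrite !class_val; split=> [/eqP|[u uC E]].
  by rewrite to_quotient_eq => /asboolP.
by apply/eqP; rewrite to_quotient_eq; apply/asboolP; exists u.
Qed.

(** The part of u of degree p - 1 is a primitive. For p = 0, where [p.-1] is 0 again, an exact form
    is 0. *)
Lemma homog_primitive w u : (forall q v, v \in C -> hpartF q v \in C) ->
  w \in homog R X p -> u \in C -> w = dform u ->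
  exists2 v, v \in C & v \in homog R X p.-1 /\ w = dform v.
Proof.
move=> Ch wp uC E; case: p wp => [|q] wp.
  exists 0; rewrite ?rpred0 // dform0; split=> //.
  by rewrite -(hpartF_id wp) E hpart0_d.
exists (hpartF q u); first exact: Ch.
by split; [exact: homog_hpartF | rewrite -hpartF_d -E hpartF_id].
Qed.

End Classes.

Section Absolute.
Variables (R : realType) (X : topologicalType).
Local Notation PL := (PL_forms R X).
Local Notation cocyc := (cocycle (PL_forms R X)).
Local Notation cls := (class (PL_forms R X)).

Lemma PL_class_eq p w e : w \in cocyc p -> e \in cocyc p -> cls p w = cls p e ->
  exists2 u, u \in PL & u \in homog R X p.-1 /\ w - e = dform u.
Proof.
move=> Hw He /(class_eq Hw He)[u uC E]; apply: homog_primitive uC E => [q v|].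
  exact: PL_hpartF.
by have /cocycleP[_ wp _] := Hw; have /cocycleP[_ ep _] := He; rewrite rpredB.
Qed.

Lemma wedgeF_cocycle p q w e : w \in cocyc p -> e \in cocyc q -> wedgeF w e \in cocyc (p + q).
Proof.
move=> /cocycleP[wC wp dw] /cocycleP[eC ep de]; apply/cocycleP; split.
- exact (PL_wedgeF wC eC).
- exact: homog_wedgeF.
- by rewrite (dform_wedgeF _ wp) dw de wedgeF0l wedgeF0r scaler0 addr0.
Qed.

Lemma dform_wedgeF_cocycler p q u e : u \in homog R X p -> e \in cocyc q ->
  dform (wedgeF u e) = wedgeF (dform u) e.
Proof.
by move=> up /cocycleP[_ _ de]; rewrite (dform_wedgeF _ up) de wedgeF0r scaler0 addr0.
Qed.
Lemma dform_wedgeF_cocyclel p w u : w \in cocyc p ->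
  dform (wedgeF w u) = (-1) ^+ p *: wedgeF w (dform u).
Proof. by move=> /cocycleP[_ wp dw]; rewrite (dform_wedgeF _ wp) dw wedgeF0l add0r. Qed.

Lemma cup_class p q r w e : (p + q)%N = r -> w \in cocyc p -> e \in cocyc q ->
  cup r (cls p w) (cls q e) = cls r (wedgeF w e).
Proof.
move=> <- Hw He; rewrite /cup; set w' := rep _; set e' := rep _.
have Hw' : w' \in cocyc p by exact: rep_cocycle.
have He' : e' \in cocyc q by exact: rep_cocycle.
have [u uC [up Eu]] := PL_class_eq Hw' Hw (class_rep _).
have [v vC [vp Ev]] := PL_class_eq He' He (class_rep _).
have [wC _ _] := cocycleP _ _ _ Hw; have [eC' _ _] := cocycleP _ _ _ He'.
apply/class_eq; rewrite ?wedgeF_cocycle //.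
have [eC2 _ _] := cocycleP _ _ _ He'.
(* From w' - w = d u and e' - e = d v one gets w' e' - w e = (d u) e' + w (d v). *)
exists (wedgeF u e' + (-1) ^+ p *: wedgeF w v).
  exact (rpredD (PL_wedgeF uC eC2) (rpredZ _ (PL_wedgeF wC vC))).
rewrite dformD dformZ (dform_wedgeF_cocycler up He') (dform_wedgeF_cocyclel _ Hw) -Eu -Ev.
by rewrite scalerA -expr2 sqrr_sign scale1r wedgeFBl wedgeFBr addrA subrK.
Qed.

Lemma cupPl p q r a (x x' : HPL R X p) (y : HPL R X q) : (p + q)%N = r ->
  cup r (a *: x + x') y = a *: cup r x y + cup r x' y.
Proof.
move=> pq; rewrite -(class_rep x) -(class_rep x') -(class_rep y).
rewrite -classP ?rep_cocycle // !(cup_class pq) ?rep_cocycle ?rpredD ?rpredZ ?rep_cocycle //.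
by rewrite wedgeFDl wedgeFZl classP // -pq wedgeF_cocycle ?rep_cocycle.
Qed.

Lemma cupC p q r (x : HPL R X p) (y : HPL R X q) : (p + q)%N = r ->
  cup r x y = (-1) ^+ (p * q) *: cup r y x.
Proof.
move=> pq; have qp : (q + p)%N = r by rewrite addnC.
rewrite -(class_rep x) -(class_rep y) (cup_class pq) ?(cup_class qp) ?rep_cocycle //.
have /cocycleP[_ xp _] := rep_cocycle x; have /cocycleP[_ yq _] := rep_cocycle y.
have H : wedgeF (rep y) (rep x) \in cocyc r by rewrite -qp wedgeF_cocycle ?rep_cocycle.
rewrite (wedgeFC xp yq) -[_ *: wedgeF _ _]addr0 classP ?rpred0 //.
by rewrite class0 addr0.
Qed.

Lemma HPL_eq0 N p (x : HPL R X p) : highly_connected R X N -> (0 < p <= N)%N -> x = 0.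
Proof.
move=> HX; case: p x => // p x pN; have /cocycleP[xC xp dx] := rep_cocycle x.
have [e eC [_ E]] := closed_form_exact HX pN xC xp dx.
rewrite -(class_rep x) -(class0 PL); apply/class_eq; rewrite ?rep_cocycle ?rpred0 //.
by exists e; rewrite ?subr0.
Qed.

End Absolute.

Section Maps.
Variables (R : realType) (M W : topologicalType) (f : continuousType M W).

Lemma restrict_cocycle p w : w \in cocycle (PL_forms R W) p ->
  restrict_form f w \in cocycle (PL_forms R M) p.
Proof.
move=> /cocycleP[wC wp dw]; apply/cocycleP; split.
- exact: PL_restrict_form.
- exact: homog_restrict_form.
- by rewrite -restrict_dform dw linear0.
Qed.

Lemma relative_cocycleP p w : reflect
  (w \in cocycle (PL_forms R W) p /\ restrict_form f w = 0)
  (w \in cocycle (relative_PL_forms f) p).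
Proof.
apply: (iffP (cocycleP _ _ _)) => [[/andP[wC /eqP fw] wp dw]|[/cocycleP[wC wp dw] fw]].
  by split=> //; apply/cocycleP.
by split=> //; apply/andP; split=> //; apply/eqP.
Qed.

Lemma pullbackH_rep p (x : HPL R W p) w : w \in cocycle (PL_forms R M) p ->
  pullbackH f x = class (PL_forms R M) p w ->
  exists2 u, u \in PL_forms R M & u \in homog R M p.-1 /\ w - restrict_form f (rep x) = dform u.
Proof.
move=> Hw E; apply: PL_class_eq => //; apply: restrict_cocycle; exact: rep_cocycle.
Qed.

Lemma rel_to_abs_class p w : w \in cocycle (relative_PL_forms f) p ->
  rel_to_abs (class (relative_PL_forms f) p w) = class (PL_forms R W) p w.
Proof.
move=> Hw; have Hr := rep_cocycle (class (relative_PL_forms f) p w).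
have [wC _] := relative_cocycleP _ _ Hw; have [rC _] := relative_cocycleP _ _ Hr.
apply/class_eq => //; have /(class_eq Hr Hw)[u /andP[uC _] E] := class_rep (class (relative_PL_forms f) p w).
by exists u.
Qed.

End Maps.

(** * The Bianchi-Massey form *)

#[local] Opaque Sym22_mul.

Section CupSquare.
Variables (R : realType) (M : topologicalType).
Local Notation HM := (HPL R M).
Local Notation pos := positive_degrees.

Lemma full_symE d p q (e : Estar R M p) (f : Estar R M q) : (p + q)%N = d ->
  full_sym R M d (monomial all_degrees d (pair2 e f)) = Sym22_mul d (sval e) (sval f).
Proof.
move=> pq; rewrite /full_sym.
rewrite (@induced2E all_degrees (Estar R M) d _ (fun p q x y => Sym22_mul d (sval x) (sval y))) //.
  by move=> *; exact: Sym22_mulPl.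
by move=> *; exact: Sym22_mulC.
Qed.

Section LowDegree.
Variable N : nat.
Hypothesis HN : highly_connected R M N.

(** Of two positive degrees with sum at most 2N + 1, one is at most N, where the cohomology
    vanishes. For N = n - 1 this covers the degrees below 2n. *)
Lemma Sym2_eq0 d (x : Sym 2 pos HM d) : (d <= N.*2.+1)%N -> x = 0.
Proof.
move=> dN; elim/Sym2_ind: x => [//|a p q x y z p0 q0 pq ->].
suff -> : monomial pos d (pair2 x y) = 0 by rewrite scaler0 addr0.
have [pN|Np] := leqP p N.
  have -> : x = 0 by apply: (HPL_eq0 x HN); apply/andP.
  by have := monomial0 pos d (pair2 x y) ord0 p; rewrite htuple_set0.
have -> : y = 0 by apply: (HPL_eq0 y HN); apply/andP; split=> //; lia.
by have := monomial0 pos d (pair2 x y) ord_max q; rewrite htuple_set1.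
Qed.

Lemma Estar_eq0 d (e : Estar R M d) : (d <= N.*2.+1)%N -> e = 0.
Proof. by move=> dN; apply: val_inj; exact: Sym2_eq0. Qed.

End LowDegree.
End CupSquare.

Section SymProduct.
Variables (R : realType) (X : topologicalType).
Implicit Types g w : pre_form R X.

Definition sym_product (a : rat) g g' w w' : pre_form R X :=
  (1 / 2%:R) *: (wedgeF g w' + a *: wedgeF g' w).

Lemma sym_product_linear a c g g1 g' w w1 w' :
  sym_product a (c *: g + g1) g' (c *: w + w1) w' =
  c *: sym_product a g g' w w' + sym_product a g1 g' w1 w'.
Proof.
rewrite /sym_product wedgeFDl wedgeFZl wedgeFDr wedgeFZr.
move: (wedgeF g w') (wedgeF g1 w') (wedgeF g' w) (wedgeF g' w1) => e1 e2 e3 e4.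
move: (1 / 2) => h; rewrite !(scalerDr, scalerA) addrACA.
by congr (_ *: _ + _ *: _ + _); ring.
Qed.

Lemma sym_productC k g g' w w' :
  sym_product ((-1) ^+ k) g g' w w' = (-1) ^+ k *: sym_product ((-1) ^+ k) g' g w' w.
Proof.
rewrite /sym_product; move: (wedgeF _ _) (wedgeF _ _) => e1 e2.
have : (-1) ^+ k * (-1) ^+ k = 1 :> rat by rewrite -expr2 sqrr_sign.
move: ((-1) ^+ k) (1 / 2) => s h ss.
by rewrite !(scalerDr, scalerA) addrC [s * h]mulrC -[_ * s * s]mulrA ss mulr1.
Qed.

Lemma sym_product_PL a g g' w w' : g \in PL_forms R X -> g' \in PL_forms R X ->
  w \in PL_forms R X -> w' \in PL_forms R X -> sym_product a g g' w w' \in PL_forms R X.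
Proof.
move=> gC gC' wC wC'; have C1 := PL_wedgeF gC wC'; have C2 := PL_wedgeF gC' wC.
exact: (rpredZ (1 / 2%:R) (rpredD C1 (rpredZ a C2))).
Qed.

End SymProduct.

Section BM.
Variables (R : realType) (M : topologicalType).
Variables (alpha : forall p, {linear HPL R M p -> pre_form R M}).
Hypothesis Ha : closed_representatives alpha.
Variables (gamma : forall p, {linear Estar R M p -> pre_form R M}).
Hypothesis Hg : primitives alpha gamma.
Local Notation PL := (PL_forms R M).
Local Notation pos := positive_degrees.

Lemma alpha_cocycle p (x : HPL R M p) : alpha p x \in cocycle PL p.
Proof. by have [] := Ha x. Qed.

Lemma alpha2E d p q (x : HPL R M p) (y : HPL R M q) :
  (0 < p)%N -> (0 < q)%N -> (p + q)%N = d ->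
  alpha2 alpha d (monomial pos d (pair2 x y)) = wedgeF (alpha p x) (alpha q y).
Proof.
by apply: form_pow2E => p' x' _; have /cocycleP[] := alpha_cocycle x'.
Qed.

Lemma alpha2_cocycle d z : alpha2 alpha d z \in cocycle PL d.
Proof.
elim/Sym2_ind: z => [|a p q x y z p0 q0 pq IH]; first by rewrite linear0 rpred0.
by rewrite linearP alpha2E // rpredD ?rpredZ // -pq wedgeF_cocycle ?alpha_cocycle.
Qed.

Definition BM_term p q (e : Estar R M p) (f : Estar R M q) : pre_form R M :=
  sym_product ((-1) ^+ (p * q)) (gamma p e) (gamma q f)
    (alpha2 alpha p (sval e)) (alpha2 alpha q (sval f)).

Lemma BM_term_linear p q a (e e' : Estar R M p) (f : Estar R M q) :
  BM_term (a *: e + e') f = a *: BM_term e f + BM_term e' f.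
Proof.
have alphaP : alpha2 alpha p (sval (a *: e + e')) =
    a *: alpha2 alpha p (sval e) + alpha2 alpha p (sval e') by exact: linearP.
have gammaP : gamma p (a *: e + e') = a *: gamma p e + gamma p e' by exact: linearP.
exact: (eq_trans (f_equal2 (fun g w => sym_product _ g _ w _) gammaP alphaP) (sym_product_linear _ _ _ _ _ _ _ _)).
Qed.

Lemma BM_termC p q (e : Estar R M p) (f : Estar R M q) :
  BM_term e f = (-1) ^+ (p * q) *: BM_term f e.
Proof. by rewrite /BM_term [(q * p)%N]mulnC; exact: sym_productC. Qed.

Lemma BM_formE d p q (e : Estar R M p) (f : Estar R M q) : (p + q)%N = d ->
  BM_form alpha gamma d (monomial all_degrees d (pair2 e f)) = BM_term e f.
Proof.
move=> pq; apply: (@induced2E all_degrees (Estar R M) d (pre_form R M) BM_term);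
  [by move=> *; exact: BM_term_linear|by move=> *; exact: BM_termC|by []|by []|exact: pq].
Qed.

(** By graded commutativity both summands have this same differential, and the factor 1/2
    compensates. *)
Lemma dform_BM_term p q (e : Estar R M p) (f : Estar R M q) :
  dform (BM_term e f) = wedgeF (alpha2 alpha p (sval e)) (alpha2 alpha q (sval f)).
Proof.
have [gC gh dg] := Hg e; have [gC' gh' dg'] := Hg f.
rewrite /BM_term dformZ dformD dformZ.
rewrite (dform_wedgeF_cocycler gh (alpha2_cocycle _)) (dform_wedgeF_cocycler gh' (alpha2_cocycle _)).
have /cocycleP[_ ep _] := alpha2_cocycle (sval e); have /cocycleP[_ fp _] := alpha2_cocycle (sval f).
rewrite dg dg' -(wedgeFC ep fp) -mulr2n -scaler_nat scalerA.
by rewrite mul1r mulVf ?scale1r.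
Qed.

Lemma BM_term_PL p q (e : Estar R M p) (f : Estar R M q) : BM_term e f \in PL.
Proof.
have [gC _ _] := Hg e; have [gC' _ _] := Hg f.
have /cocycleP[eC _ _] := alpha2_cocycle (sval e); have /cocycleP[fC _ _] := alpha2_cocycle (sval f).
exact (sym_product_PL _ gC gC' eC fC).
Qed.

Lemma BM_form_PL d b : BM_form alpha gamma d b \in PL.
Proof.
elim/Sym2_ind: b => [|a p q x y z _ _ pq IH]; first by rewrite linear0 rpred0.
rewrite linearP (BM_formE _ _ pq).
exact: (rpredD (rpredZ a (BM_term_PL x y)) IH).
Qed.

(** By [form_pow4] the differential factors through the full symmetrisation. Closedness makes the
    integral insensitive to the boundary that [bounds] allows to be added to [zM]. *)
Lemma dform_BM_form d b : full_sym R M d b = 0 -> dform (BM_form alpha gamma d b) = 0.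
Proof.
have Ah p (x : HPL R M p) : pos p -> alpha p x \in homog R M p.
  by have /cocycleP[] := alpha_cocycle x.
have [L LE] := form_pow4 Ah d.
suff -> : dform (BM_form alpha gamma d b) = L (full_sym R M d b) by move=> ->; exact: linear0.
elim/Sym2_ind: b => [|a p q x y z _ _ pq IH].
  by rewrite !linear0.
rewrite 2!linearP dformD dformZ IH (BM_formE _ _ pq) (full_symE _ _ pq) linearP (LE _ _ _ _ pq).
by rewrite dform_BM_term.
Qed.

End BM.

(** * The intersection form of the coboundary *)

#[local] Opaque alpha2 BM_form full_sym cup_G2 form_pow2.

Lemma homog_dform_pred (R : realType) (X : topologicalType) p (w : pre_form R X) :
  (0 < p)%N -> w \in homog R X p.-1 -> dform w \in homog R X p.
Proof. by case: p => // p _; exact: homog_dform. Qed.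

(** Used for the integrals I of beta(e) beta(f) and J of beta(f) beta(e), with x that of alpha^2(e)
    alpha^2(f) over W and y, z the boundary terms: the mean of I and a J has the symmetrised
    boundary term of [F_M]. *)
Lemma symmetrize (I J x y z a b : rat) : a * b = 1 ->
  I = x + y -> J = b * x + z -> I = a * J -> I = x + 1 / 2%:R * (y + a * z).
Proof. by move=> ab E1 ->; rewrite mulrDr mulrA ab mul1r => E2; lra. Qed.

Section Coboundary.
Variables (R : realType) (n m : nat) (M W : topologicalType) (iota : continuousType M W).
Variables (zM : chain R M m) (zW : chain R W m.+1) (s : int).
Hypotheses (n2 : (2 <= n)%N) (HM : highly_connected R M n.-1) (iotaI : injective iota).
Variable b0 : chain R M m.+1.
Hypothesis Hb0 : chain_boundary zW = - chain_push iota (zM + chain_boundary b0).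
Hypothesis sE : s = m%:Z - (3 * n)%N%:Z + 1.
Variables (r : forall p, {linear HPL R M p -> HPL R W p}).
Hypothesis Hr : right_inverse_upto iota r s.
Variables (alpha : forall p, {linear HPL R M p -> pre_form R M}).
Hypothesis Ha : closed_representatives alpha.
Variables (gamma : forall p, {linear Estar R M p -> pre_form R M}).
Hypothesis Hg : primitives alpha gamma.
Local Notation PLW := (PL_forms R W).
Local Notation pos := positive_degrees.
Local Notation res := (restrict_form iota).

(** In degrees above s, where [r] need not be a right inverse, the lift is set to 0, so that linear
    choices exist in all degrees; by [alphahat2_low] this does no harm up to degree n + s. *)
Definition lifts p (x : HPL R M p) (w : pre_form R W) : Prop :=
  w \in cocycle PLW p /\
  if p%:Z <= s then res w = alpha p x /\ class PLW p w = r p x else w = 0.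

Lemma lifts_linear p a (x : HPL R M p) w (x' : HPL R M p) w' :
  lifts x w -> lifts x' w' -> lifts (a *: x + x') (a *: w + w').
Proof.
move=> [Hw1 Hw2] [Hw1' Hw2']; split; first exact: (rpredD (rpredZ a Hw1) Hw1').
case: ifP Hw2 Hw2' => _ => [[E1 E2] [E1' E2']|-> ->]; last by rewrite scaler0 addr0.
rewrite (classP _ Hw1 Hw1') E2 E2' linearP; split; last by rewrite linearP.
by rewrite -E1 -E1'.
Qed.

(** On M, a representative of r(x) differs from alpha(x) by some d u. Extending u to v over W and
    adding d v corrects the restriction without changing the class. *)
Lemma lifts_total p (x : HPL R M p) : exists w, lifts x w.
Proof.
have [ps|/negPf ps] := boolP (p%:Z <= s); last first.
  by exists 0; split; [exact: rpred0 | rewrite ps].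
rewrite /lifts ps.
have Hrep := rep_cocycle (r p x).
have Hal := alpha_cocycle Ha x.
have [|u uC [up Eu]] := @pullbackH_rep _ _ _ iota p (r p x) _ Hal.
  by rewrite Hr // (proj2 (Ha x)).
(* In degree 0 the exact form d u is 0, and there is nothing to correct. *)
have [p0|p0] := posnP p.
  exists (rep (r p x)); split=> //; split; last exact: class_rep.
  apply/esym/eqP; rewrite -subr_eq0; apply/eqP; rewrite Eu -(@hpartF_id _ _ 0 (dform u)) ?hpart0_d //.
  rewrite -Eu; have [_ h1 _] := cocycleP _ _ _ Hal.
  have [_ h2 _] := cocycleP _ _ _ (restrict_cocycle iota Hrep).
  by rewrite -p0; exact: rpredB.
have [v vC [vp Ev]] := PL_forms_extend iotaI uC up.
have Hdv : dform v \in cocycle PLW p.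
  apply/cocycleP; split; [exact: PL_dform| |exact: dform_dform].
  exact: homog_dform_pred p0 vp.
have Hs : rep (r p x) + dform v \in cocycle PLW p by exact: rpredD.
exists (rep (r p x) + dform v); split=> //; split.
  by rewrite raddfD /= restrict_dform Ev -Eu addrC subrK.
rewrite -[RHS]class_rep; apply/(class_eq Hs Hrep); exists v => //.
by rewrite addrC addKr.
Qed.

Lemma alphahat_exists : exists alphahat : forall p, {linear HPL R M p -> pre_form R W},
  forall p x, lifts x (alphahat p x).
Proof.
have H p := linear_selection (@lifts_linear p) (@lifts_total p).
by exists (fun p => projT1 (cid (H p))) => p x; exact: (projT2 (cid (H p))).
Qed.

Definition extends_gamma p (e : Estar R M p) (w : pre_form R W) : Prop :=
  [/\ w \in PLW, w \in homog R W p.-1 & res w = gamma p e].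

Lemma gammahat_exists : exists gammahat : forall p, {linear Estar R M p -> pre_form R W},
  forall p e, extends_gamma e (gammahat p e).
Proof.
have H p : exists f : {linear Estar R M p -> pre_form R W}, forall e, extends_gamma e (f e).
  apply: linear_selection => [a e w e' w' [w1 w2 w3] [w1' w2' w3']|e].
    split; [exact: (rpredD (rpredZ a w1) w1')|exact: (rpredD (rpredZ a w2) w2')|].
    by rewrite [RHS]linearP -w3 -w3'.
  have [gC gh _] := Hg e; have [w wC [wh wE]] := PL_forms_extend iotaI gC gh.
  by exists w.
by exists (fun p => projT1 (cid (H p))) => p x; exact: (projT2 (cid (H p))).
Qed.

Lemma integral_dform_relative w : w \in PLW -> res w = 0 -> integral zW (dform w) = 0.
Proof. by move=> wC w0; rewrite stokes // Hb0 integralNc integral_push w0 integral0 oppr0. Qed.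

Lemma integral_dform_boundary w : w \in PLW ->
  integral zW (dform w) = - integral (zM + chain_boundary b0) (res w).
Proof. by move=> wC; rewrite stokes // Hb0 integralNc integral_push. Qed.

Lemma integral_wedgeF_exactr p w u : w \in cocycle (relative_PL_forms iota) p -> u \in PLW ->
  integral zW (wedgeF w (dform u)) = 0.
Proof.
move=> /relative_cocycleP[Hw w0] uC; have [wC _ _] := cocycleP _ _ _ Hw.
have := dform_wedgeF_cocyclel u Hw => /(congr1 ( *:%R ((-1) ^+ p))).
rewrite scalerA -expr2 sqrr_sign scale1r => <-.
rewrite integralZ integral_dform_relative ?mulr0 ?PL_wedgeF //.
by rewrite restrict_wedgeF w0 wedgeF0l.
Qed.

Lemma integral_wedgeF_exactl p q u w : u \in homog R W q -> u \in PLW ->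
  w \in cocycle (relative_PL_forms iota) p -> integral zW (wedgeF (dform u) w) = 0.
Proof.
move=> uh uC /relative_cocycleP[Hw w0]; have [wC _ _] := cocycleP _ _ _ Hw.
rewrite -(dform_wedgeF_cocycler uh Hw) integral_dform_relative ?PL_wedgeF //.
by rewrite restrict_wedgeF w0 wedgeF0r.
Qed.

(* By Stokes' theorem, changing one of the factors by an exact form does not
   change the integral, as the other factor vanishes on M. *)
Lemma intersection_formE p q (w v : pre_form R W) :
  w \in cocycle (relative_PL_forms iota) p -> v \in cocycle (relative_PL_forms iota) q ->
  intersection_form iota zW (class PLW p w) (class PLW q v) = integral zW (wedgeF w v).
Proof.
move=> Hw Hv; rewrite /intersection_form; set u := xget _ _.
have uE : rel_to_abs u = class PLW p w.
  rewrite /u; case: xgetP => [//|/(_ (class (relative_PL_forms iota) p w))[]].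
  exact: rel_to_abs_class.
have Hu := rep_cocycle u.
have [Hw' w0] := relative_cocycleP _ _ _ Hw; have [Hv' v0] := relative_cocycleP _ _ _ Hv.
have [Hu' u0] := relative_cocycleP _ _ _ Hu.
have [t tC [th Et]] := PL_class_eq Hu' Hw' uE.
have [t' tC' [th' Et']] := PL_class_eq (rep_cocycle _) Hv' (class_rep (class PLW q v)).
rewrite -[rep (class _ _ _)](subrK v) Et' wedgeFDr integralD (integral_wedgeF_exactr Hu tC') add0r.
by rewrite -[rep u](subrK w) Et wedgeFDl integralD (integral_wedgeF_exactl th tC Hv) add0r.
Qed.

Variables (alphahat : forall p, {linear HPL R M p -> pre_form R W}).
Hypothesis Halphahat : forall p x, lifts x (alphahat p x).
Variables (gammahat : forall p, {linear Estar R M p -> pre_form R W}).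
Hypothesis Hgammahat : forall p e, extends_gamma e (gammahat p e).

Let alphahat_homog p (x : HPL R M p) : pos p -> alphahat p x \in homog R W p.
Proof. by move=> _; have [/cocycleP[]] := Halphahat x. Qed.

Definition alphahat2 d : {linear Sym 2 pos (HPL R M) d -> pre_form R W} := form_pow2 pos alphahat d.

Lemma alphahat2E d p q (x : HPL R M p) (y : HPL R M q) : (0 < p)%N -> (0 < q)%N -> (p + q)%N = d ->
  alphahat2 d (monomial pos d (pair2 x y)) = wedgeF (alphahat p x) (alphahat q y).
Proof. by move=> p0 q0 pq; exact: (form_pow2E alphahat_homog). Qed.

Lemma alphahat2_cocycle d z : alphahat2 d z \in cocycle PLW d.
Proof.
elim/Sym2_ind: z => [|a p q x y z p0 q0 pq IH]; first by rewrite linear0 rpred0.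
rewrite linearP (alphahat2E _ _ p0 q0 pq); apply: (rpredD (rpredZ a _) IH).
by rewrite -pq wedgeF_cocycle //; [have [] := Halphahat x|have [] := Halphahat y].
Qed.

Let hat2 d p q (x : HPL R M p) (y : HPL R M q) : HPL R W d :=
  if (p%:Z <= s) && (q%:Z <= s) then cup d (r p x) (r q y) else 0.

Let hat2_linear d p q a (x x' : HPL R M p) (y : HPL R M q) : (p + q)%N = d ->
  hat2 d (a *: x + x') y = a *: hat2 d x y + hat2 d x' y.
Proof.
rewrite /hat2; case: (_ && _) => pq; first by rewrite linearP (cupPl _ _ _ _ pq).
by rewrite scaler0 addr0.
Qed.

Let hat2C d p q (x : HPL R M p) (y : HPL R M q) : (p + q)%N = d ->
  hat2 d x y = (-1) ^+ (p * q) *: hat2 d y x.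
Proof.
rewrite /hat2 andbC; case: (_ && _) => pq; first exact: cupC.
by rewrite scaler0.
Qed.

Lemma hat_G2E d p q (x : HPL R M p) (y : HPL R M q) : (0 < p)%N -> (0 < q)%N -> (p + q)%N = d ->
  hat_G2 r s d (monomial pos d (pair2 x y)) =
  if (p%:Z <= s) && (q%:Z <= s) then cup d (r p x) (r q y) else 0.
Proof.
move=> p0 q0 pq; apply: (@induced2E pos (HPL R M) d (HPL R W d) (hat2 d));
  [ | |exact: p0|exact: q0|exact: pq].
- by move=> *; exact: hat2_linear.
- by move=> *; exact: hat2C.
Qed.

(** If p + q <= n + s and p > s, then 0 < q < n and the class of degree q is 0. Otherwise both
    degrees are at most s, where [alphahat] restricts to [alpha] and represents [r]. *)
Lemma alphahat2_low d z : d%:Z <= n%:Z + s ->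
  res (alphahat2 d z) = alpha2 alpha d z /\ class PLW d (alphahat2 d z) = hat_G2 r s d z.
Proof.
move=> ds; elim/Sym2_ind: z => [|a p q x y z p0 q0 pq [IH1 IH2]].
  by rewrite !linear0 class0.
have Hm := alphahat2_cocycle (monomial pos d (pair2 x y)).
have resP w w' : res (a *: w + w') = a *: res w + res w' by [].
rewrite (linearP (alphahat2 d)) (linearP (alpha2 alpha d)) (linearP (hat_G2 r s d)).
rewrite (classP _ Hm (alphahat2_cocycle z)) resP IH1 IH2.
suff [-> ->] : res (alphahat2 d (monomial pos d (pair2 x y))) = alpha2 alpha d (monomial pos d (pair2 x y)) /\
   class PLW d (alphahat2 d (monomial pos d (pair2 x y))) = hat_G2 r s d (monomial pos d (pair2 x y)) by [].
have [ps|/negPf ps] := boolP (p%:Z <= s); last first.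
  have -> : y = 0.
    by apply: (HPL_eq0 y HM); apply/andP; split=> //; move: ps; rewrite -pq in ds; lia.
  have := monomial0 pos d (pair2 x y) ord_max q; rewrite htuple_set1 => ->.
  by rewrite !linear0 class0.
have [qs|/negPf qs] := boolP (q%:Z <= s); last first.
  have -> : x = 0.
    by apply: (HPL_eq0 x HM); apply/andP; split=> //; move: qs; rewrite -pq in ds; lia.
  have := monomial0 pos d (pair2 x y) ord0 p; rewrite htuple_set0 => ->.
  by rewrite !linear0 class0.
rewrite (alphahat2E _ _ p0 q0 pq) (alpha2E Ha _ _ p0 q0 pq) (hat_G2E _ _ p0 q0 pq) ps qs.
have [Hx] := Halphahat x; have [Hy] := Halphahat y; rewrite ps qs => -[y1 y2] [x1 x2].
by rewrite restrict_wedgeF x1 y1 -x2 -y2 (cup_class pq).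
Qed.

(* m + 1 - (n + s) = 2n *)
Lemma small_eq0 p q (e : Estar R M p) : (p + q)%N = m.+1 -> ~~ (q%:Z <= n%:Z + s) -> e = 0.
Proof. by move=> pq qs; apply: (Estar_eq0 HM); lia. Qed.

Definition beta p (e : Estar R M p) : pre_form R W := alphahat2 p (sval e) - dform (gammahat p e).

Lemma beta_linear p a (e e' : Estar R M p) : beta (a *: e + e') = a *: beta e + beta e'.
Proof.
have alphahat2P : alphahat2 p (sval (a *: e + e')) = a *: alphahat2 p (sval e) + alphahat2 p (sval e') by exact: linearP.
have gammahatP : gammahat p (a *: e + e') = a *: gammahat p e + gammahat p e' by exact: linearP.
rewrite /beta; apply: (eq_trans (f_equal2 (fun x y => x - dform y) alphahat2P gammahatP)).
by rewrite dformD dformZ scalerBr opprD addrACA.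
Qed.

Lemma beta0 p : beta (0 : Estar R M p) = 0.
Proof. by have := beta_linear 1 (0 : Estar R M p) 0; rewrite !scale1r addr0 => /eqP;
  rewrite addrC -subr_eq subrr eq_sym => /eqP. Qed.

Lemma beta_cocycle p (e : Estar R M p) : beta e \in cocycle PLW p.
Proof.
have [p0|p0] := posnP p.
  have -> : e = 0 by apply: (Estar_eq0 HM); rewrite p0.
  by rewrite beta0 rpred0.
have [gC gh _] := Hgammahat e; apply: (rpredB (alphahat2_cocycle _)).
apply/cocycleP; split; [exact: PL_dform| |exact: dform_dform].
exact: homog_dform_pred p0 gh.
Qed.

Lemma beta_relative p (e : Estar R M p) : p%:Z <= n%:Z + s ->
  beta e \in cocycle (relative_PL_forms iota) p.
Proof.
move=> ps; apply/relative_cocycleP; split; first exact: beta_cocycle.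
have [_ _ dg] := Hg e; have [_ _ gE] := Hgammahat e; have [rE _] := alphahat2_low (sval e) ps.
have -> : res (beta e) = res (alphahat2 p (sval e)) - dform (res (gammahat p e)) by [].
by rewrite rE gE dg subrr.
Qed.

Lemma class_beta p (e : Estar R M p) : p%:Z <= n%:Z + s -> class PLW p (beta e) = hat r s e.
Proof.
rewrite /hat => ps; have [_ <-] := alphahat2_low (sval e) ps; have [gC gh _] := Hgammahat e.
apply/(class_eq (beta_cocycle e) (alphahat2_cocycle _)); exists (- gammahat p e); first by rewrite rpredN.
by rewrite /beta addrAC subrr add0r raddfN.
Qed.

Lemma integral_betaC p q (e : Estar R M p) (f : Estar R M q) :
  integral zW (wedgeF (beta e) (beta f)) = (-1) ^+ (p * q) * integral zW (wedgeF (beta f) (beta e)).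
Proof.
have /cocycleP[_ e1 _] := beta_cocycle e; have /cocycleP[_ f1 _] := beta_cocycle f.
by rewrite (wedgeFC e1 f1) integralZ.
Qed.

(** If one degree exceeds n + s, the other factor is 0 by [small_eq0], and the default value 0
    agrees with the integral. *)
Lemma intersection_beta p q (e : Estar R M p) (f : Estar R M q) : (p + q)%N = m.+1 ->
  (if (p%:Z <= n%:Z + s) && (q%:Z <= n%:Z + s)
   then intersection_form iota zW (hat r s e) (hat r s f) else 0) =
  integral zW (wedgeF (beta e) (beta f)).
Proof.
move=> pq; have [ps|ps] := boolP (p%:Z <= _); last first.
  by rewrite (@small_eq0 q p f) 1?addnC // beta0 wedgeF0r integral0.
have [qs|qs] := boolP (q%:Z <= _); last first.
  by rewrite (@small_eq0 p q e) // beta0 wedgeF0l integral0.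
by rewrite -!class_beta // intersection_formE // beta_relative.
Qed.

(** The integral of beta(e) beta(f) is visibly bilinear and graded symmetric. Hence so is the
    formula in [A_W], despite its chosen preimage and representatives, and [induced] does not take
    its default value. *)
Lemma A_WE p q (e : Estar R M p) (f : Estar R M q) : (p + q)%N = m.+1 ->
  A_W iota r n s zW (monomial all_degrees m.+1 (pair2 e f)) = integral zW (wedgeF (beta e) (beta f)).
Proof.
move=> pq; rewrite -(intersection_beta _ _ pq).
pose Bl p q (e : Estar R M p) (f : Estar R M q) : rat^o :=
  if (p%:Z <= n%:Z + s) && (q%:Z <= n%:Z + s)
   then intersection_form iota zW (hat r s e) (hat r s f) : rat^o else 0.
have BlE p' q' (x : Estar R M p') (y : Estar R M q') : (p' + q')%N = m.+1 ->
  Bl p' q' x y = integral zW (wedgeF (beta x) (beta y)) by exact: intersection_beta.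
apply: (@induced2E all_degrees (Estar R M) m.+1 rat^o Bl); [| |by []|by []|exact: pq].
  move=> p' q' a x x' y _ _ E; rewrite 3!(BlE _ _ _ _ E) beta_linear.
  by rewrite wedgeFDl wedgeFZl integralD integralZ.
move=> p' q' x y _ _ E; have E' : (q' + p')%N = m.+1 by rewrite addnC.
by rewrite (BlE _ _ _ _ E) (BlE _ _ _ _ E'); exact: integral_betaC.
Qed.

Lemma integral_beta_alphahat2 p q (e : Estar R M p) (f : Estar R M q) : (p + q)%N = m.+1 ->
  integral zW (wedgeF (beta e) (beta f)) = integral zW (wedgeF (beta e) (alphahat2 q (sval f))).
Proof.
move=> pq; have [ps|ps] := boolP (p%:Z <= n%:Z + s); last first.
  rewrite (@small_eq0 q p f) 1?addnC // beta0 wedgeF0r.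
  have -> : alphahat2 q (sval (0 : Estar R M q)) = 0 by exact: linear0.
  by rewrite wedgeF0r.
have [fC _ _] := Hgammahat f.
by rewrite [beta f]/beta wedgeFBr integralB (integral_wedgeF_exactr (beta_relative _ ps) fC) subr0.
Qed.

(** Stokes' theorem for the product of gamma^(e) and alpha^2(f); the minus sign of [bounds] cancels
    the one in beta. *)
Lemma integral_beta_alphahat2E p q (e : Estar R M p) (f : Estar R M q) :
  integral zW (wedgeF (beta e) (alphahat2 q (sval f))) =
  integral zW (wedgeF (alphahat2 p (sval e)) (alphahat2 q (sval f)))
  + integral (zM + chain_boundary b0) (wedgeF (gamma p e) (res (alphahat2 q (sval f)))).
Proof.
have [gC gh gE] := Hgammahat e; have fC := alphahat2_cocycle (sval f); have [fPL _ _] := cocycleP _ _ _ fC.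
rewrite [beta e]/beta wedgeFBl integralB -(dform_wedgeF_cocycler gh fC).
rewrite (integral_dform_boundary (PL_wedgeF gC fPL)) opprK restrict_wedgeF.
have -> // : res (gammahat p e) = gamma p e by exact: gE.
Qed.

(** For q > n + s the form alpha^2(f) on W need not restrict to the one on M, but then e = 0. *)
Lemma gamma_res_alphahat2 p q (e : Estar R M p) (f : Estar R M q) : (p + q)%N = m.+1 ->
  wedgeF (gamma p e) (res (alphahat2 q (sval f))) = wedgeF (gamma p e) (alpha2 alpha q (sval f)).
Proof.
move=> pq; have [qs|qs] := boolP (q%:Z <= n%:Z + s); first by have [-> _] := alphahat2_low (sval f) qs.
rewrite (@small_eq0 p q e) //.
have -> : gamma p 0 = 0 by exact: linear0.
by rewrite !wedgeF0l.
Qed.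

Lemma A_W_monomial p q (e : Estar R M p) (f : Estar R M q) : (p + q)%N = m.+1 ->
  A_W iota r n s zW (monomial all_degrees m.+1 (pair2 e f)) =
  integral zW (wedgeF (alphahat2 p (sval e)) (alphahat2 q (sval f)))
  + integral (zM + chain_boundary b0) (BM_term alpha gamma e f).
Proof.
move=> pq; have qp : (q + p)%N = m.+1 by rewrite addnC.
have E1 := integral_beta_alphahat2 e f pq; have E2 := integral_beta_alphahat2 f e qp.
rewrite !integral_beta_alphahat2E !gamma_res_alphahat2 // in E1 E2.
have /cocycleP[_ e1 _] := alphahat2_cocycle (sval e); have /cocycleP[_ f1 _] := alphahat2_cocycle (sval f).
have Es := integral_betaC e f.
rewrite A_WE // /BM_term /sym_product integralZ integralD integralZ.
rewrite (wedgeFC f1 e1) integralZ in E2.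
have ss : (-1) ^+ (p * q) * (-1) ^+ (q * p) = 1 :> rat by rewrite [(q * p)%N]mulnC -expr2 sqrr_sign.
exact (symmetrize ss E1 E2 Es).
Qed.

Lemma A_W_F_M b : full_sym R M m.+1 b = 0 -> A_W iota r n s zW b = F_M alpha gamma zM b.
Proof.
move=> b_sym; have [L LE] := form_pow4 alphahat_homog m.+1.
(* This holds on the whole of G^2 E in degree m + 1, and by linearity may be checked on
   monomials. *)
have -> : A_W iota r n s zW b = integral zW (L (full_sym R M m.+1 b))
    + integral (zM + chain_boundary b0) (BM_form alpha gamma m.+1 b).
  elim/Sym2_ind: b {b_sym} => [|a p q x y z _ _ pq IH].
    by rewrite !linear0 !integral0 addr0.
  have full_symP : full_sym R M m.+1 (a *: monomial all_degrees m.+1 (pair2 x y) + z) =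
      a *: Sym22_mul m.+1 (sval x) (sval y) + full_sym R M m.+1 z.
    by rewrite linearP (full_symE _ _ pq).
  have BM_formP : BM_form alpha gamma m.+1 (a *: monomial all_degrees m.+1 (pair2 x y) + z) =
      a *: BM_term alpha gamma x y + BM_form alpha gamma m.+1 z.
    by rewrite linearP (BM_formE _ _ _ _ pq).
  have A_WP : A_W iota r n s zW (a *: monomial all_degrees m.+1 (pair2 x y) + z) =
      a * A_W iota r n s zW (monomial all_degrees m.+1 (pair2 x y)) + A_W iota r n s zW z.
    exact: linearP.
  rewrite A_WP full_symP BM_formP IH (A_W_monomial _ _ pq) linearP (LE _ _ _ _ pq).
  rewrite !integralD !integralZ; ring.
(* On B the integral over W vanishes, and as the Bianchi-Massey form is closed, so does its integral
   over the boundary of b0. *)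
rewrite b_sym linear0 integral0 add0r integralDc -stokes; last exact: BM_form_PL.
by rewrite (dform_BM_form Ha Hg b_sym) integral0 addr0.
Qed.

End Coboundary.

Theorem lemma4p1 (R : realType) (n m : nat) (M W : topologicalType)
    (iota : continuousType M W) (zM : chain R M m) (zW : chain R W m.+1) :
  (2 <= n)%N ->
  closed_manifold R M m ->
  highly_connected R M n.-1 ->
  compact_manifold R W m.+1 ->
  boundary_inclusion R iota m ->
  fundamental_cycle zM ->
  fundamental_cycle zW ->
  bounds iota zW zM ->
  let s : int := m%:Z - (3 * n)%N%:Z + 1 in
  coboundary_over R iota s ->
  forall r : (forall p, {linear HPL R M p -> HPL R W p}),
  right_inverse_upto iota r s ->
  forall alpha : (forall p, {linear HPL R M p -> pre_form R M}),
  closed_representatives alpha ->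
  forall gamma : (forall p, {linear Estar R M p -> pre_form R M}),
  primitives alpha gamma ->
  forall b : Sym 2 all_degrees (Estar R M) m.+1, Bspace b ->
    A_W iota r n s zW b = F_M alpha gamma zM b.
Proof.
move=> n2 _ HM _ [iotaI _] _ _ [b0 Hb0] s _ r Hr alpha Ha gamma Hg b /= Hb.
have [AH HAH] := alphahat_exists iotaI Hr Ha.
have [GH HGH] := gammahat_exists iotaI Hg.
exact: (A_W_F_M n2 HM Hb0 erefl Ha Hg HAH HGH).
Qed.
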